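(* Let $n\ge 3$, let $0\le k\le n/2$ be an integer with $2k\ne n$ (i.e. $k$ is not $\pi$-modular), and take signature $(r,s)=(n-1,1)$. Then the Krämer condition implies the strengthened spin condition. Precisely: for every $O_F$-algebra $R$ and every family $(\mathcal F_i^0\subset\mathcal F_i\subset\Lambda_i\otimes_{O_{F_0}}R)_{i\in[k]}$ in $M^{\mathrm{Kra}}_{[k]}(R)$, the family $(\mathcal F_i)_{i\in[k]}$ defines an $R$-point of the canonical local model $M^{\mathrm{loc}}_{[k]}$; that is, the closed immersion $M^{\mathrm{nspl}}_{[k]}\hookrightarrow M^{\mathrm{Kra}}_{[k]}$ is an isomorphism.
   Context: Setting. $F/F_0$ is a ramified quadratic extension of complete discretely valued fields with rings of integers $O_F, O_{F_0}$, common residue field $\mathbb F_q$ of odd characteristic, and uniformizers $\pi\in F$, $\pi_0\in F_0$ with $\pi^2=\pi_0$; $a\mapsto\bar a$ is the nontrivial automorphism of $F/F_0$. The space $F^n$ has standard basis $e_1,\dots,e_n$ and hermitian form $\phi(ae_i,be_j)=\bar a b\,\delta_{i,n+1-j}$; put $(x,y)=\frac12\mathrm{tr}_{F/F_0}\phi(x,y)$. For $i=bn+c$ with $0\le c<n$ let $\Lambda_i=\sum_{j\le c}\pi^{-b-1}O_Fe_j+\sum_{j>c}\pi^{-b}O_Fe_j$; then $\Lambda_{n-i}$ is the dual of $\Lambda_i$ for $(\,,\,)$. For $0\le k\le n/2$ put $[k]=\{\pm k\}+n\mathbb Z$. For an $O_F$-algebra $R$, write $\Pi=\pi\otimes 1$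 and $\pi=1\otimes\pi$ in $O_F\otimes_{O_{F_0}}R$. Local model. $M^{\mathrm{naive}}_{[k]}$ is the projective $O_F$-scheme whose $R$-points are families $(\mathcal F_i\subset\Lambda_i\otimes_{O_{F_0}}R)_{i\in[k]}$ such that: (LM1) $\mathcal F_i$ is an $O_F\otimes_{O_{F_0}}R$-submodule and an $R$-direct summand of rank $n$; (LM2) for $i<j$ the map induced by $\Lambda_i\subset\Lambda_j$ sends $\mathcal F_i$ into $\mathcal F_j$; (LM3) the isomorphism $\pi\otimes1:\Lambda_i\otimes R\to\Lambda_{i-n}\otimes R$ identifies $\mathcal F_i$ with $\mathcal F_{i-n}$; (LM4) under the perfect pairing $(\,,\,)\otimes R$ between $\Lambda_i\otimes R$ and $\Lambda_{n-i}\otimes R$ one has $\mathcal F_i^\perp=\mathcal F_{n-i}$; (LM5) $\det(T\cdot\mathrm{id}-\Pi\mid\mathcal F_i)=(T+\pi)^{n-1}(T-\pi)$. The canonical local model $M^{\mathrm{loc}}_{[k]}$ is the scheme-theoretic closure of the generic fiber in $M^{\mathrm{naive}}_{[k]}$. The strengthened spin condition on a family $(\mathcal F_i)$ is (by known results, in this signature and for non-$\pi$-modular $k$) equivalent to $(\mathcal F_i)$ being a point of $M^{\mathrm{loc}}_{[k]}$. Krämer model. $M^{\mathrm{Kra}}_{[k]}$ is the $O_F$-scheme whose $R$-points are families $(\mathcal F_i^0\subset\mathcal F_i\subset\Lambda_i\otimes_{O_{F_0}}R)_{i\in[k]}$ such that: $(\mathcal F_i)$ satisfies (LM1)–(LM4)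 (but (LM5) is not imposed); $\mathcal F_i^0$ is an $O_F\otimes_{O_{F_0}}R$-submodule and an $R$-direct summand of rank $1$; for $i<j$ the transition map sends $\mathcal F_i^0$ into $\mathcal F_j^0$; the isomorphism $\pi\otimes1:\Lambda_i\otimes R\to\Lambda_{i-n}\otimes R$ identifies $\mathcal F_i^0$ with $\mathcal F_{i-n}^0$; and the Krämer condition holds: $(\Pi+\pi)(\mathcal F_i)\subset\mathcal F_i^0$, $(\Pi-\pi)(\mathcal F_i^0)=0$. The naive splitting model $M^{\mathrm{nspl}}_{[k]}\subset M^{\mathrm{Kra}}_{[k]}$ is the closed subfunctor of families such that $(\mathcal F_i)_{i\in[k]}$ is an $R$-point of $M^{\mathrm{loc}}_{[k]}$. *)

(* Defs.v *)
(* Algebras over O_F are nonzero commutative rings (comAlgType); over the zero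
   ring every functor below would be a single point.  Classical sets serve as
   extensional predicates. *)
From HB Require Import structures.
From mathcomp Require Import all_boot all_order all_algebra all_field.
From mathcomp Require Import boolp classical_sets.
From mathcomp Require Import zify.
Set Implicit Arguments.
Unset Strict Implicit.
Unset Printing Implicit Defensive.
Import Order.TTheory GRing.Theory Num.Theory.
Local Open Scope classical_set_scope.
Local Open Scope ring_scope.

(* [val_ge w N x] is "w(x) >= N" with the convention w(0) = +oo; the value of
   the underlying function at 0 is junk and never used. *)
Definition val_ge (K : fieldType) (w : K -> int) (N : int) : {pred K} :=
  fun x => (x == 0) || (N <= w x).

Record cdvaluation (K : fieldType) := CDValuation {
  dv :> K -> int;
  dvM : forall x y, x != 0 -> y != 0 -> dv (x * y) = dv x + dv y;
  dvD : forall N x y, val_ge dv N x -> val_ge dv N y -> val_ge dv N (x + y);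
  dv_surj : forall N : int, exists2 x, x != 0 & dv x = N;
  dv_complete : forall u : nat -> K,
    (forall N, exists m, forall p q, (m <= p)%N -> (m <= q)%N ->
       val_ge dv N (u p - u q)) ->
    exists l, forall N, exists m, forall p, (m <= p)%N -> val_ge dv N (u p - l) }.

Section RingOfIntegers.
Variables (K : fieldType) (w : cdvaluation K).

Definition integers : {pred K} := val_ge w 0.

Lemma dv1 : w 1 = 0.
Proof.
have := dvM w (oner_neq0 K) (oner_neq0 K).
by rewrite mulr1 -[X in X = _]addr0 => /addrI.
Qed.

Lemma dvN1 : w (-1) = 0.
Proof.
have n1 : (-1 : K) != 0 by rewrite oppr_eq0 oner_neq0.
have := dvM w n1 n1; rewrite mulrNN mulr1 dv1 => /esym/eqP.
by rewrite -mulr2n mulrn_eq0 => /eqP.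
Qed.

Lemma val_geM N M x y :
  val_ge w N x -> val_ge w M y -> val_ge w (N + M) (x * y).
Proof.
rewrite /val_ge; have [->|x0] := eqVneq x 0; first by rewrite mul0r eqxx.
have [->|y0] := eqVneq y 0; first by rewrite mulr0 eqxx.
by move=> /= Nx My; rewrite dvM // lerD // orbT.
Qed.

Lemma integers_subring : subring_closed integers.
Proof.
have i1 : integers 1 by rewrite /integers /val_ge dv1 lexx orbT.
have iN1 : integers (-1) by rewrite /integers /val_ge dvN1 lexx orbT.
have iM x y : integers x -> integers y -> integers (x * y).
  by move=> ix iy; have := val_geM ix iy; rewrite addr0.
split=> [//|x y ix iy|x y]; last exact: iM.
by apply: dvD => //; rewrite -mulN1r; apply: iM.
Qed.

HB.instance Definition _ :=
  GRing.isSubringClosed.Build K integers integers_subring.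

Record int_ring := IntRing { int_val :> K; int_valP : int_val \in integers }.

HB.instance Definition _ := [isSub for int_val].
HB.instance Definition _ := [Choice of int_ring by <:].
HB.instance Definition _ := [SubChoice_isSubComNzRing of int_ring by <:].

End RingOfIntegers.

Record ramified_quadratic := RamifiedQuadratic {
  rqF0 : fieldType;
  rqF : fieldExtType rqF0;
  rq_v0 : cdvaluation rqF0;
  rq_v : cdvaluation rqF;
  rq_dim : \dim {: rqF} = 2;
  rq_ram : forall a : rqF0, a != 0 -> rq_v a%:A = rq_v0 a *+ 2;
  rq_k : finFieldType;
  rq_res : {rmorphism int_ring rq_v -> rq_k};
  rq_res_ker : forall a, (rq_res a == 0) = val_ge rq_v 1 (\val a);
  (* surjective already on the integers of F0: common residue field *)
  rq_res_surj : forall y, exists (a : int_ring rq_v0) (b : int_ring rq_v),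
    \val b = (\val a)%:A /\ rq_res b = y;
  rq_odd : 2%N \notin [pchar rq_k];
  rq_pi0 : rqF0;
  rq_pi : rqF;
  rq_pi0_unif : rq_pi0 != 0 /\ rq_v0 rq_pi0 = 1;
  rq_pi_unif : rq_pi != 0 /\ rq_v rq_pi = 1;
  rq_piE : rq_pi ^+ 2 = rq_pi0%:A;
  rq_conj : {lrmorphism rqF -> rqF};
  rq_conj_neq : exists x, rq_conj x != x }.

Section LocalModels.
Variables (E : ramified_quadratic) (n : nat).

Local Notation F0 := (rqF0 E).
Local Notation F := (rqF E).
Local Notation conj := (@rq_conj E).

Definition OF0 : comNzRingType := int_ring (rq_v0 E).
Definition OF : comNzRingType := int_ring (rq_v E).

Definition incl0 (a : OF0) : F := (int_val a)%:A.

Lemma incl0_int a : incl0 a \in integers (rq_v E).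
Proof.
case: a => a; rewrite /incl0 /= !unfold_in /val_ge /=.
have [->|a0] := eqVneq a 0; first by rewrite scale0r eqxx.
by rewrite rq_ram //= => va; rewrite mulrn_wge0 ?orbT.
Qed.

Definition inclO (a : OF0) : OF := IntRing (incl0_int a).

Lemma piO_int : rq_pi E \in integers (rq_v E).
Proof.
by case: (rq_pi_unif E) => p0 vp; rewrite unfold_in /val_ge vp orbT.
Qed.

Definition piO : OF := IntRing piO_int.

Definition herm (x y : 'rV[F]_n) : F :=
  \sum_(l < n) conj (x 0 l) * y 0 (rev_ord l).

Definition pair_tr (x y : 'rV[F]_n) : F :=
  2%:R^-1 * (herm x y + conj (herm x y)).

(* With i = b n + c, 0 <= c < n, the lattice Lambda_i is the direct sum of the
   pi^(- lat_exp i l) O_F e_l; since 'I_n counts from 0, the condition "j <= c"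
   on indices 1 <= j <= n becomes l < c. *)
Definition lat_exp (i : int) (l : 'I_n) : int :=
  (i %/ n%:Z)%Z + (nat_of_bool (l%:Z < (i %% n%:Z)%Z)%R)%:Z.

Definition lattice (i : int) : set 'rV[F]_n :=
  [set x | forall l, exists a : OF, x 0 l = rq_pi E ^ (- lat_exp i l) * int_val a].

(* The rows are an O_F0-basis of Lambda_i: the pi^(- lat_exp i l) e_l, followed
   by their multiples by pi (see lattice_basisP). *)
Definition lat_basis (i : int) : 'M[F]_(n + n, n) :=
  let D := diag_mx (\row_l rq_pi E ^ (- lat_exp i l)) in
  col_mx D (rq_pi E *: D).

Definition lat_vec (i : int) (u : 'rV[OF0]_(n + n)) : 'rV[F]_n :=
  map_mx incl0 u *m lat_basis i.

Lemma rq_free (a b : F0) : a%:A + b *: rq_pi E = 0 -> a = 0 /\ b = 0.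
Proof.
case: (rq_pi_unif E) => p0 vp.
have [->|b0] := eqVneq b 0.
  rewrite scale0r addr0 => /eqP; rewrite scaler_eq0 oner_eq0 orbF => /eqP ->.
  by [].
move=> /eqP; rewrite addrC addr_eq0 -scaleNr => /eqP e.
have e' : rq_pi E = (- a / b)%:A :> F.
  by rewrite mulrC -scalerA -e scalerA mulVf // scale1r.
have ab0 : - a / b != 0.
  by apply: contraNneq p0 => h; rewrite e' h scale0r.
by have := rq_ram ab0; rewrite -e' vp; case: (rq_v0 E _) => m /=; lia.
Qed.

Lemma rq_decomp (y : F) : exists a b : F0, y = a%:A + b *: rq_pi E.
Proof.
have fr : free [tuple (1 : F); rq_pi E].
  rewrite free_cons span_seq1 seq1_free; case: (rq_pi_unif E) => -> _.
  rewrite andbT; apply/negP => /vlineP[c e].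
  have [] : (1 : F0) = 0 /\ - c = 0.
    by apply: rq_free; rewrite scaleNr -e scale1r subrr.
  by move/eqP; rewrite oner_eq0.
have bas : basis_of fullv [tuple (1 : F); rq_pi E].
  by rewrite basisEfree fr subvf size_tuple rq_dim.
rewrite (coord_basis bas (memvf y)) !big_ord_recl big_ord0 addr0 /=.
by eexists; eexists; reflexivity.
Qed.

Lemma rq_int_decomp (a b : F0) : a%:A + b *: rq_pi E \in integers (rq_v E) ->
  a \in integers (rq_v0 E) /\ b \in integers (rq_v0 E).
Proof.
case: (rq_pi_unif E) => p0 vp.
have vN x N : val_ge (rq_v E) N x -> val_ge (rq_v E) N (- x).
  move=> h; rewrite -mulN1r -[N]add0r; apply: val_geM => //.
  by rewrite /val_ge dvN1 lexx orbT.
have va : a != 0 -> rq_v E a%:A = rq_v0 E a *+ 2 by exact: rq_ram.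
have vb : b != 0 -> rq_v E (b *: rq_pi E) = rq_v0 E b *+ 2 + 1.
  move=> b0; rewrite -mulr_algl dvM ?vp ?rq_ram //.
  by rewrite scaler_eq0 oner_eq0 orbF.
rewrite !unfold_in; set s := _ + _ => sge.
have key (N : int) : N <= 0 -> val_ge (rq_v E) N s.
  by move=> N0; move: sge; rewrite /val_ge => /orP[->//|h]; rewrite (le_trans N0 h) orbT.
have bad x N : x != 0 -> val_ge (rq_v E) N x -> N <= rq_v E x.
  by rewrite /val_ge => /negPf->.
have sa : a%:A = s + - (b *: rq_pi E) by rewrite /s addrK.
have sb : b *: rq_pi E = s + - a%:A by rewrite /s addrC addKr.
have a0F : a != 0 -> a%:A != 0 :> F by rewrite scaler_eq0 oner_eq0 orbF.
have b0F : b != 0 -> b *: rq_pi E != 0 by rewrite scaler_eq0 (negPf p0) orbF.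
rewrite /val_ge; have [ea|a0] := eqVneq a 0; have [eb|b0] := eqVneq b 0 => //=.
- split=> //; have := bad _ _ (b0F b0) _; move=> /(_ 0); rewrite vb // => h.
  have : 0 <= rq_v0 E b *+ 2 + 1.
    by apply: h; rewrite sb ea scale0r oppr0 addr0.
  lia.
- split=> //; have := bad _ _ (a0F a0) _; move=> /(_ 0); rewrite va // => h.
  have : 0 <= rq_v0 E a *+ 2.
    by apply: h; rewrite sa eb scale0r oppr0 addr0.
  lia.
have hA := bad _ _ (a0F a0); have hB := bad _ _ (b0F b0).
rewrite va // in hA; rewrite vb // in hB.
have [lt|ge] := ltP (rq_v0 E a) 0.
- have [ab|ba] := leP (rq_v0 E a) (rq_v0 E b).
  + have := hA (rq_v0 E a *+ 2 + 1) _; set H := (X in (X -> _) -> _).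
    suff h : H by move=> /(_ h); lia.
    rewrite /H sa; apply: dvD; first by apply: key; lia.
    by apply: vN; rewrite /val_ge (negPf (b0F b0)) vb //=; lia.
  + have := hB (rq_v0 E b *+ 2 + 2) _; set H := (X in (X -> _) -> _).
    suff h : H by move=> /(_ h); lia.
    rewrite /H sb; apply: dvD; first by apply: key; lia.
    by apply: vN; rewrite /val_ge (negPf (a0F a0)) va //=; lia.
- split=> //; have [lt|//] := ltP (rq_v0 E b) 0.
  have := hB (rq_v0 E b *+ 2 + 2) _; set H := (X in (X -> _) -> _).
  suff h : H by move=> /(_ h); lia.
  rewrite /H sb; apply: dvD; first by apply: key; lia.
  by apply: vN; rewrite /val_ge (negPf (a0F a0)) va //=; lia.
Qed.

Lemma lat_vecE i u l : lat_vec i u 0 l = rq_pi E ^ (- lat_exp i l) *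
  (incl0 (u 0 (lshift n l)) + int_val (u 0 (rshift n l)) *: rq_pi E).
Proof.
rewrite /lat_vec /lat_basis -[map_mx _ _]hsubmxK mul_row_col -scalemxAr.
rewrite !mul_mx_diag !mxE mulrDr -[int_val _ *: _]mulr_algl.
set d := _ ^ _; congr (_ + _); first exact: mulrC.
by rewrite mulrCA [d * _]mulrC -mulrA; congr (_ * _); exact: mulrC.
Qed.

Lemma lattice_basisP i x : lattice i x <-> exists u, lat_vec i u = x.
Proof.
split=> [xP|[u <-] l].
  have /choice[u0 u0P] : forall l, exists ab : OF0 * OF0, x 0 l =
      rq_pi E ^ (- lat_exp i l) * (incl0 ab.1 + int_val ab.2 *: rq_pi E).
    move=> l; have [[y yP] ->] := xP l; have [a [b e]] := rq_decomp y.
    have := yP; rewrite {1}e => /rq_int_decomp[aP bP].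
    by exists (IntRing aP, IntRing bP) => /=; rewrite e.
  exists (row_mx (\row_l (u0 l).1) (\row_l (u0 l).2)).
  by apply/rowP => l; rewrite lat_vecE row_mxEl row_mxEr !mxE u0P.
have piP := valP (inclO (u 0 (rshift n l)) * piO).
exists (inclO (u 0 (lshift n l)) + inclO (u 0 (rshift n l)) * piO).
by rewrite lat_vecE /= /incl0 mulr_algl.
Qed.

Lemma lat_vec_inj i : injective (lat_vec i).
Proof.
move=> u w /rowP e.
have h l : incl0 (u 0 (lshift n l)) + int_val (u 0 (rshift n l)) *: rq_pi E =
           incl0 (w 0 (lshift n l)) + int_val (w 0 (rshift n l)) *: rq_pi E.
  have := e l; rewrite !lat_vecE; apply: mulfI.
  by apply: expfz_neq0; case: (rq_pi_unif E).
have h' l : u 0 (lshift n l) = w 0 (lshift n l) /\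
            u 0 (rshift n l) = w 0 (rshift n l).
  have /eqP := h l; rewrite -subr_eq0 opprD addrACA -!scalerBl => /eqP/rq_free.
  by move=> [/eqP + /eqP]; rewrite !subr_eq0 => /eqP/val_inj-> /eqP/val_inj->.
apply/rowP => j; rewrite -[j]splitK.
by case: (split j) => l /=; case: (h' l).
Qed.

Definition lat_coord (i : int) (x : 'rV[F]_n) : 'rV[OF0]_(n + n) :=
  xget 0 [set u | lat_vec i u = x].

(* Matrix over O_F0, acting on row vectors, of an O_F0-linear map f sending
   Lambda_i into Lambda_j. *)
Definition lat_mx (i j : int) (f : 'rV[F]_n -> 'rV[F]_n) : 'M[OF0]_(n + n) :=
  \matrix_(a < n + n) lat_coord j (f (row a (lat_basis i))).

(* Gram matrix of ( , ) between Lambda_i and its dual Lambda_(n - i). *)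
Definition lat_gram (i : int) : 'M[OF0]_(n + n) :=
  \matrix_(a, b) xget 0 [set c | incl0 c =
    pair_tr (row a (lat_basis i)) (row b (lat_basis (n%:Z - i)))].

(* Lambda_i being free over O_F0, Lambda_i (x) R is represented by its
   coordinates in the basis lat_basis i (x) 1. *)
Definition lat_space (R : comAlgType OF) := 'rV[R]_(n + n).

Definition struct_map (R : comAlgType OF) (a : OF0) : R := (inclO a)%:A.

Definition lat_tensor_mx (R : comAlgType OF) i j f : 'M[R]_(n + n) :=
  map_mx (struct_map R) (lat_mx i j f).

Definition lat_tensor (R : comAlgType OF) i j f (x : lat_space R) :
  lat_space R := x *m lat_tensor_mx R i j f.

Definition scale_pi (x : 'rV[F]_n) : 'rV[F]_n := rq_pi E *: x.

Definition pair_tensor (R : comAlgType OF) i (x y : lat_space R) : R :=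
  (x *m map_mx (struct_map R) (lat_gram i) *m y^T) 0 0.

End LocalModels.

Section Submodules.
Variables (R : comNzRingType) (m : nat).
Implicit Types U W : set 'rV[R]_m.

Definition is_submodule U :=
  U 0 /\ forall (a : R) x y, U x -> U y -> U (a *: x + y).

Definition is_complement U W :=
  (forall x, exists y z, [/\ U y, W z & x = y + z]) /\
  (forall x, U x -> W x -> x = 0).

Definition is_direct_summand U :=
  is_submodule U /\ exists2 W, is_submodule W & is_complement U W.

Definition span (U : set 'rV[R]_m) : set 'rV[R]_m :=
  [set x | forall W, is_submodule W -> U `<=` W -> W x].

Definition is_projector U (P : 'M[R]_m) :=
  (forall x, U (x *m P)) /\ (forall x, U x -> x *m P = x).

(* det (T id - A | U) for a direct summand U stable under A: it is computed as
   the determinant over R[T] of (T id - A on U) (+) (id on a complement). *)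
Definition charpoly_on U (A : 'M[R]_m) (p : {poly R}) :=
  exists2 P, is_projector U P &
    \det (map_mx polyC (1%:M - P)
          + map_mx polyC P *m ('X%:M - map_mx polyC A)) = p.

End Submodules.

(* For U a direct summand of R^m this is the image of U (x)_R S in S^m. *)
Definition base_change (R S : comNzRingType) (m : nat) (g : R -> S)
  (U : set 'rV[R]_m) : set 'rV[S]_m := span (map_mx g @` U).

(* All fibres of U over field-valued points of R have dimension r. *)
Definition has_rank (R : comNzRingType) (m : nat) (U : set 'rV[R]_m) (r : nat) :=
  forall (K : fieldType) (g : {rmorphism R -> K}),
    exists2 A : 'M[K]_(r, m), row_free A &
      forall x : 'rV[K]_m, base_change g U x <-> (x <= A)%MS.

Section Models.
Variables (E : ramified_quadratic) (n k : nat).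

(* The index set [k] = {k, -k} + n Z. *)
Definition in_class (i : int) : bool :=
  (n%:Z %| i - k%:Z)%Z || (n%:Z %| i + k%:Z)%Z.

Definition class_idx := {i : int | in_class i}.

Local Notation OF := (OF E).
Local Notation family R := (class_idx -> set (lat_space n R)).

(* Pi = pi (x) 1 on Lambda_i (x) R; the scalar pi = 1 (x) pi is piO acting
   through the O_F-algebra structure of R. *)
Definition Pi (R : comAlgType OF) (i : int) : lat_space n R -> lat_space n R :=
  lat_tensor i i (@scale_pi E n).

Definition pi_R (R : comAlgType OF) : R := (piO E)%:A.

Definition bc_family (R S : comAlgType OF) (g : R -> S) (x : family R) :
  family S := fun i => base_change g (x i).

Section Conditions.
Variables (R : comAlgType OF) (x : family R).

Definition OF_summand_of_rank (r : nat) := forall i : class_idx,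
  [/\ is_direct_summand (x i), has_rank (x i) r
    & forall y, x i y -> x i (Pi (val i) y)].

Definition transition_stable := forall i j : class_idx, val i < val j ->
  forall y, x i y -> x j (lat_tensor (val i) (val j) id y).

Definition periodic := forall i j : class_idx, val j = val i - n%:Z ->
  lat_tensor (val i) (val j) (@scale_pi E n) @` x i = x j.

Definition LM1 := OF_summand_of_rank n.
Definition LM2 := transition_stable.
Definition LM3 := periodic.
Definition LM4 := forall i j : class_idx, val j = n%:Z - val i ->
  [set z : lat_space n R | forall y, x i y -> pair_tensor (val i) y z = 0] = x j.
Definition LM5 := forall i : class_idx,
  charpoly_on (x i) (lat_tensor_mx R (val i) (val i) (@scale_pi E n))
    (('X + (pi_R R)%:P) ^+ n.-1 * ('X - (pi_R R)%:P)).

End Conditions.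

Definition M_naive (R : comAlgType OF) : set (family R) :=
  [set x | [/\ LM1 x, LM2 x, LM3 x, LM4 x & LM5 x]].

Definition M_Kra (R : comAlgType OF) : set (family R * family R) :=
  [set x0x | let: (x0, x) := x0x in
    [/\ [/\ LM1 x, LM2 x, LM3 x & LM4 x],
        [/\ forall i, x0 i `<=` x i,
            OF_summand_of_rank x0 1, transition_stable x0 & periodic x0],
        forall i y, x i y -> x0 i (Pi (val i) y + pi_R R *: y)
      & forall i y, x0 i y -> Pi (val i) y - pi_R R *: y = 0]].

Definition is_ideal (R : comNzRingType) (I : set R) :=
  I 0 /\ forall a b c : R, I b -> I c -> I (a * b + c).

(* Y is a closed subfunctor of X: pulled back along any R-point of X it becomes
   the closed subscheme of Spec R defined by some ideal I. *)
Definition closed_subfunctor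
    (X Y : forall R : comAlgType OF, set (family R)) : Prop :=
  [/\ forall R, Y R `<=` X R,
      forall (R S : comAlgType OF) (g : {lrmorphism R -> S}) x,
        Y R x -> Y S (bc_family g x)
    & forall (R : comAlgType OF) x, X R x -> exists2 I : set R, is_ideal I &
        forall (S : comAlgType OF) (g : {lrmorphism R -> S}),
          Y S (bc_family g x) <-> (forall a, I a -> g a = 0)].

(* The F-algebras are the O_F-algebras in which pi is invertible. *)
Definition contains_generic_fiber
    (X Y : forall R : comAlgType OF, set (family R)) : Prop :=
  forall R : comAlgType OF, (exists u : R, u * pi_R R = 1) -> X R `<=` Y R.

(* Points of the scheme-theoretic closure of the generic fiber of M_naive, i.e.
   of its smallest closed subscheme containing the generic fiber. *)
Definition M_loc (R : comAlgType OF) : set (family R) :=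
  [set x | M_naive x /\
    forall Y : forall S : comAlgType OF, set (family S),
      closed_subfunctor M_naive Y -> contains_generic_fiber M_naive Y -> Y R x].

Definition M_nspl (R : comAlgType OF) : set (family R * family R) :=
  [set x0x | M_Kra x0x /\ M_loc x0x.2].

End Models.

(* Main.v *)
(* In the coordinates p = x' + pi x'' and x'' on Lambda_i (x) R = R^n + Pi R^n, the
   Kraemer condition says that F_k lies in {p in R v} and F_{-k} in {p in R w},
   where v and w span the lines F^0_k and F^0_{-k}.  Over a local ring the
   transition maps give scalars with s t = pi and a vector z such that
   v = (t z_1, z_2) and w = (z_1, s z_2), z_2 being the n - 2k middle coordinates
   of z, and duality leaves a single pair (a, b) of freedom for F_k, namely
   F_k = {(p, x'') | p = b c v and <x'', w> = a c for some c}.  When a = 1 or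
   b = 1 one can moreover achieve 2 t a = b q(z_2) for the quadratic form q of
   the middle block, without changing F_k.  As q is nonzero modulo pi (this is
   where 2k <> n enters), s t = pi and 2 t a = b q define a pi-torsion-free ring,
   over which the same formulas give a point of the naive local model; it lies in
   the closure of the generic fibre, hence so does its specialization F.  General
   R is reduced to local R by localizing at primes. *)

(* The Kraemer model itself need not be flat, so its own coordinate ring cannot serve: only F is
   lifted, and the line in F_k is allowed to change when [t] is corrected. The relation 2 t a = b q
   is the condition that the transition map carries F_k into F_-k, once F_-k is the orthogonal of
   F_k. Pairing F_k with its own image yields it only multiplied by b, which is why the cases a = 1
   and b = 1 are treated differently. No equations of the closure are computed. [M_loc] quantifies
   over closed subfunctors Y, and at a naive point each Y is an ideal J. Over a ring that embeds in
   its localization at pi, J vanishes because Y contains the generic fibre; over an arbitrary R, J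
   vanishes because its elements die at every prime. The second use replaces any gluing of points,
   but J exists only once the characteristic polynomial condition, absent from the Kraemer model,
   has been established over R. *)
From HB Require Import structures.
From mathcomp Require Import all_boot all_order all_algebra all_field.
From mathcomp Require Import boolp classical_sets.
From mathcomp Require Import mpoly ring zify.
Require Import Defs.
Set Implicit Arguments.
Unset Strict Implicit.
Unset Printing Implicit Defensive.
Import Order.TTheory GRing.Theory Num.Theory.
Import Quotient.
Local Open Scope classical_set_scope.
Local Open Scope ring_scope.
Local Open Scope quotient_scope.

(** * Localizations of quotient rings *)

(* Data for the ring S^-1 (A / I), seen as an O-algebra through iota. *)
Record locdata (O A : comNzRingType) (iota : {rmorphism O -> A}) := LocData {
  ld_S : set A;
  ld_I : set A;
  ld_S1 : ld_S 1;
  ld_SM : forall a b, ld_S a -> ld_S b -> ld_S (a * b);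
  ld_ideal : is_ideal ld_I;
  ld_disj : forall a, ld_S a -> ~ ld_I a }.

Section Locq.
Variables (O A : comNzRingType) (iota : {rmorphism O -> A}) (d : locdata iota).
Local Notation S := (ld_S d).
Local Notation I := (ld_I d).

Lemma ideal0 : I 0. Proof. by case: (ld_ideal d). Qed.
Lemma idealD a b : I a -> I b -> I (a + b).
Proof. by move=> ia ib; have [_ /(_ 1 a b ia ib)] := ld_ideal d; rewrite mul1r. Qed.
Lemma idealM a b : I b -> I (a * b).
Proof. by move=> ib; have [i0 /(_ a b 0 ib i0)] := ld_ideal d; rewrite addr0. Qed.

Definition frac := {x : A * A | `[< S x.2 >]}.
Lemma frac_den (x : frac) : S (val x).2. Proof. by case: x => x /= /asboolP. Qed.
Definition mkfrac a s (Ss : S s) : frac := exist _ (a, s) (introT (asboolP _) Ss).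

(** Passing to A / I and inverting S happen in one relation, so no intermediate quotient ring is
    formed; the factor [u] is there because elements of S may be zero divisors modulo I. *)
Definition frac_eqv (x y : frac) : bool :=
  `[< exists2 u, S u & I (u * ((val x).1 * (val y).2 - (val y).1 * (val x).2)) >].

Lemma frac_eqv_refl : reflexive frac_eqv.
Proof.
move=> x; apply/asboolP; exists 1; first exact: ld_S1.
by rewrite subrr mulr0; exact: ideal0.
Qed.
Lemma frac_eqv_sym : ssrbool.symmetric frac_eqv.
Proof.
have h x y : frac_eqv x y -> frac_eqv y x.
  move=> /asboolP[u Su Iu]; apply/asboolP; exists u => //.
  by have := idealM (-1) Iu; rewrite mulN1r -mulrN opprB.
by move=> x y; apply/idP/idP; exact: h.
Qed.
Lemma frac_eqv_trans : transitive frac_eqv.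
Proof.
move=> y x z /asboolP[u Su Iu] /asboolP[w Sw Iw]; apply/asboolP.
exists (u * w * (val y).2); first by apply: ld_SM; [exact: ld_SM | exact: frac_den].
have := idealD (idealM (w * (val z).2) Iu) (idealM (u * (val x).2) Iw).
by congr (I _); ring.
Qed.

Definition frac_equiv := EquivRel frac_eqv frac_eqv_refl frac_eqv_sym frac_eqv_trans.
Definition locq := {eq_quot frac_equiv}.
HB.instance Definition _ := Choice.on locq.
HB.instance Definition _ := EqQuotient.on locq.

Definition lfrac a s (Ss : S s) : locq := \pi_locq (mkfrac a Ss).

Lemma lfrac_eq a b s t (Ss : S s) (St : S t) u :
  S u -> I (u * (a * t - b * s)) -> lfrac a Ss = lfrac b St.
Proof. by move=> Su h; apply/eqquotP; apply/asboolP; exists u. Qed.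

Lemma lfrac_eqP a b s t (Ss : S s) (St : S t) :
  lfrac a Ss = lfrac b St -> exists2 u, S u & I (u * (a * t - b * s)).
Proof. by move=> /eqquotP /asboolP. Qed.

Lemma lfrac_eq1 a b s t (Ss : S s) (St : S t) :
  a * t = b * s -> lfrac a Ss = lfrac b St.
Proof.
move=> e; apply: (lfrac_eq _ _ (ld_S1 d)).
by rewrite e subrr mulr0; exact: ideal0.
Qed.

Lemma locqW (P : locq -> Prop) : (forall a s (Ss : S s), P (lfrac a Ss)) -> forall x, P x.
Proof.
move=> h x; rewrite -[x]reprK.
case: (repr x) => [[a s] /= p]; have := h a s (elimT (asboolP _) p).
by rewrite /lfrac /mkfrac (Prop_irrelevance (introT _ _) p).
Qed.

Let num x := (val (repr (x : locq))).1.
Let den x := (val (repr (x : locq))).2.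
Let denP x : S (den x). Proof. exact: frac_den. Qed.
Let locqE x : x = lfrac (num x) (denP x).
Proof.
rewrite -[LHS]reprK /lfrac; congr (\pi_locq _).
by apply: val_inj; rewrite /num /den /=; case: (val _).
Qed.

Definition locq_add x y : locq :=
  lfrac (num x * den y + num y * den x) (ld_SM (denP x) (denP y)).
Definition locq_mul x y : locq := lfrac (num x * num y) (ld_SM (denP x) (denP y)).
Definition locq_opp x : locq := lfrac (- num x) (denP x).
Definition locq_of a : locq := lfrac a (ld_S1 d).

Lemma locq_addE a b s t (Ss : S s) (St : S t) :
  locq_add (lfrac a Ss) (lfrac b St) = lfrac (a * t + b * s) (ld_SM Ss St).
Proof.
rewrite /locq_add; set x := lfrac a Ss; set y := lfrac b St.
have [u Su Iu] := lfrac_eqP (esym (locqE x)).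
have [w Sw Iw] := lfrac_eqP (esym (locqE y)).
apply: (lfrac_eq _ _ (ld_SM Su Sw)).
have := idealD (idealM (w * t * den y) Iu) (idealM (u * s * den x) Iw).
by congr (I _); ring.
Qed.

Lemma locq_mulE a b s t (Ss : S s) (St : S t) :
  locq_mul (lfrac a Ss) (lfrac b St) = lfrac (a * b) (ld_SM Ss St).
Proof.
rewrite /locq_mul; set x := lfrac a Ss; set y := lfrac b St.
have [u Su Iu] := lfrac_eqP (esym (locqE x)).
have [w Sw Iw] := lfrac_eqP (esym (locqE y)).
apply: (lfrac_eq _ _ (ld_SM Su Sw)).
have := idealD (idealM (w * t * num y) Iu) (idealM (u * a * den x) Iw).
by congr (I _); ring.
Qed.

Lemma locq_oppE a s (Ss : S s) : locq_opp (lfrac a Ss) = lfrac (- a) Ss.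
Proof.
rewrite /locq_opp; set x := lfrac a Ss.
have [u Su Iu] := lfrac_eqP (esym (locqE x)).
by apply: (lfrac_eq _ _ Su); have := idealM (-1) Iu; congr (I _); ring.
Qed.

Let locq_addA : associative locq_add.
Proof.
elim/locqW => a s Ss; elim/locqW => b t St; elim/locqW => c r Sr.
by rewrite !locq_addE; apply: lfrac_eq1; ring.
Qed.
Let locq_addC : commutative locq_add.
Proof.
elim/locqW => a s Ss; elim/locqW => b t St.
by rewrite !locq_addE; apply: lfrac_eq1; ring.
Qed.
Let locq_add0 : left_id (locq_of 0) locq_add.
Proof. by elim/locqW => a s Ss; rewrite !locq_addE; apply: lfrac_eq1; ring. Qed.
Let locq_addN : left_inverse (locq_of 0) locq_opp locq_add.
Proof. by elim/locqW => a s Ss; rewrite locq_oppE locq_addE; apply: lfrac_eq1; ring. Qed.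
Let locq_mulA : associative locq_mul.
Proof.
elim/locqW => a s Ss; elim/locqW => b t St; elim/locqW => c r Sr.
by rewrite !locq_mulE; apply: lfrac_eq1; ring.
Qed.
Let locq_mulC : commutative locq_mul.
Proof.
elim/locqW => a s Ss; elim/locqW => b t St.
by rewrite !locq_mulE; apply: lfrac_eq1; ring.
Qed.
Let locq_mul1 : left_id (locq_of 1) locq_mul.
Proof. by elim/locqW => a s Ss; rewrite !locq_mulE; apply: lfrac_eq1; ring. Qed.
Let locq_mulD : left_distributive locq_mul locq_add.
Proof.
elim/locqW => a s Ss; elim/locqW => b t St; elim/locqW => c r Sr.
by rewrite !(locq_addE, locq_mulE); apply: lfrac_eq1; ring.
Qed.
(** All algebras here are nonzero rings; this is the purpose of [ld_disj]. *)
Let locq_nz : locq_of 1 != locq_of 0.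
Proof.
apply/eqP => /lfrac_eqP[u Su]; rewrite mul0r !mulr1 subr0 mulr1.
exact: ld_disj.
Qed.

HB.instance Definition _ :=
  GRing.isZmodule.Build locq locq_addA locq_addC locq_add0 locq_addN.
HB.instance Definition _ :=
  GRing.Zmodule_isComNzRing.Build locq locq_mulA locq_mulC locq_mul1 locq_mulD locq_nz.

Lemma locq_of_zmod : zmod_morphism locq_of.
Proof.
move=> a b; rewrite [RHS](_ : _ = locq_add (locq_of a) (locq_opp (locq_of b))) //.
by rewrite locq_oppE locq_addE; apply: lfrac_eq1; ring.
Qed.
Lemma locq_of_monoid : monoid_morphism locq_of.
Proof.
split=> // a b; rewrite [RHS](_ : _ = locq_mul (locq_of a) (locq_of b)) //.
by rewrite locq_mulE; apply: lfrac_eq1; ring.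
Qed.
HB.instance Definition _ := GRing.isZmodMorphism.Build A locq locq_of locq_of_zmod.
HB.instance Definition _ := GRing.isMonoidMorphism.Build A locq locq_of locq_of_monoid.

Definition locq_scale (k : O) (x : locq) : locq := locq_of (iota k) * x.
Let locq_scaleA k l x : locq_scale k (locq_scale l x) = locq_scale (k * l) x.
Proof. by rewrite /locq_scale mulrA -!rmorphM. Qed.
Let locq_scale1 : left_id 1 locq_scale.
Proof. by move=> x; rewrite /locq_scale !rmorph1 mul1r. Qed.
Let locq_scaleDr : right_distributive locq_scale +%R.
Proof. by move=> k x y; rewrite /locq_scale mulrDr. Qed.
Let locq_scaleDl x : {morph locq_scale^~ x : k l / k + l}.
Proof. by move=> k l; rewrite /locq_scale !rmorphD mulrDl. Qed.
HB.instance Definition _ := GRing.Zmodule_isLmodule.Build O locq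
  locq_scaleA locq_scale1 locq_scaleDr locq_scaleDl.
Let locq_scaleAl (k : O) (x y : locq) : k *: (x * y) = (k *: x) * y.
Proof. by rewrite /GRing.scale /= /locq_scale mulrA. Qed.
HB.instance Definition _ := GRing.Lmodule_isLalgebra.Build O locq locq_scaleAl.
HB.instance Definition _ := GRing.Lalgebra_isComAlgebra.Build O locq.

Lemma locq_algE k : k%:A = locq_of (iota k).
Proof. by rewrite /GRing.scale /= /locq_scale mulr1. Qed.

Lemma locq_of_eq0 a : locq_of a = 0 <-> exists2 u, S u & I (u * a).
Proof.
split=> [|[u Su Iu]]; last by apply: (lfrac_eq _ _ Su); rewrite mulr1 mul0r subr0.
by move=> /lfrac_eqP[u Su]; rewrite mulr1 mul0r subr0; exists u.
Qed.

Lemma locq_of_unit s : S s -> exists x, x * locq_of s = 1.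
Proof.
move=> Ss; exists (lfrac 1 Ss).
rewrite [LHS](_ : _ = locq_mul (lfrac 1 Ss) (locq_of s)) // locq_mulE.
by apply: lfrac_eq1; ring.
Qed.

Lemma locq_frac x : exists a s, S s /\ x * locq_of s = locq_of a.
Proof.
elim/locqW: x => a s Ss; exists a, s; split=> //.
rewrite [LHS](_ : _ = locq_mul (lfrac a Ss) (locq_of s)) // locq_mulE.
by apply: lfrac_eq1; ring.
Qed.

End Locq.

Section Lift.
Variables (O A : comNzRingType) (iota : {rmorphism O -> A}) (d : locdata iota).

Lemma locq_lift (T : comAlgType O) (f : {rmorphism A -> T}) :
    (forall k, f (iota k) = k%:A) ->
    (forall a, ld_I d a -> f a = 0) ->
    (forall s, ld_S d s -> exists y, y * f s = 1) ->
  exists g : {lrmorphism locq d -> T}, forall a, g (locq_of d a) = f a.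
Proof.
move=> fi fI fS.
(* The chosen value fits every fraction representing [x] at once, so the morphism laws below follow
   by cancelling the units [f s]. *)
have /choice[g0 g0P] : forall x : locq d, exists y,
    forall a s, ld_S d s -> x * locq_of d s = locq_of d a -> y * f s = f a.
  move=> x; have [a [s [Ss e]]] := locq_frac x.
  have [u uE] := fS s Ss; exists (f a * u) => b t St e'.
  have : locq_of d (a * t - b * s) = 0.
    rewrite rmorphB !rmorphM /= -e -e'; ring.
  move=> /locq_of_eq0[w Sw /fI]; have [w' w'E] := fS w Sw.
  rewrite rmorphM rmorphB !rmorphM => /(congr1 (fun z => w' * z)).
  rewrite mulr0 mulrA w'E mul1r => /eqP; rewrite subr_eq0 => /eqP h.
  by rewrite mulrAC h -mulrA [_ * u]mulrC uE mulr1.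
have g0of a : g0 (locq_of d a) = f a.
  have := g0P (locq_of d a) a 1 (ld_S1 d).
  by rewrite !rmorph1 !mulr1; exact.
have g0u x y s : ld_S d s -> x * f s = y * f s -> x = y.
  by move=> /fS[u uE] /(congr1 (fun z => z * u)); rewrite -!mulrA [_ * u]mulrC uE !mulr1.
have gB : zmod_morphism g0.
  move=> x y; have [a [s [Ss e]]] := locq_frac x; have [b [t [St e']]] := locq_frac y.
  apply: (g0u _ _ (s * t)); first exact: ld_SM.
  have /g0P-> : (x - y) * locq_of d (s * t) = locq_of d (a * t - b * s); last exact: ld_SM.
    by rewrite rmorphB !rmorphM /= -e -e'; ring.
  rewrite rmorphB !rmorphM -(g0P x _ _ Ss e) -(g0P y _ _ St e'); ring.
have gM : monoid_morphism g0.
  split=> [|x y]; first by rewrite -(rmorph1 (locq_of d)) g0of rmorph1.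
  have [a [s [Ss e]]] := locq_frac x; have [b [t [St e']]] := locq_frac y.
  apply: (g0u _ _ (s * t)); first exact: ld_SM.
  have /g0P-> : (x * y) * locq_of d (s * t) = locq_of d (a * b); last exact: ld_SM.
    by rewrite !rmorphM /= -e -e'; ring.
  by rewrite !rmorphM -(g0P x _ _ Ss e) -(g0P y _ _ St e'); ring.
have gZ : scalable g0.
  move=> k x; rewrite -mulr_algl gM.2 locq_algE g0of fi.
  by rewrite mulr_algl.
pose gr := GRing.isZmodMorphism.Build _ _ g0 gB.
pose gm := GRing.isMonoidMorphism.Build _ _ g0 gM.
pose gs := GRing.isScalable.Build _ _ _ _ g0 gZ.
pose g : {lrmorphism locq d -> T} := HB.pack g0 gr gm gs.
by exists g.
Qed.

End Lift.

(** * Localization at a prime *)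

Definition is_prime_ideal (A : comNzRingType) (p : set A) :=
  [/\ is_ideal p, ~ p 1 & forall a b, p (a * b) -> p a \/ p b].

(** Zorn among the proper ideals containing J: a maximal one is prime, because every element outside
    it is invertible modulo it. *)
Lemma prime_ideal_above (A : comNzRingType) (J : set A) :
  is_ideal J -> ~ J 1 -> exists2 p, is_prime_ideal p & J `<=` p.
Proof.
move=> Ji J1.
pose T := {I : set A | [/\ is_ideal I, ~ I 1 & J `<=` I]}.
pose le (I I' : T) := `[< sval I `<=` sval I' >].
pose J' : T := exist _ J (And3 Ji J1 (@subset_refl _ J)).
have [||I I' /asboolP h /asboolP h'|C tot|[p [pi p1 Jp]] pmax] := @Zorn T le.
- by move=> I; apply/asboolP.
- by move=> I I' I'' /asboolP h /asboolP h'; apply/asboolP => x /h/h'.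
- move: I I' h h' => [I ?] [I' ?] /= h h'; apply: eq_exist.
  by rewrite eqEsubset.
- have [[I0 CI0]|Cempty] := pselect (exists I, C I); last first.
    by exists J' => I CI; case: Cempty; exists I.
  pose U : set A := [set x | exists2 I, C I & sval I x].
  have Ui : is_ideal U.
    split; first by exists I0 => //; case: (svalP I0) => -[].
    move=> a b c [I CI Ib] [I' CI' I'c].
    have [/asboolP h|/asboolP h] := tot _ _ CI CI'.
      by exists I' => //; case: (svalP I') => -[_ +] _ _; apply=> //; exact: h.
    by exists I => //; case: (svalP I) => -[_ +] _ _; apply=> //; exact: h.
  have U1 : ~ U 1 by case=> I _; case: (svalP I).
  have JU : J `<=` U by move=> x Jx; exists I0 => //; case: (svalP I0) => _ _; exact.
  exists (exist _ U (And3 Ui U1 JU)) => I CI; apply/asboolP => x Ix.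
  by exists I.
exists p => //; split=> // a b pab.
have [p0 pD] := pi.
apply: contrapT => /not_orP[pa pb].
have key c : ~ p c -> exists r, p (r * c - 1).
  move=> pc; pose q : set A := [set x | exists r, p (x - r * c)].
  have qi : is_ideal q.
    split; first by exists 0; rewrite mul0r subr0.
    move=> x y z [r pr] [r' pr']; exists (x * r + r').
    by have := pD x _ _ pr pr'; congr p; ring.
  have pq : p `<=` q by move=> x px; exists 0; rewrite mul0r subr0.
  apply: contrapT => nr.
  have q1 : ~ q 1.
    case=> r pr; apply: nr; exists r; have := pD (-1) _ _ pr p0.
    by rewrite addr0 mulN1r opprB.
  have Jq : J `<=` q by move=> x /Jp/pq.
  have := pmax (exist _ q (And3 qi q1 Jq)) (introT (asboolP _) pq).
  move=> /(congr1 sval)/= e; apply: pc; rewrite -e; exists 1.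
  by rewrite mul1r subrr.
have [r pr] := key _ pa; have [r' pr'] := key _ pb.
have goal1 : p 1; last exact: p1 goal1.
have h := pD (r * r') _ _ pab p0.
have h' := pD (- (r' * b)) _ _ pr (pD (-1) _ _ pr' p0).
by have := pD 1 _ _ h h'; congr p; ring.
Qed.

Section Primes.
Variables (O A : comNzRingType) (iota : {rmorphism O -> A}).
Variables (p : set A) (pP : is_prime_ideal p).

Let S : set A := [set a | ~ p a].
Let S1 : S 1. Proof. by case: pP. Qed.
Let SM a b : S a -> S b -> S (a * b).
Proof. by case: pP => _ _ h ha hb /h[]. Qed.
Let zero_ideal : is_ideal [set 0 : A].
Proof. by split=> // a b c /= -> ->; rewrite mulr0 addr0. Qed.
Let disj0 a : S a -> ~ [set 0] a.
Proof. by move=> Sa /= a0; apply: Sa; rewrite a0; case: pP => -[]. Qed.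

(** The local ring A_p; [prime_res] is its residue field, realized as the fraction field of A /
    p. *)
Definition prime_loc := LocData iota S1 SM zero_ideal disj0.
Definition prime_res := LocData iota S1 SM (let: And3 h _ _ := pP in h)
  (fun a (Sa : S a) pa => Sa pa).

Definition resfield := locq prime_res.
HB.instance Definition _ := GRing.ComNzRing.on resfield.

Let res_inv (x : resfield) : resfield :=
  if x == 0 then 0 else xget 0 [set y | y * x = 1].
Let res_invP : forall x : resfield, x != 0 -> res_inv x * x = 1.
Proof.
move=> x x0; rewrite /res_inv (negPf x0).
case: xgetP => // /(_ _) nx; exfalso.
have [a [s [Ss e]]] := locq_frac x.
have pa : ~ p a.
  move=> pa; have a0 : locq_of prime_res a = 0.
    by apply/locq_of_eq0; exists 1; [exact: S1|rewrite mul1r].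
  move: e; rewrite a0; have [y ys] := locq_of_unit Ss.
  move=> /(congr1 (fun z => y * z)); rewrite mulr0 mulrCA ys mulr1 => /eqP.
  by apply/negP.
have [y ya] := locq_of_unit (d := prime_res) pa.
apply: (nx (y * locq_of _ s)) => /=.
by rewrite -mulrA [_ s * x]mulrC e.
Qed.
Let res_inv0 : res_inv 0 = 0.
Proof. by rewrite /res_inv eqxx. Qed.

HB.instance Definition _ := GRing.ComNzRing_isField.Build resfield res_invP res_inv0.
End Primes.

(** Locality is carried by a residue map that detects units, because it is used to lift bases from
    the residue field and to invert determinants that are nonzero there. *)
Definition is_local (L : comNzRingType) (K : fieldType) (rho : L -> K) :=
  (forall y, exists x, rho x = y) /\ (forall x, rho x != 0 -> exists y, y * x = 1).

(** The annihilator of [a] is a proper ideal; [a] stays nonzero in the localization at any prime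
    above it. *)
Lemma localize (O : comNzRingType) (R : comAlgType O) (a : R) : a != 0 ->
  exists (L : comAlgType O) (g : {lrmorphism R -> L}) (K : fieldType)
    (rho : {rmorphism L -> K}), is_local rho /\ g a != 0.
Proof.
move=> a0.
have annI : is_ideal [set u : R | u * a = 0].
  split; first by rewrite /= mul0r.
  by move=> u b c /= b0 c0; rewrite mulrDl -mulrA b0 c0 mulr0 addr0.
have ann1 : ~ [set u : R | u * a = 0] 1.
  by rewrite /= mul1r => /eqP; apply/negP.
have [p pP ap] := prime_ideal_above annI ann1.
pose iota : {rmorphism O -> R} := @GRing.in_alg O R.
pose dL := prime_loc iota pP; pose dK := prime_res iota pP.
have gZ : scalable (locq_of dL).
  by move=> k x; rewrite -mulr_algl -[RHS]mulr_algl rmorphM locq_algE.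
pose g : {lrmorphism R -> locq dL} := HB.pack (locq_of dL) (GRing.isScalable.Build _ _ _ _ _ gZ).
have [//| |s Ss|rho rhoE] := @locq_lift _ _ _ dL (locq dK) (locq_of dK).
- by move=> k; rewrite locq_algE.
- by move=> x /= ->; rewrite rmorph0.
- exact: locq_of_unit.
pose rho' : {rmorphism locq dL -> resfield iota pP} := rho.
have {}rhoE c : rho' (locq_of dL c) = locq_of dK c := rhoE c.
clearbody rho'.
exists (locq dL), g, (resfield iota pP), rho'; split; last first.
  by apply/eqP => /locq_of_eq0[u Su] /= /ap.
split=> [y|x].
  have [b [s [Ss e]]] := locq_frac y.
  have [u us] := @locq_of_unit _ _ _ dL _ Ss.
  exists (u * locq_of dL b); rewrite rmorphM rhoE -e.
  rewrite mulrCA; have -> : locq_of dK s = rho' (locq_of dL s) by rewrite rhoE.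
  by rewrite -rmorphM us rmorph1 mulr1.
have [b [s [Ss e]]] := locq_frac x.
have [u us] := @locq_of_unit _ _ _ dL _ Ss.
move=> rx; have pb : ~ p b.
  move=> pb; move/eqP: rx; apply.
  have b0 : locq_of dK b = 0.
    by apply/locq_of_eq0; exists 1; [exact: ld_S1|rewrite mul1r].
  have : rho' (x * locq_of dL s) = 0 by rewrite e rhoE.
  move=> /(congr1 (fun z => rho' u * z)); rewrite mulr0 -rmorphM mulrCA us mulr1.
  done.
have [v vb] := @locq_of_unit _ _ _ dL _ pb.
by exists (v * locq_of dL s); rewrite -mulrA [_ s * x]mulrC e.
Qed.

(** * Direct summands as row spans *)

Section RowSpans.
Variables (R : comNzRingType) (m : nat).
Implicit Types (U V : set 'rV[R]_m).

Definition rowsp r (B : 'M[R]_(r, m)) : set 'rV[R]_m := [set x | exists u, x = u *m B].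

Lemma rowsp_submodule r (B : 'M[R]_(r, m)) : is_submodule (rowsp B).
Proof.
split; first by exists 0; rewrite mul0mx.
by move=> a _ _ [u ->] [v ->]; exists (a *: u + v); rewrite mulmxDl scalemxAl.
Qed.

Lemma submodule_mulmx U r (B : 'M[R]_(r, m)) :
  is_submodule U -> (forall i, U (row i B)) -> rowsp B `<=` U.
Proof.
move=> [U0 Ul] UB _ [u ->]; rewrite mulmx_sum_row.
elim/big_ind: _ => // [x y Ux Uy|i _].
  by rewrite -[x]scale1r; apply: Ul.
by rewrite -[_ *: _]addr0; apply: Ul.
Qed.

Lemma submodule_sub U : is_submodule U -> forall x y, U x -> U y -> U (x - y).
Proof. by move=> [_ Ul] x y Ux Uy; rewrite addrC -scaleN1r; apply: Ul. Qed.

Lemma rowsp_row r (B : 'M[R]_(r, m)) i : rowsp B (row i B).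
Proof. by exists (delta_mx 0 i); rewrite rowE. Qed.

Lemma rowsp_subP r s (B : 'M[R]_(r, m)) (D : 'M[R]_(s, m)) :
  rowsp B `<=` rowsp D -> exists X, B = X *m D.
Proof.
move=> h; have /choice[f fP] : forall i, exists u, row i B = u *m D.
  by move=> i; apply: h; exact: rowsp_row.
exists (\matrix_i f i); apply/row_matrixP => i.
by rewrite row_mul rowK fP.
Qed.

Lemma projector_exists U : is_direct_summand U -> exists P, is_projector U P.
Proof.
move=> [Us [W Ws [UW UW0]]].
have /choice[f fP] : forall i : 'I_m, exists y, U y /\ W (delta_mx 0 i - y).
  move=> i; have [y [z [Uy Wz ->]]] := UW (delta_mx 0 i).
  by exists y; rewrite addrC addKr.
pose P : 'M[R]_m := \matrix_i f i.
have UP : rowsp P `<=` U.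
  by apply: submodule_mulmx => // i; rewrite rowK; case: (fP i).
have WP : rowsp (1%:M - P) `<=` W.
  by apply: submodule_mulmx => // i; rewrite raddfB /= rowK row1; case: (fP i).
exists P; split=> [x|x Ux]; first by apply: UP; exists x.
apply/esym/eqP; rewrite -subr_eq0; apply/eqP/UW0.
  by apply: submodule_sub => //; apply: UP; exists x.
by apply: WP; exists x; rewrite mulmxBr mulmx1.
Qed.

Lemma projector_rowsp U P : is_projector U P -> U = rowsp P.
Proof.
move=> [PU UP]; apply/seteqP; split=> [x Ux|_ [u ->]]; last exact: PU.
by exists x; rewrite UP.
Qed.

Lemma projectorM U P r (B : 'M[R]_(r, m)) : is_projector U P ->
  rowsp B `<=` U -> B *m P = B.
Proof.
move=> [_ UP] BU; apply/row_matrixP => i; rewrite row_mul UP //.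
by apply: BU; exact: rowsp_row.
Qed.

Lemma projector_idem U P : is_projector U P -> P *m P = P.
Proof.
by move=> PP; apply: (projectorM PP); rewrite (projector_rowsp PP).
Qed.

Lemma idem_projector P : P *m P = P -> is_projector (rowsp P) P.
Proof.
move=> PP; split=> [x|_ [u ->]]; first by exists x.
by rewrite -mulmxA PP.
Qed.

Lemma idem_summand P : P *m P = P -> is_direct_summand (rowsp P).
Proof.
move=> PP; split; first exact: rowsp_submodule.
exists (rowsp (1%:M - P)); first exact: rowsp_submodule.
split=> [x|_ [u ->] [v /(congr1 (mulmx^~ P))]].
  exists (x *m P), (x *m (1%:M - P)); split; [by exists x|by exists x|].
  by rewrite mulmxBr mulmx1 addrC subrK.
by rewrite -!mulmxA mulmxBl mul1mx PP subrr mulmx0.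
Qed.

(** A free direct summand of rank r: the right inverse [C] makes the rows of [B] a basis and gives
    the projector C B. *)
Definition framed r U := exists (B : 'M[R]_(r, m)) C, B *m C = 1%:M /\ U = rowsp B.

Lemma frame_projector r (B : 'M[R]_(r, m)) C : B *m C = 1%:M ->
  is_projector (rowsp B) (C *m B).
Proof.
move=> BC; split=> [x|_ [u ->]]; first by exists (x *m C); rewrite mulmxA.
by rewrite mulmxA -[u *m B *m C]mulmxA BC mulmx1.
Qed.

Lemma framed_summand r U : framed r U -> is_direct_summand U.
Proof.
move=> [B [C [BC ->]]]; have BP := frame_projector BC.
by rewrite (projector_rowsp BP); apply: idem_summand; exact: projector_idem BP.
Qed.

(** The matrix expressing one frame in the other is square with a right inverse, hence invertible.
    Equalities of modules thereby reduce to one inclusion. *)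
Lemma framed_eq r U V : framed r U -> framed r V -> U `<=` V -> U = V.
Proof.
move=> [B [C [BC ->]]] [D [C' [_ ->]]] sUV.
have [X XE] := rowsp_subP sUV.
apply/seteqP; split=> // _ [u ->].
have : D *m C *m X = 1%:M by apply: mulmx1C; rewrite mulmxA -XE.
move=> e; exists (u *m (D *m C)); rewrite XE mulmxA -[u *m _ *m X]mulmxA e.
by rewrite mulmx1.
Qed.

End RowSpans.

Lemma bilin_row (R : comNzRingType) m (G : 'M[R]_m) r (B : 'M_(r, m)) s (D : 'M_(s, m)) i j :
  (row i B *m G *m (row j D)^T) 0 0 = (B *m G *m D^T) i j.
Proof. by rewrite -row_mul !mxE; apply: eq_bigr => l _; rewrite !mxE. Qed.

Lemma bilin_rows0 (R : comNzRingType) m (G : 'M[R]_m) r (B : 'M_(r, m)) s (D : 'M_(s, m)) :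
    (forall x y, rowsp B x -> rowsp D y -> (x *m G *m y^T) 0 0 = 0) ->
  B *m G *m D^T = 0.
Proof.
move=> h; apply/matrixP => i j; rewrite -bilin_row h ?mxE //; exact: rowsp_row.
Qed.

Lemma perp_rowsp (R : comNzRingType) m (G : 'M[R]_m) r (B : 'M_(r, m)) (y : 'rV_m) :
  (forall x, rowsp B x -> (x *m G *m y^T) 0 0 = 0) <-> y *m (B *m G)^T = 0.
Proof.
split=> [h|h _ [u ->]].
  apply: trmx_inj; rewrite trmx_mul trmxK trmx0; apply/matrixP => i j.
  by rewrite ord1 -(bilin_row G B y i 0) row_id h ?mxE //; exact: rowsp_row.
have -> : u *m B *m G *m y^T = u *m (y *m (B *m G)^T)^T.
  by rewrite trmx_mul trmxK !mulmxA.
by rewrite h trmx0 mulmx0 mxE.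
Qed.

(* Both sides have rank n in a space of rank 2n. *)
Lemma framed_perp (R : comNzRingType) n (U V : set 'rV[R]_(n + n)) (G G' : 'M[R]_(n + n)) :
    framed n U -> framed n V -> G' *m G = 1%:M ->
    (forall x y, U x -> V y -> (x *m G *m y^T) 0 0 = 0) ->
  [set y : 'rV[R]_(n + n) | forall x, U x -> (x *m G *m y^T) 0 0 = 0] = V.
Proof.
move=> [B [C [BC ->]]] [B' [C' [BC' ->]]] /mulmx1C GG' /bilin_rows0 orth.
pose X := (B *m G)^T.
have XB' : B' *m X = 0.
  by apply: trmx_inj; rewrite trmx_mul trmxK trmx0.
pose D := (G' *m C)^T.
have DX : D *m X = 1%:M.
  by rewrite /D /X -trmx_mul mulmxA -[B *m G *m G']mulmxA GG' mulmx1 BC trmx1.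
(* [col_mx B' D] is square, so this right inverse is also a left inverse; it splits any y as a
   combination of the rows of B' plus (y X) D, and y X = 0 says that y is orthogonal to U. *)
pose Y : 'M_(n + n) := row_mx ((1%:M - X *m D) *m C') X.
have ZY : col_mx B' D *m Y = 1%:M.
  rewrite mul_col_row !mulmxA !mulmxBr !mulmx1 mulmxA XB' mul0mx subr0 BC'.
  by rewrite mulmxA DX mul1mx subrr mul0mx -scalar_mx_block.
have YZ := mulmx1C ZY.
apply/seteqP; split=> y /=.
  move=> /perp_rowsp yX; exists (y *m (1%:M - X *m D) *m C').
  move: YZ; rewrite mul_row_col => /(congr1 (mulmx y)); rewrite mulmx1 => yE; rewrite -[LHS]yE.
  by rewrite mulmxDr !mulmxA [y *m X]yX mul0mx addr0.
move=> yB'; apply/perp_rowsp; case: yB' => u ->.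
by rewrite -mulmxA [B' *m _]XB' mulmx0.
Qed.

(** * Base change of direct summands, and freeness over local rings *)

Section BaseChange.
Variables (R S : comNzRingType) (g : {rmorphism R -> S}) (m : nat).

Lemma base_change_rowsp r (B : 'M[R]_(r, m)) :
  base_change g (rowsp B) = rowsp (map_mx g B).
Proof.
apply/seteqP; split=> [x|x Bx W Ws hW].
  apply; first exact: rowsp_submodule.
  by move=> _ [_ [u ->] <-]; exists (map_mx g u); rewrite map_mxM.
apply: (submodule_mulmx Ws) Bx => i; apply: hW.
by exists (row i B); [exact: rowsp_row|rewrite map_row].
Qed.

Lemma framed_bc r U : framed r U -> framed r (base_change g U : set 'rV[S]_m).
Proof.
move=> [B [C [BC ->]]]; exists (map_mx g B), (map_mx g C).
by rewrite -map_mxM BC map_mx1 base_change_rowsp.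
Qed.

Lemma base_change_min U (V : set 'rV[S]_m) : is_submodule V ->
  (forall x, U x -> V (map_mx g x)) -> base_change g U `<=` V.
Proof. by move=> Vs h x; apply=> // _ [y Uy <-]; exact: h. Qed.

Lemma bc_projector U P : is_projector U P ->
  is_projector (base_change g U : set 'rV[S]_m) (map_mx g P).
Proof.
move=> PU; rewrite (projector_rowsp PU) base_change_rowsp.
by apply: idem_projector; rewrite -map_mxM (projector_idem PU).
Qed.

Lemma bc_summand U : is_direct_summand U ->
  is_direct_summand (base_change g U : set 'rV[S]_m).
Proof.
move=> /projector_exists[P /bc_projector PU].
rewrite (projector_rowsp PU); apply: idem_summand; exact: projector_idem PU.
Qed.
End BaseChange.

Lemma base_change_id (R : comNzRingType) m (U : set 'rV[R]_m) (g : R -> R) :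
  (forall x, g x = x) -> is_submodule U -> base_change g U = U.
Proof.
move=> gid Us; have gx k (x : 'rV[R]_k) : map_mx g x = x by apply/rowP => j; rewrite mxE gid.
apply/seteqP; split=> [x|x Ux W _]; last by apply; exists x.
by apply=> // _ [y Uy <-]; rewrite gx.
Qed.

Lemma base_change_comp (R S T : comNzRingType) m (g : {rmorphism R -> S})
    (h : {rmorphism S -> T}) (U : set 'rV[R]_m) : is_direct_summand U ->
  base_change h (base_change g U) = base_change (h \o g) U.
Proof.
move=> /projector_exists[P /projector_rowsp->].
rewrite !base_change_rowsp; congr rowsp; apply/matrixP => i j.
by rewrite !mxE.
Qed.

Lemma bc_rank (R S : comNzRingType) m (g : {rmorphism R -> S}) (U : set 'rV[R]_m) r :
  is_direct_summand U -> has_rank U r -> has_rank (base_change g U) r.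
Proof.
move=> Us Ur K h; have [A A1 A2] := Ur K (h \o g : {rmorphism R -> K}).
by exists A => // x; rewrite base_change_comp.
Qed.

Lemma framed_rank (R : comNzRingType) m r (U : set 'rV[R]_m) : framed r U -> has_rank U r.
Proof.
move=> [B [C [BC ->]]] K g; exists (map_mx g B).
  by apply/row_freeP; exists (map_mx g C); rewrite -map_mxM BC map_mx1.
move=> x; rewrite base_change_rowsp; split; first by case=> u ->; exact: submxMl.
by move=> /submxP[u ->]; exists u.
Qed.

Lemma local_unit_det (L : comNzRingType) (K : fieldType) (rho : {rmorphism L -> K})
    n (A : 'M[L]_n) :
  is_local rho -> \det (map_mx rho A) != 0 -> exists A', A *m A' = 1%:M.
Proof.
move=> [_ lu]; rewrite det_map_mx => /lu[y yA].
exists (y *: \adj A); rewrite -scalemxAr mul_mx_adj.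
by rewrite scale_scalar_mx yA.
Qed.

(** Nakayama's lemma through idempotents: a basis of the fibre lifts to vectors of U that split off,
    and the complement left in U is zero modulo the maximal ideal. *)
Lemma local_framed (L : comNzRingType) (K : fieldType) (rho : {rmorphism L -> K})
    m r (U : set 'rV[L]_m) :
  is_local rho -> is_direct_summand U -> has_rank U r -> framed r U.
Proof.
move=> loc Us /(_ K rho)[A Afree AU].
have [P PU] := projector_exists Us.
have UE := projector_rowsp PU; have PP := projector_idem PU.
have rhoU : base_change rho U = rowsp (map_mx rho P) by rewrite UE base_change_rowsp.
have [D AD] := row_freeP Afree.
have AP : rowsp A `<=` rowsp (map_mx rho P).
  by move=> x [u ->]; rewrite -rhoU; apply/AU; exact: submxMl.
have [X XE] := rowsp_subP AP.
have PA : rowsp (map_mx rho P) `<=` rowsp A.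
  by move=> x; rewrite -rhoU => /AU/submxP.
have [Y YE] := rowsp_subP PA.
have lift_mx a b (M : 'M[K]_(a, b)) : exists M', map_mx rho M' = M.
  have /choice[f fP] : forall y, exists x, rho x = y by case: loc.
  by exists (map_mx f M); apply/matrixP => i j; rewrite !mxE fP.
have [Xl XlE] := lift_mx _ _ X; have [Dl DlE] := lift_mx _ _ D.
pose B := Xl *m P.
have rB : map_mx rho B = A by rewrite map_mxM XlE -XE.
have [Z BDZ] : exists Z, B *m Dl *m Z = 1%:M.
  apply: (local_unit_det loc); rewrite map_mxM rB DlE AD det1; exact: oner_neq0.
pose C := Dl *m Z; have BC : B *m C = 1%:M by rewrite mulmxA.
have BP : B *m P = B by rewrite /B -mulmxA PP.
(* N is the idempotent onto what [B] misses in U. It dies under [rho], so 1 - N is invertible, and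
   (1 - N) N = 0 kills it. *)
pose N := P *m (1%:M - C *m B).
have NN : N *m N = N.
  rewrite /N mulmxA -[P *m _ *m P]mulmxA [(1%:M - _) *m P]mulmxBl mul1mx.
  rewrite -[C *m B *m P]mulmxA BP -mulmxA [(P - _) *m _]mulmxBl.
  rewrite [C *m B *m (_ - _)]mulmxBr mulmx1 -[C *m B *m (C *m B)]mulmxA.
  by rewrite [B *m (C *m B)]mulmxA BC mul1mx subrr subr0 mulmxA PP.
have rN : map_mx rho N = 0.
  rewrite map_mxM map_mxB map_mx1 map_mxM rB YE mulmxBr mulmx1 !mulmxA.
  rewrite -[Y *m A *m _]mulmxA.
  have -> : A *m map_mx rho C = 1%:M by rewrite -rB -map_mxM BC map_mx1.
  by rewrite mulmx1 subrr.
have [N' NN'] : exists N', (1%:M - N) *m N' = 1%:M.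
  apply: (local_unit_det loc); rewrite map_mxB map_mx1 rN subr0 det1; exact: oner_neq0.
have N0 : N = 0.
  by rewrite -[N]mulmx1 -NN' mulmxA mulmxBr mulmx1 NN subrr mul0mx.
exists B, C; split=> //; rewrite UE; apply/seteqP; split=> x [u ->].
  exists (u *m P *m C); rewrite -[u *m P *m C]mulmxA -[u *m _ *m B]mulmxA.
  congr (_ *m _); apply/eqP; rewrite -subr_eq0; apply/eqP.
  by rewrite -[RHS]N0 /N mulmxBr mulmx1 -[P *m C *m B]mulmxA.
by exists (u *m Xl); rewrite mulmxA.
Qed.

(** Sylvester's identity, from two triangular factorizations of one block matrix. *)
Lemma det_1D_mulC (R : comNzRingType) m n (U : 'M[R]_(m, n)) (V : 'M_(n, m)) :
  \det (1%:M + U *m V) = \det (1%:M + V *m U).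
Proof.
pose Z := block_mx 1%:M (- U) V 1%:M : 'M_(m + n).
have Z1 : Z = block_mx 1%:M 0 V 1%:M *m block_mx 1%:M (- U) 0 (1%:M + V *m U).
  rewrite mulmx_block !mul1mx !mulmx1 !mul0mx !addr0 mulmxN.
  by rewrite addrCA addNr addr0.
have Z2 : Z = block_mx 1%:M (- U) 0 1%:M *m block_mx (1%:M + U *m V) 0 V 1%:M.
  rewrite mulmx_block !mul1mx !mulmx1 !mul0mx !add0r mulNmx.
  by rewrite addrK.
have := congr1 determinant Z1; rewrite {1}Z2 !det_mulmx !det_lblock !det_ublock !det1.
by rewrite !(mul1r, mulr1).
Qed.

(** The matrix determinant lemma, with an extra factor [x] on the left so that x need not be
    invertible. *)
Lemma det_sub_rank1 (R : comNzRingType) n (x : R) (c : 'cV_n) (z : 'rV_n) :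
  \det (x%:M - c *m z) * x = x ^+ n * (x - (z *m c) 0 0).
Proof.
pose Z := block_mx x%:M c z 1%:M : 'M_(n + 1).
have Z1 : Z = block_mx 1%:M c 0 1%:M *m block_mx (x%:M - c *m z) 0 z 1%:M.
  rewrite mulmx_block !mul1mx !mulmx1 !mul0mx !add0r.
  by rewrite subrK.
have Z2 : block_mx 1%:M 0 (- z) x%:M *m Z = block_mx x%:M c 0 (x%:M - z *m c).
  rewrite mulmx_block !mul1mx !mulmx1 !mul0mx !addr0 !mulNmx.
  by rewrite mul_mx_scalar mul_scalar_mx addNr [- _ + _]addrC.
have := congr1 determinant Z2; rewrite det_mulmx Z1 !det_mulmx.
rewrite !det_lblock !det_ublock !det1 !(mul1r, mulr1) det_scalar1.
rewrite det_scalar det_mx11 mulrC => ->.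
by congr (_ * _); rewrite [in LHS]mxE [in LHS]mxE [in X in _ + X]mxE mulr1n.
Qed.

Section CharPolyOn.
Variables (R : comNzRingType) (m : nat) (A : 'M[R]_m).

(** The matrix in [charpoly_on] is 1 plus a product factoring through R^n, so Sylvester's identity
    reduces its determinant to size n. *)
Lemma charpoly_framed n (B : 'M[R]_(n, m)) C M :
  B *m C = 1%:M -> B *m A = M *m B ->
  charpoly_on (rowsp B) A (\det ('X%:M - map_mx polyC M)).
Proof.
move=> BC BA; exists (C *m B); first exact: frame_projector.
rewrite map_mxB map_mx1 !map_mxM; set c := map_mx _ C; set b := map_mx _ B.
set a := map_mx _ A; set w := map_mx _ M.
have bc : b *m c = 1%:M by rewrite -map_mxM BC map_mx1.
have ba : b *m a = w *m b by rewrite -!map_mxM BA.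
have -> : 1%:M - c *m b + c *m b *m ('X%:M - a) =
          1%:M + c *m (('X%:M - w - 1%:M) *m b).
  rewrite -addrA; congr (_ + _).
  rewrite -mulmxA mulmxBr ba !mulmxBl mul1mx !mulmxBr.
  by rewrite mul_mx_scalar mul_scalar_mx addrC.
by rewrite det_1D_mulC -mulmxA bc mulmx1 addrCA subrr addr0.
Qed.

(** [charpoly_on] only asserts the existence of one suitable projector. Independence of this choice
    is what lets a projector over R be compared with the one found over a localization. *)
Lemma charpoly_projector (U : set 'rV[R]_m) (P : 'M_m) p :
    (forall x, U x -> U (x *m A)) -> is_projector U P -> charpoly_on U A p ->
  \det (map_mx polyC (1%:M - P) + map_mx polyC P *m ('X%:M - map_mx polyC A)) = p.
Proof.
move=> UA PU [Q QU <-].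
have PUr : rowsp P `<=` U by rewrite (projector_rowsp PU).
have QUr : rowsp Q `<=` U by rewrite (projector_rowsp QU).
have PQ : P *m Q = P := projectorM QU PUr.
have QP : Q *m P = Q := projectorM PU QUr.
have QA : Q *m A *m P = Q *m A.
  apply: (projectorM PU) => _ [u ->]; rewrite mulmxA; apply: UA.
  by apply: QUr; exists u.
rewrite !map_mxB !map_mx1; set p' := map_mx _ P; set q := map_mx _ Q.
set a := map_mx _ A.
have pq : p' *m q = p' by rewrite -map_mxM PQ.
have qp : q *m p' = q by rewrite -map_mxM QP.
have qa : q *m a *m p' = q *m a by rewrite -!map_mxM QA.
have h r : 1%:M - r + r *m ('X%:M - a) = 1%:M + r *m ('X%:M - a - 1%:M).
  by rewrite [in RHS]mulmxBr mulmx1 -addrA [- r + _]addrC.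
rewrite !h -{1}pq -mulmxA det_1D_mulC; congr (\det (_ + _)).
rewrite !mulmxBr !mulmxBl !mulmx1 qp qa; congr (_ - _ - _).
by rewrite !mul_mx_scalar -scalemxAl qp.
Qed.

End CharPolyOn.

(** This is [det_sub_rank1] at X + e, which is monic and can be cancelled; the condition z c = 2 e
    turns X + e - z c into X - e. *)
Lemma charpoly_rank1 (R : comNzRingType) n (e : R) (c : 'cV_n) (z : 'rV_n) :
  (0 < n)%N -> z *m c = (2%:R * e)%:M ->
  \det ('X%:M - map_mx polyC (c *m z - e%:M)) =
    ('X + e%:P) ^+ n.-1 * ('X - e%:P).
Proof.
move=> n0 zc; have Xm : 'X + e%:P \is monic by rewrite -[e]opprK polyCN monicXsubC.
apply: (monic_rreg Xm).
have -> : 'X%:M - map_mx polyC (c *m z - e%:M) =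
    ('X + e%:P)%:M - map_mx polyC c *m map_mx polyC z.
  rewrite map_mxB map_mxM map_scalar_mx /= (raddfD (@scalar_mx _ _)).
  by rewrite opprB addrA.
rewrite det_sub_rank1 -map_mxM zc map_scalar_mx mxE /= mulr1n.
rewrite -[in LHS](prednK n0) exprS polyCM polyC_natr; ring.
Qed.

(** * Transition and Gram matrices of the lattices *)

Section LatticeMatrices.
Variables (E : ramified_quadratic) (n : nat).
Local Notation F0 := (rqF0 E).
Local Notation F := (rqF E).
Local Notation conj := (@rq_conj E).
Local Notation OF0 := (OF0 E).
Local Notation OF := (OF E).
Local Notation pi := (rq_pi E).

Lemma pi_neq0 : pi != 0. Proof. by case: (rq_pi_unif E). Qed.

Lemma half_OF : exists h : OF, h * 2%:R = 1.
Proof.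
have r2 : @rq_res E 2%:R != 0.
  rewrite rmorph_nat; apply: contra (rq_odd E) => /eqP h.
  by rewrite inE /= h eqxx.
have v2 := rq_res_ker (2%:R : int_ring (rq_v E)); rewrite (negPf r2) in v2.
have i2 := valP (2%:R : int_ring (rq_v E)).
set t := \val _ in v2 i2; have t0 : t != 0.
  by apply/eqP => t0; move: v2; rewrite t0 /val_ge eqxx.
have vt : rq_v E t = 0.
  by move: v2 i2; rewrite unfold_in /val_ge (negPf t0) /= => h1 h2; lia.
have vti : t^-1 \in integers (rq_v E).
  rewrite unfold_in /val_ge; have := dvM (rq_v E) (x := t^-1) (y := t).
  rewrite invr_eq0 mulVf // dv1 vt addr0 => <- //.
  by rewrite lexx orbT.
exists (IntRing vti); apply: val_inj; rewrite /= -/t.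
by rewrite mulVf.
Qed.

Lemma two_neq0 : (2%:R : F) != 0.
Proof.
have [h eh] := half_OF.
have e : int_val h * 2%:R = 1 := congr1 (@int_val _ _) eh.
by apply/eqP => t0; move: e; rewrite t0 mulr0 => /eqP; rewrite eq_sym oner_eq0.
Qed.

Lemma conj_scalar (a : F0) : conj a%:A = a%:A.
Proof. by rewrite linearZ rmorph1. Qed.

(** The square of pi is fixed, so its conjugate is pi or - pi, and the first would make the
    conjugation trivial. *)
Lemma conj_pi : conj pi = - pi.
Proof.
have : (conj pi - pi) * (conj pi + pi) == 0.
  rewrite -subr_sqr -rmorphXn /= rq_piE conj_scalar subrr //.
rewrite mulf_eq0 subr_eq0 addr_eq0 => /orP[/eqP h|/eqP//].
have [x] := rq_conj_neq E; have [a [b ->]] := rq_decomp x.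
by rewrite rmorphD /= linearZ rmorph1 linearZ /= h eqxx.
Qed.

Lemma incl0_inj : injective (@incl0 E).
Proof.
move=> a b /eqP; rewrite /incl0 -subr_eq0 -scalerBl scaler_eq0 oner_eq0 orbF.
by rewrite subr_eq0 => /eqP/val_inj.
Qed.

Lemma inclO_zmod : zmod_morphism (@inclO E).
Proof. by move=> a b; apply: val_inj; rewrite /= /incl0 -scalerBl. Qed.
Lemma inclO_monoid : monoid_morphism (@inclO E).
Proof.
split=> [|a b]; apply: val_inj; rewrite /= /incl0 /=; first by rewrite scale1r.
by rewrite -scalerAl mul1r scalerA.
Qed.
HB.instance Definition _ := GRing.isZmodMorphism.Build OF0 OF (@inclO E) inclO_zmod.
HB.instance Definition _ := GRing.isMonoidMorphism.Build OF0 OF (@inclO E) inclO_monoid.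

Lemma incl0_zmod : zmod_morphism (@incl0 E).
Proof. by move=> a b; rewrite /incl0 -scalerBl. Qed.
Lemma incl0_monoid : monoid_morphism (@incl0 E).
Proof.
split=> [|a b]; rewrite /incl0 /=; first by rewrite scale1r.
by rewrite -scalerAl mul1r scalerA.
Qed.
HB.instance Definition _ := GRing.isZmodMorphism.Build OF0 F (@incl0 E) incl0_zmod.
HB.instance Definition _ := GRing.isMonoidMorphism.Build OF0 F (@incl0 E) incl0_monoid.

Section StructMap.
Variable R : comAlgType OF.
Lemma struct_map_zmod : zmod_morphism (@struct_map E R).
Proof. by move=> a b; rewrite /struct_map rmorphB /= scalerBl. Qed.
Lemma struct_map_monoid : monoid_morphism (@struct_map E R).
Proof.
split=> [|a b]; rewrite /struct_map ?rmorph1 ?scale1r // rmorphM /=.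
by rewrite -scalerAl mul1r scalerA.
Qed.
HB.instance Definition _ :=
  GRing.isZmodMorphism.Build OF0 R (@struct_map E R) struct_map_zmod.
HB.instance Definition _ :=
  GRing.isMonoidMorphism.Build OF0 R (@struct_map E R) struct_map_monoid.
End StructMap.

Lemma pi0_int : rq_pi0 E \in integers (rq_v0 E).
Proof. by case: (rq_pi0_unif E) => p0 vp; rewrite unfold_in /val_ge vp orbT. Qed.
Definition pi0O : OF0 := IntRing pi0_int.

Lemma struct_map_pi0 (R : comAlgType OF) : struct_map R pi0O = pi_R R ^+ 2.
Proof.
rewrite /struct_map /pi_R expr2 -scalerAl mul1r scalerA; congr (_ *: _).
by apply: val_inj; rewrite /= /incl0 /= -rq_piE expr2.
Qed.

Lemma lat_expE (b : int) (c : nat) (l : 'I_n) : (c < n)%N ->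
  lat_exp (c%:Z + b * n%:Z) l = b + (l < c)%N%:Z :> int.
Proof.
move=> cn; have n0 : n%:Z != 0 by apply/eqP => h; lia.
rewrite /lat_exp [c%:Z + _]addrC divzMDl // modzMDl divz_small ?modz_small; [|lia..].
by rewrite addr0.
Qed.

Lemma lat_exp_shift (b i : int) (l : 'I_n) : lat_exp (i + b * n%:Z) l = lat_exp i l + b :> int.
Proof.
have n0 : n%:Z != 0 by case: l => l; case: n.
rewrite /lat_exp [i + _]addrC divzMDl // modzMDl; lia.
Qed.

Lemma lat_exp_dual i (l : 'I_n) : lat_exp (n%:Z - i) (rev_ord l) = 1 - lat_exp i l :> int.
Proof.
have ln := ltn_ord l; have n0 : n%:Z != 0 by lia.
have [c cn ce] : exists2 c : nat, (c < n)%N & (i %% n%:Z)%Z = c%:Z.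
  have h1 := modz_ge0 i n0; have h2 := ltz_mod i n0.
  by exists `|(i %% n%:Z)%Z|%N; lia.
have [q ->] : exists q, i = q * n%:Z + c%:Z.
  by exists (i %/ n%:Z)%Z; rewrite -ce -divz_eq.
(* For c = 0 the residue of n - i is 0, not n - c. *)
case: (posnP c) => [c0|c0].
  have -> : n%:Z - (q * n%:Z + c%:Z) = 0%N%:Z + (1 - q) * n%:Z by lia.
  rewrite lat_expE; last by lia.
  rewrite [_ + c%:Z]addrC lat_expE // /=; lia.
have -> : n%:Z - (q * n%:Z + c%:Z) = (n - c)%N%:Z + (- q) * n%:Z by lia.
rewrite lat_expE; last by lia.
rewrite [_ + c%:Z]addrC lat_expE // /=; lia.
Qed.

(** The two O_F0-coordinates belonging to e_l regrouped into one coefficient in F; inclusions of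
    lattices then act on each coefficient as a power of pi. *)
Definition cplx (u : 'rV[OF0]_(n + n)) l : F :=
  incl0 (u 0 (lshift n l)) + int_val (u 0 (rshift n l)) *: pi.

Lemma cplxE u l : cplx u l = incl0 (u 0 (lshift n l)) + incl0 (u 0 (rshift n l)) * pi.
Proof. by rewrite /cplx /incl0 mulr_algl. Qed.

Lemma lat_vec_delta i a : row a (lat_basis E n i) = lat_vec i (delta_mx 0 a).
Proof.
rewrite /lat_vec rowE; congr (_ *m _); apply/rowP => j; rewrite !mxE /=.
by case: (j == a); rewrite /= /incl0 ?scale1r ?scale0r.
Qed.

Lemma lat_mxP i j f (X : 'M[OF0]_(n + n)) :
  (forall u, lat_vec j (u *m X) = f (lat_vec i u)) -> lat_mx i j f = X.
Proof.
move=> h; apply/row_matrixP => a; rewrite rowK lat_vec_delta -h -rowE.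
rewrite /lat_coord; case: xgetP => [w _ /= /lat_vec_inj->//|/(_ (row a X))].
by move=> /(_ erefl).
Qed.

Definition Pim : 'M[OF0]_(n + n) := block_mx 0 1%:M pi0O%:M 0.
Definition Dg (chi : 'I_n -> bool) : 'M[OF0]_n := diag_mx (\row_l (chi l)%:R).
(** Multiplication by pi on the coordinates selected by [chi] and by 1 on the others; [PT] adds D
    further factors pi everywhere. The exponents are the differences of [lat_exp] between the two
    lattices. *)
Definition Tm (chi : 'I_n -> bool) : 'M[OF0]_(n + n) :=
  block_mx (Dg (negb \o chi)) (Dg chi) (pi0O *: Dg chi) (Dg (negb \o chi)).
Definition PT D chi := iter D (mulmx Pim) (Tm chi).

Lemma cplx_Pim u l : cplx (u *m Pim) l = pi * cplx u l.
Proof.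
rewrite !cplxE -[u]hsubmxK mul_row_block !mulmx0 mulmx1 add0r addr0.
rewrite mul_mx_scalar !row_mxEl !row_mxEr mulrDr addrC ![in LHS]mxE rmorphM.
congr (_ + _); first by rewrite mulrC mxE.
by rewrite mulrCA -expr2 rq_piE mulrC mxE.
Qed.

Lemma cplx_Tm chi u l : cplx (u *m Tm chi) l = pi ^+ (chi l) * cplx u l.
Proof.
rewrite !cplxE -[u]hsubmxK mul_row_block -scalemxAr !mul_mx_diag.
rewrite !row_mxEl !row_mxEr !mxE /=.
case: (chi l); rewrite /= ?rmorph0 ?rmorph1 !(mulr0, mulr1, addr0, add0r).
  rewrite expr1 rmorphM mulrDr addrC; congr (_ + _); first by rewrite mulrC.
  by rewrite mulrCA -expr2 rq_piE mulrC.
by rewrite expr0 mul1r.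
Qed.

Lemma cplx_PT D chi u l : cplx (u *m PT D chi) l = pi ^+ (D + chi l) * cplx u l.
Proof.
elim: D u => [|D IH] u; first by rewrite cplx_Tm.
by rewrite /PT iterS mulmxA IH cplx_Pim mulrA addSn exprSr.
Qed.

Lemma lat_mx_PT i j D (chi : 'I_n -> bool) :
  (forall l, lat_exp j l = lat_exp i l + D%:Z + (chi l : nat)%:Z :> int) ->
  lat_mx i j id = PT D chi.
Proof.
move=> h; apply: lat_mxP => u; apply/rowP => l.
rewrite !lat_vecE -/(cplx _ l) cplx_PT -/(cplx _ l) mulrA; congr (_ * _).
rewrite exprnP -expfzDr ?pi_neq0 // h; congr (_ ^ _).
by rewrite PoszD; ring.
Qed.

Lemma lat_mx_pi i : lat_mx i i (@scale_pi E n) = Pim.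
Proof.
apply: lat_mxP => u; apply/rowP => l.
by rewrite /scale_pi [RHS]mxE !lat_vecE -/(cplx _ l) cplx_Pim -/(cplx _ l) mulrCA.
Qed.

Lemma lat_mx_period i : lat_mx i (i - n%:Z) (@scale_pi E n) = 1%:M.
Proof.
apply: lat_mxP => u; apply/rowP => l.
rewrite mulmx1 /scale_pi [RHS]mxE !lat_vecE mulrA; congr (_ * _).
have -> : i - n%:Z = i + (-1) * n%:Z by ring.
rewrite lat_exp_shift -[X in X * _]expr1z -expfzDr ?pi_neq0 //; congr (_ ^ _); ring.
Qed.

(** The signs come from conj (pi ^ a) = (-1) ^ a pi ^ a. *)
Definition Km i : 'M[OF0]_n :=
  \matrix_(l, m) ((-1) ^+ `|lat_exp i l|%N *+ (m == rev_ord l)).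

Lemma pair_basis (a c : int) (l m : 'I_n) :
  pair_tr (pi ^ a *: delta_mx 0 l) (pi ^ c *: delta_mx 0 m : 'rV[F]_n) =
  2%:R^-1 * ((-1) ^ a * (1 + (-1) ^ (a + c)) * pi ^ (a + c)) *+ (m == rev_ord l).
Proof.
have cpi b : conj (pi ^ b) = (-1) ^ b * pi ^ b.
  rewrite rmorphXz /= ?unitfE ?pi_neq0 // conj_pi.
  by rewrite -exprzMl ?mulN1r // unitfE ?oppr_eq0 ?oner_neq0 ?pi_neq0.
have -> : 2%:R^-1 * ((-1) ^ a * (1 + (-1) ^ (a + c)) * pi ^ (a + c)) *+ (m == rev_ord l) =
    2%:R^-1 * ((-1) ^ a * (1 + (-1) ^ (a + c)) * pi ^ (a + c) *+ (m == rev_ord l)).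
  by rewrite mulrnAr.
rewrite /pair_tr; congr (_ * _).
have hE : herm (pi ^ a *: delta_mx 0 l) (pi ^ c *: delta_mx 0 m : 'rV[F]_n) =
    (-1) ^ a * pi ^ (a + c) *+ (m == rev_ord l).
  rewrite /herm (bigD1 l) //= big1 ?addr0 => [|j jl]; last first.
    by rewrite !mxE (negPf jl) andbF mulr0 rmorph0 mul0r.
  rewrite !mxE !eqxx /= mulr1 cpi [rev_ord l == m]eq_sym.
  by rewrite expfzDr ?pi_neq0 // !mulrA mulr_natr.
rewrite hE; case: eqP => _; last by rewrite !mulr0n rmorph0 addr0.
rewrite !mulr1n rmorphM /= cpi rmorphXz ?unitfE ?oppr_eq0 ?oner_neq0 //= rmorphN1; ring.
Qed.

Lemma sign_expz (z : int) : (-1) ^ z = (-1) ^+ `|z|%N :> F.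
Proof.
case: z => m //; rewrite NegzE abszN /= -invr_expz -exprnP.
by rewrite invr_sign.
Qed.

Lemma lat_basisl i l : row (lshift n l) (lat_basis E n i) =
  pi ^ (- lat_exp i l) *: delta_mx 0 l.
Proof. by rewrite rowKu row_diag_mx mxE. Qed.

Lemma lat_basisr i l : row (rshift n l) (lat_basis E n i) =
  pi ^ (1 - lat_exp i l) *: delta_mx 0 l.
Proof.
rewrite rowKd linearZ /= row_diag_mx mxE scalerA.
by rewrite expfzDr ?pi_neq0 // expr1z.
Qed.

(** By [lat_exp_dual] two mirror basis vectors pair through pi to the power -1, 0, 0 or 1. The half
    trace kills the odd powers, hence the vanishing diagonal blocks. *)
Lemma lat_gramE i : lat_gram E n i = block_mx 0 (Km i) (- Km i) 0.
Proof.
have gramE a b c : incl0 c =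
    pair_tr (row a (lat_basis E n i)) (row b (lat_basis E n (n%:Z - i))) ->
    lat_gram E n i a b = c.
  move=> h; rewrite mxE; case: xgetP => [c' _ /= h'|/(_ c)//].
  by apply: incl0_inj; rewrite h h'.
have iK l m : incl0 (Km i l m) = (-1) ^+ `|lat_exp i l|%N *+ (m == rev_ord l).
  by rewrite mxE rmorphMn rmorphXn rmorphN1.
have two := two_neq0.
apply/matrixP => a b; apply: gramE; rewrite -[a]splitK -[b]splitK.
case: (split a) => l; case: (split b) => m /=.
- rewrite block_mxEul mxE rmorph0 !lat_basisl pair_basis.
  case: eqP => [->|//]; rewrite lat_exp_dual.
  have -> : - lat_exp i l + - (1 - lat_exp i l) = -1 :> int by ring.
  by rewrite exprN1 invrN1 subrr mulr0 mul0r mulr0.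
- rewrite block_mxEur iK lat_basisl lat_basisr pair_basis.
  case: eqP => [->|//]; rewrite lat_exp_dual.
  have -> : - lat_exp i l + (1 - (1 - lat_exp i l)) = 0 :> int by ring.
  by rewrite !expr0z mulr1 sign_expz abszN mulrCA -[1 + 1]/2%:R mulVf // mulr1.
- rewrite block_mxEdl mxE rmorphN /= iK lat_basisl lat_basisr pair_basis.
  case: eqP => [->|//]; last by rewrite !mulr0n oppr0.
  rewrite lat_exp_dual.
  have -> : 1 - lat_exp i l + - (1 - lat_exp i l) = 0 :> int by ring.
  rewrite !expr0z mulr1 mulrCA -[1 + 1]/2%:R mulVf // mulr1.
  by rewrite expfzDr ?oppr_eq0 ?oner_neq0 // expr1z mulN1r sign_expz abszN.
- rewrite block_mxEdr mxE rmorph0 !lat_basisr pair_basis.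
  case: eqP => [->|//]; rewrite lat_exp_dual.
  have -> : 1 - lat_exp i l + (1 - (1 - lat_exp i l)) = 1 :> int by ring.
  by rewrite expr1z subrr mulr0 mul0r mulr0.
Qed.
End LatticeMatrices.

(** * Explicit families *)

Section Coordinates.
Variables (R : comNzRingType) (n : nat) (e : R).
Implicit Types (x y : 'rV[R]_(n + n)) (p q u v : 'rV[R]_n).

(** Here and below the uniformizer pi_0 of O_F0 has become the square of e, the image of pi in R. *)
Definition Pmx : 'M[R]_(n + n) := block_mx 0 1%:M (e ^+ 2)%:M 0.
Definition Tmx (X' X : 'M[R]_n) : 'M[R]_(n + n) := block_mx X' X (e ^+ 2 *: X) X'.
Definition Gmx (K : 'M[R]_n) : 'M[R]_(n + n) := block_mx 0 K (- K) 0.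

(* Coordinates adapted to the eigenspaces of Pi: [pp] is the image under Pi + pi. *)
Definition pp x := lsubmx x + e *: rsubmx x.
Definition qq x := rsubmx x.
Definition mk p q : 'rV[R]_(n + n) := row_mx (p - e *: q) q.

Lemma pp_mk p q : pp (mk p q) = p.
Proof. by rewrite /pp /mk row_mxKl row_mxKr subrK. Qed.
Lemma qq_mk p q : qq (mk p q) = q.
Proof. by rewrite /qq /mk row_mxKr. Qed.
Lemma mkK x : mk (pp x) (qq x) = x.
Proof. by rewrite /mk /pp addrK hsubmxK. Qed.

Lemma ppD x y : pp (x + y) = pp x + pp y.
Proof. by rewrite /pp !linearD /= addrACA. Qed.
Lemma ppZ a x : pp (a *: x) = a *: pp x.
Proof. by rewrite /pp !linearZ /= scalerDr !scalerA mulrC. Qed.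
Lemma qqD x y : qq (x + y) = qq x + qq y. Proof. exact: linearD. Qed.
Lemma qqZ a x : qq (a *: x) = a *: qq x. Proof. exact: linearZ. Qed.

Lemma Pmx_row x : x *m Pmx = row_mx (e ^+ 2 *: rsubmx x) (lsubmx x).
Proof.
by rewrite -[in LHS](hsubmxK x) mul_row_block !mulmx0 mulmx1 addr0 add0r mul_mx_scalar.
Qed.

Lemma qq_Pmx x : qq (x *m Pmx) = pp x - e *: qq x.
Proof. by rewrite Pmx_row /qq /pp row_mxKr addrK. Qed.

Lemma Tmx_row X' X x : x *m Tmx X' X =
  row_mx (lsubmx x *m X' + e ^+ 2 *: (rsubmx x *m X)) (lsubmx x *m X + rsubmx x *m X').
Proof. by rewrite -[in LHS](hsubmxK x) mul_row_block -scalemxAr. Qed.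

Lemma pp_Tmx X' X x : pp (x *m Tmx X' X) = pp x *m X' + e *: (pp x *m X).
Proof.
rewrite Tmx_row /pp row_mxKl row_mxKr !mulmxDl !scalerDr -!scalemxAl !scalerA -expr2.
by rewrite [X in _ + X = _]addrC addrACA [X in _ + X = _]addrC.
Qed.
Lemma qq_Tmx X' X x : qq (x *m Tmx X' X) = pp x *m X + qq x *m X' - e *: (qq x *m X).
Proof.
rewrite Tmx_row /qq /pp row_mxKr mulmxDl -scalemxAl.
by rewrite [in RHS]addrAC addrK.
Qed.

Definition bil (K : 'M[R]_n) p q : R := (p *m K *m q^T) 0 0.

Lemma Gmx_pair K x y :
  (x *m Gmx K *m y^T) 0 0 = bil K (pp x) (qq y) - bil K (qq x) (pp y).
Proof.
rewrite -[in LHS](hsubmxK x) -[in LHS](hsubmxK y) mul_row_block tr_row_mx mul_row_col.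
rewrite !mulmx0 addr0 add0r mulmxN mulNmx /bil /pp /qq.
rewrite !mulmxDl linearD /= mulmxDr linearZ /= -!scalemxAl -scalemxAr !mxE; ring.
Qed.

Lemma Gmx_inv K : K *m K^T = 1%:M -> exists G', G' *m Gmx K = 1%:M.
Proof.
move=> KK; exists (block_mx 0 (- K^T) K^T 0); rewrite /Gmx mulmx_block.
rewrite !mul0mx !mulmx0 !addr0 !add0r mulNmx mulmxN opprK.
by rewrite (mulmx1C KK) -scalar_mx_block.
Qed.

Lemma bilDl K p p' q : bil K (p + p') q = bil K p q + bil K p' q.
Proof. by rewrite /bil !mulmxDl mxE. Qed.
Lemma bilDr K p q q' : bil K p (q + q') = bil K p q + bil K p q'.
Proof. by rewrite /bil linearD /= mulmxDr mxE. Qed.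
Lemma bilZl K a p q : bil K (a *: p) q = a * bil K p q.
Proof. by rewrite /bil -!scalemxAl mxE. Qed.
Lemma bilZr K a p q : bil K p (a *: q) = a * bil K p q.
Proof. by rewrite /bil linearZ /= -scalemxAr mxE. Qed.
Lemma bilNl K p q : bil K (- p) q = - bil K p q.
Proof. by rewrite -scaleN1r bilZl mulN1r. Qed.
Lemma bilNr K p q : bil K p (- q) = - bil K p q.
Proof. by rewrite -scaleN1r bilZr mulN1r. Qed.
Lemma bil_tr K p q : bil K^T p q = bil K q p.
Proof.
have -> : bil K^T p q = (q *m K *m p^T)^T 0 0 by rewrite !trmx_mul trmxK mulmxA.
by rewrite mxE.
Qed.

(** One formula for both modules: y is K w^T for F_k, and for F_-k the roles of v and w are
    exchanged with y = K^T v^T. Scaling (a, b) by a unit changes nothing. *)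
Definition kset v (y : 'cV[R]_n) a b : set 'rV[R]_(n + n) :=
  [set x | exists c, pp x = (b * c) *: v /\ (qq x *m y) 0 0 = a * c].

Lemma kset_submodule v (y : 'cV_n) a b : is_submodule (kset v y a b).
Proof.
split.
  by exists 0; rewrite /pp /qq !linear0 mulr0 scale0r addr0 mul0mx mxE mulr0.
move=> d x x' [c [cp cq]] [c' [cp' cq']]; exists (d * c + c').
rewrite ppD ppZ cp cp' qqD qqZ mulmxDl -scalemxAl.
split; last by rewrite mxE [X in X + _]mxE cq cq'; ring.
by rewrite scalerA -scalerDl; congr (_ *: _); ring.
Qed.

(* Such a [U] is stable under [Pmx], which acts on it as [c *m z - e] with
   [z *m c = 2 e]. *)
Definition good_frame (U : set 'rV[R]_(n + n)) :=
  exists (B : 'M[R]_(n, n + n)) C (c : 'cV_n) (z : 'rV_n),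
    [/\ B *m C = 1%:M, U = rowsp B, B *m Pmx = (c *m z - e%:M) *m B
      & z *m c = (2%:R * e)%:M].

Lemma good_frame_framed U : good_frame U -> framed n U.
Proof. by move=> [B [C [c [z [? ? _ _]]]]]; exists B, C. Qed.

Lemma good_frame_stable U x : good_frame U -> U x -> U (x *m Pmx).
Proof.
move=> [B [C [c [z [_ -> BP _]]]]] [u ->].
by exists (u *m (c *m z - e%:M)); rewrite -!mulmxA BP.
Qed.

Lemma good_frame_charpoly U : (0 < n)%N -> good_frame U ->
  charpoly_on U Pmx (('X + e%:P) ^+ n.-1 * ('X - e%:P)).
Proof.
move=> n0 [B [C [c [z [BC -> BP zc]]]]].
by rewrite -(charpoly_rank1 n0 zc); exact: (charpoly_framed BC).
Qed.

Lemma scalar11 (a : R) (M : 'M[R]_1) : M 0 0 = a -> M = a%:M.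
Proof. by move=> <-; exact: mx11_scalar. Qed.

(** For a = 1 the scalar c is read off from [qq x], so the module is the graph of a linear map in
    [qq x]. *)
Lemma kset_rowspA v (y : 'cV[R]_n) b :
  kset v y 1 b = rowsp (row_mx (y *m (b *: v) - e%:M) 1%:M).
Proof.
set M := _ - _; have ppu u : pp (u *m row_mx M 1%:M) = (b * (u *m y) 0 0) *: v.
  rewrite mul_mx_row mulmx1 /pp row_mxKl row_mxKr mulmxBr mul_mx_scalar subrK.
  by rewrite mulmxA [in LHS](mx11_scalar (u *m y)) mul_scalar_mx scalerA mulrC.
have qqu u : qq (u *m row_mx M 1%:M) = u by rewrite mul_mx_row mulmx1 /qq row_mxKr.
apply/seteqP; split=> [x [c [pc qc]]|_ [u ->]]; last first.
  by exists ((u *m y) 0 0); rewrite ppu qqu mul1r.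
exists (qq x); rewrite -[LHS]mkK -[RHS]mkK ppu qqu pc qc; congr mk.
by rewrite mul1r.
Qed.

Lemma row_mx1_inv (M : 'M[R]_n) : row_mx M 1%:M *m col_mx 0 1%:M = 1%:M :> 'M_n.
Proof. by rewrite mul_row_col mulmx0 add0r mulmx1. Qed.

Lemma kset_framedA v (y : 'cV[R]_n) b : framed n (kset v y 1 b).
Proof.
rewrite kset_rowspA; exists (row_mx (y *m (b *: v) - e%:M) 1%:M), (col_mx 0 1%:M).
by split; first exact: row_mx1_inv.
Qed.

Lemma kset_frameA v (y : 'cV[R]_n) b : b * (v *m y) 0 0 = 2%:R * e ->
  good_frame (kset v y 1 b).
Proof.
move=> vy; rewrite kset_rowspA; set M := _ - _.
exists (row_mx M 1%:M), (col_mx 0 1%:M), y, (b *: v); rewrite -/M.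
have zc : (b *: v) *m y = (2%:R * e)%:M.
  by apply: scalar11; rewrite -scalemxAl mxE.
(* On a graph of M, stability under [Pmx] amounts to this identity, a consequence of (b v) y = 2
   e. *)
have MM : M *m M = (e ^+ 2)%:M.
  rewrite /M mulmxBl !mulmxBr mul_mx_scalar mul_scalar_mx -[y *m _ *m _]mulmxA.
  rewrite [(b *: v) *m (y *m _)]mulmxA zc mul_scalar_mx -scalemxAr.
  rewrite -scalar_mxM -expr2 opprB addrA mulr_natl mulr2n scalerDl.
  by rewrite addrK addrAC subrr add0r.
split=> //; first exact: row_mx1_inv.
by rewrite /Pmx mul_row_block !mulmx0 mulmx1 mul1mx add0r addr0 mul_mx_row mulmx1 MM.
Qed.

(** For b = 1 the scalar c is a genuine coordinate. Since y_l is a unit, the l-th entry of [qq x] is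
    determined by c and the other entries, and the frame stores c in that slot. *)
Lemma kset_frameB v (y : 'cV[R]_n) a (l l' : 'I_n) (y' v' : R) :
    (v *m y) 0 0 = 2%:R * e * a -> y' * y l 0 = 1 -> v' * v 0 l' = 1 ->
  good_frame (kset v y a 1).
Proof.
move=> vy y'y v'v.
pose d : 'cV[R]_n := delta_mx l 0; pose dt : 'rV[R]_n := delta_mx 0 l.
(* [u *m Q] replaces slot l of u, which holds c, by the entry for which the product with y equals a
   c. *)
pose Q : 'M[R]_n := 1%:M + y' *: ((a *: d - y) *m dt).
(* Frame coordinates of the vector with first coordinate 2 e v and second coordinate v, on which
   [Pmx] acts as e. *)
pose z : 'rV[R]_n := v + (2%:R * e - v 0 l) *: dt.
have dd : dt *m d = 1%:M by rewrite mul_delta_mx; apply/matrixP => i j; rewrite !ord1 !mxE.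
have ud (u : 'rV[R]_n) : u *m d = (u 0 l)%:M.
  by apply: scalar11; rewrite -colE mxE.
have dy : dt *m y = (y l 0)%:M by apply: scalar11; rewrite -rowE mxE.
have uQ (u : 'rV[R]_n) : u *m Q = u + (y' * (a * u 0 l - (u *m y) 0 0)) *: dt.
  rewrite /Q mulmxDr mulmx1 -scalemxAr mulmxA mulmxBr -scalemxAr ud.
  by rewrite [in LHS](mx11_scalar (u *m y)) scale_scalar_mx -raddfB /= mul_scalar_mx scalerA.
have uQ' (u q : 'rV[R]_n) : a * u 0 l - (q *m y) 0 0 = 0 ->
    u = q + (u 0 l - q 0 l) *: dt -> u *m Q = q.
  move=> h1 h2; rewrite uQ.
  have -> : (u *m y) 0 0 = (q *m y) 0 0 + (u 0 l - q 0 l) * y l 0.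
    by rewrite {1}h2 mulmxDl -scalemxAl dy !mxE mulr1n.
  rewrite opprD addrA h1 add0r mulrN mulrCA y'y mulr1 {1}h2.
  by rewrite -addrA -scalerDl addrN scale0r addr0.
have dtl : dt 0 l = 1 by rewrite mxE !eqxx.
have zl : z 0 l = 2%:R * e by rewrite !mxE !eqxx mulr1 addrC subrK.
have zQ : z *m Q = v.
  by apply: uQ'; rewrite zl //; rewrite vy; ring.
pose B := row_mx (d *m v - e *: Q) Q.
(* [C1] recovers c from c v through the unit entry l' of v, and [C2] keeps the entries of [qq x]
   other than the l-th. *)
pose C1 : 'M[R]_n := v' *: delta_mx l' l; pose C2 : 'M[R]_n := 1%:M - d *m dt.
have ppu u : pp (u *m B) = u 0 l *: v.
  rewrite mul_mx_row /pp row_mxKl row_mxKr mulmxBr -scalemxAr subrK.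
  by rewrite mulmxA ud mul_scalar_mx.
have qqu u : qq (u *m B) = u *m Q by rewrite mul_mx_row /qq row_mxKr.
exists B, (col_mx C1 (e *: C1 + C2)), d, z; split.
- rewrite mul_row_col mulmxBl mulmxDr -[(e *: Q) *m C1]scalemxAl.
  rewrite -[Q *m (e *: C1)]scalemxAr addrA subrK.
  have -> : d *m v *m C1 = d *m dt.
    rewrite -mulmxA; congr (_ *m _); rewrite /C1 -scalemxAr.
    apply/rowP => j; rewrite !mxE (bigD1 l') //= big1 ?addr0 => [|i il].
      by rewrite !mxE eqxx /= mulrA v'v mul1r.
    by rewrite !mxE (negPf il) mulr0.
  rewrite /C2 mulmxBr mulmx1 mulmxA.
  have -> : Q *m d = d + y' *: (a *: d - y).
    by rewrite /Q mulmxDl mul1mx -scalemxAl -mulmxA dd mulmx1.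
  rewrite mulmxDl -scalemxAl /Q addrC opprD addrA addrAC addrK.
  by rewrite subrK.
- apply/seteqP; split=> [x [c [pc qc]]|_ [u ->]].
    pose u := qq x + (c - qq x 0 l) *: dt.
    have ul : u 0 l = c by rewrite !mxE !eqxx mulr1 addrC subrK.
    exists u; rewrite -[LHS]mkK -[RHS]mkK ppu qqu pc ul mul1r; congr mk.
    by rewrite (uQ' _ (qq x)) ?ul // qc subrr.
  exists (u 0 l); rewrite ppu qqu mul1r; split=> //.
  rewrite uQ mulmxDl -scalemxAl dy !mxE mulr1n mulrAC y'y mul1r.
  by rewrite addrC subrK.
- rewrite /Pmx mul_row_block !mulmx0 mulmx1 add0r addr0 mul_mx_scalar.
  have zB : z *m B = row_mx (e *: v) v.
    by rewrite -[LHS]mkK ppu qqu zl zQ /mk mulrDl mul1r scalerDl addrK.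
  rewrite mulmxBl -mulmxA zB mul_mx_row -scalemxAr mul_scalar_mx scale_row_mx.
  rewrite opp_row_mx add_row_mx scalerBr scalerA opprB addrCA subrr addr0.
  by rewrite -expr2.
- by rewrite ud zl.
Qed.
End Coordinates.

(* mu and nu project onto the coordinates on which the pairing K between Lambda_k
   and Lambda_-k is symmetric, respectively alternating. *)
Record form_axioms (R : comNzRingType) n (K mu nu : 'M[R]_n) : Prop := FormAxioms {
  fa_half : exists h : R, h * 2%:R = 1;
  fa_mumu : mu *m mu = mu;
  fa_munu : mu *m nu = 0;
  fa_numu : nu *m mu = 0;
  fa_D : mu + nu = 1%:M;
  fa_mut : mu^T = mu;
  fa_nut : nu^T = nu;
  fa_Kmu : K *m mu = mu *m K;
  fa_Tmu : K^T *m mu = mu *m K;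
  fa_Tnu : K^T *m nu = - (nu *m K);
  fa_KK : K *m K^T = 1%:M;
  fa_K : forall (w : 'rV_n) i, exists l (r : R), r * r = 1 /\ (K *m w^T) l 0 = r * w 0 i;
  fa_KT : forall (w : 'rV_n) i, exists l (r : R), r * r = 1 /\ (K^T *m w^T) l 0 = r * w 0 i }.

(** * The pair of modules attached to (z, s, t, a, b) *)

Section Datum.
Variables (R : comNzRingType) (n : nat) (e : R) (K mu nu : 'M[R]_n).
Hypothesis FA : form_axioms K mu nu.

Lemma fa_nunu : nu *m nu = nu.
Proof.
have : nu *m (mu + nu) = nu by rewrite (fa_D FA) mulmx1.
by rewrite mulmxDr (fa_numu FA) add0r.
Qed.

Lemma fa_Knu : K *m nu = nu *m K.
Proof.
have -> : nu = 1%:M - mu by rewrite -(fa_D FA) addrAC subrr add0r.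
by rewrite mulmxBr mulmxBl mulmx1 mul1mx (fa_Kmu FA).
Qed.

Lemma bil_mu x y : bil K (x *m mu) y = bil K x (y *m mu).
Proof.
rewrite /bil trmx_mul (fa_mut FA) -[x *m mu *m K]mulmxA -(fa_Kmu FA).
by rewrite !mulmxA.
Qed.
Lemma bil_nu x y : bil K (x *m nu) y = bil K x (y *m nu).
Proof. by rewrite /bil trmx_mul (fa_nut FA) -[x *m nu *m K]mulmxA -fa_Knu !mulmxA. Qed.

Lemma bil_symmu x y : bil K x (y *m mu) = bil K (y *m mu) x.
Proof.
rewrite -[RHS]bil_tr /bil trmx_mul (fa_mut FA) !mulmxA.
by rewrite -[x *m K *m mu]mulmxA -[x *m K^T *m mu]mulmxA (fa_Kmu FA) (fa_Tmu FA).
Qed.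
Lemma bil_symnu x y : bil K x (y *m nu) = - bil K (y *m nu) x.
Proof.
rewrite -[bil K _ x]bil_tr /bil trmx_mul (fa_nut FA) !mulmxA.
rewrite -[x *m K *m nu]mulmxA -[x *m K^T *m nu]mulmxA fa_Knu (fa_Tnu FA).
by rewrite mulmxN mulNmx [in RHS]mxE opprK.
Qed.
Lemma bil_alt x : bil K (x *m nu) (x *m nu) = 0.
Proof.
have [h h2] := fa_half FA.
have e1 := bil_symnu (x *m nu) x; set B := bil _ _ _ in e1 *.
by rewrite -[B]mul1r -h2 -mulrA mulr_natl mulr2n {1}e1 addNr mulr0.
Qed.

Variables (z : 'rV[R]_n) (s t : R).
Hypothesis st : s * t = e.
Let mz := z *m mu.
Let nz := z *m nu.
(* Generators of the lines F^0_k and F^0_-k. *)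
Definition vvec := t *: (z *m nu) + z *m mu.
Definition wvec := z *m nu + s *: (z *m mu).
Local Notation v := vvec.
Local Notation w := wvec.
Definition quad := bil K (z *m mu) (z *m mu).

Lemma vmu : v *m mu = mz.
Proof. by rewrite mulmxDl -scalemxAl -!mulmxA (fa_numu FA) (fa_mumu FA) mulmx0 scaler0 add0r. Qed.
Lemma vnu : v *m nu = t *: nz.
Proof. by rewrite mulmxDl -scalemxAl -!mulmxA (fa_munu FA) fa_nunu mulmx0 addr0. Qed.
Lemma wmu : w *m mu = s *: mz.
Proof. by rewrite mulmxDl -scalemxAl -!mulmxA (fa_numu FA) (fa_mumu FA) mulmx0 add0r. Qed.
Lemma wnu : w *m nu = nz.
Proof. by rewrite mulmxDl -scalemxAl -!mulmxA (fa_munu FA) fa_nunu mulmx0 scaler0 addr0. Qed.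

Lemma v_to_w : v *m nu + e *: (v *m mu) = t *: w.
Proof. by rewrite vmu vnu -st /wvec scalerDr scalerA [t * s]mulrC. Qed.
Lemma w_to_v : w *m mu + e *: (w *m nu) = s *: v.
Proof. by rewrite wmu wnu -st /vvec scalerDr scalerA addrC. Qed.

Lemma bil_split x y : bil K x y = bil K (x *m mu) (y *m mu) + bil K (x *m nu) (y *m nu).
Proof.
rewrite -{1}[x]mulmx1 -(fa_D FA) mulmxDr bilDl bil_mu bil_nu; congr (_ + _).
  by rewrite bil_mu -mulmxA (fa_mumu FA).
by rewrite bil_nu -mulmxA fa_nunu.
Qed.

(** The outer block contributes t times the value of an alternating form on (nz, nz), hence
    nothing. *)
Lemma bil_vw : bil K v w = s * quad.
Proof.
rewrite bil_split vmu wmu vnu wnu bilZr bilZl bil_alt mulr0 addr0 //.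
Qed.

Variables a b : R.
Hypothesis tab : 2%:R * t * a = b * quad.
Definition Up := kset e v (K *m w^T) a b.
Definition Um := kset e w (K^T *m v^T) a b.

Lemma UpP x : Up x <-> exists c, pp e x = (b * c) *: v /\ bil K (qq x) w = a * c.
Proof.
split=> -[c [pc qc]]; exists c; split=> //; first by rewrite -qc mulmxA.
by rewrite mulmxA.
Qed.
Lemma UmP x : Um x <-> exists c, pp e x = (b * c) *: w /\ bil K v (qq x) = a * c.
Proof.
split=> -[c [pc qc]]; exists c; split=> //; first by rewrite -qc -bil_tr mulmxA.
by rewrite -qc -bil_tr mulmxA.
Qed.

(** The scalar c of x becomes t c. In the second coordinate the pairing with v is b c q - t a c and
    has to equal a t c: this is the origin of 2 t a = b q. *)
Lemma Up_to_Um x : Up x -> Um (x *m Tmx e nu mu).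
Proof.
move=> /UpP[c [pc qc]]; apply/UmP; exists (t * c).
have e1 : bil K v (pp e x *m mu) = b * c * quad.
  rewrite pc -scalemxAl bilZr; congr (_ * _).
  have -> : v *m mu = v *m mu *m mu by rewrite -mulmxA (fa_mumu FA).
  by rewrite -bil_mu vmu.
rewrite pp_Tmx qq_Tmx; split.
  rewrite pc -!scalemxAl [e *: _]scalerA [e * _]mulrC -[(b * c * e) *: _]scalerA.
  by rewrite -scalerDr v_to_w scalerA; congr (_ *: _); ring.
rewrite !bilDr bilNr bilZr e1 bil_symnu bil_symmu bil_nu bil_mu.
have e2 : bil K (qq x) (v *m nu) + e * bil K (qq x) (v *m mu) = t * (a * c).
  by rewrite -bilZr -bilDr v_to_w bilZr qc.
have -> : b * c * quad - bil K (qq x) (v *m nu) - e * bil K (qq x) (v *m mu) =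
   c * (b * quad) - (bil K (qq x) (v *m nu) + e * bil K (qq x) (v *m mu)) by ring.
by rewrite e2 -tab; ring.
Qed.

(** The scalar c becomes s c; the term that was q in the other direction is now a value of the
    alternating form of the outer block, which is zero. *)
Lemma Um_to_Up x : Um x -> Up (x *m Tmx e mu nu).
Proof.
move=> /UmP[c [pc qc]]; apply/UpP; exists (s * c).
have e1 : bil K (pp e x *m nu) w = 0.
  have wn : w *m nu = w *m nu *m nu by rewrite -mulmxA fa_nunu.
  by rewrite pc -scalemxAl bilZl wn bil_nu bil_alt mulr0.
rewrite pp_Tmx qq_Tmx; split.
  rewrite pc -!scalemxAl [e *: _]scalerA [e * _]mulrC -[(b * c * e) *: _]scalerA.
  by rewrite -scalerDr w_to_v scalerA; congr (_ *: _); ring.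
rewrite !bilDl bilNl bilZl e1 add0r.
have e2 : bil K (w *m mu) (qq x) + e * bil K (w *m nu) (qq x) = s * (a * c).
  by rewrite -bilZl -bilDl w_to_v bilZl qc.
have <- := bil_symmu w (qq x); rewrite -bil_mu.
have /(congr1 -%R) := bil_symnu w (qq x); rewrite opprK => <-; rewrite -bil_nu.
by rewrite mulrN opprK e2; ring.
Qed.

Lemma Up_Um_orth x y : Up x -> Um y -> (x *m Gmx K *m y^T) 0 0 = 0.
Proof.
move=> /UpP[c [pc qc]] /UmP[c' [pc' qc']].
by rewrite (Gmx_pair e) pc pc' bilZl bilZr qc qc'; ring.
Qed.

(** The two affine charts of the point (a : b). For a = 1 both modules are graphs; for b = 1 unit
    entries of w and v are what [kset_frameB] needs in order to produce frames. *)
Definition chart :=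
  a = 1 \/ b = 1 /\ exists i j y' v', y' * w 0 i = 1 /\ v' * v 0 j = 1.

(** With a = 1 or b = 1 this is the hypothesis of [kset_frameA] or [kset_frameB], and there it
    yields the trace condition z c = 2 e. *)
Lemma bil_vw_ab : b * bil K v w = 2%:R * e * a.
Proof.
rewrite bil_vw mulrCA -tab -st; ring.
Qed.

Lemma Up_frame : chart -> good_frame e Up.
Proof.
have vw := bil_vw_ab; rewrite /Up; case=> [a1|[b1 [i [j [y' [v' [yw vv]]]]]]].
  by rewrite a1; apply: kset_frameA; rewrite mulmxA -/(bil K v w) vw a1 mulr1.
have [l [r [rr Kr]]] := fa_K FA w i.
rewrite b1; apply: (@kset_frameB _ _ _ _ _ _ l j (y' * r) v') => //.
  by rewrite mulmxA -/(bil K v w) -vw b1 mul1r.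
by rewrite Kr mulrA -[y' * r * r]mulrA rr mulr1.
Qed.

Lemma Um_frame : chart -> good_frame e Um.
Proof.
have vw := bil_vw_ab; rewrite /Um; case=> [a1|[b1 [i [j [y' [v' [yw vv]]]]]]].
  by rewrite a1; apply: kset_frameA; rewrite mulmxA -/(bil K^T w v) bil_tr vw a1 mulr1.
have [l [r [rr Kr]]] := fa_KT FA v j.
rewrite b1; apply: (@kset_frameB _ _ _ _ _ _ l i (v' * r) y') => //.
  by rewrite mulmxA -/(bil K^T w v) bil_tr -vw b1 mul1r.
by rewrite Kr mulrA -[v' * r * r]mulrA rr mulr1.
Qed.

(** The situation of k = 0, where the two indices are congruent modulo n and the two formulas must
    define the same module. *)
Lemma Up_eq_Um : nu = 0 -> chart -> Up = Um.
Proof.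
move=> nu0 ch; have mu1 : mu = 1%:M by rewrite -(fa_D FA) nu0 addr0.
have bs x y : bil K x y = bil K y x.
  by have := bil_symmu x y; rewrite mu1 !mulmx1.
have vz : v = z by rewrite /vvec nu0 mu1 mulmx0 mulmx1 scaler0 add0r.
have wz : w = s *: z by rewrite /wvec nu0 mu1 mulmx0 mulmx1 add0r.
apply: (framed_eq (good_frame_framed (Up_frame ch)) (good_frame_framed (Um_frame ch))).
move=> x /UpP[c [pc]]; rewrite wz bilZr bs => qc; apply/UmP.
rewrite pc vz wz; case: ch => [a1|[b1 [i [j [y' [v' [yw vv]]]]]]].
  exists (bil K z (qq x)); rewrite a1 mul1r scalerA; split=> //.
  by congr (_ *: _); move: qc; rewrite a1 mul1r => <-; ring.
(* As w = s z has a unit entry, s is a unit, so c can be divided by it. *)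
have ss : (y' * z 0 i) * s = 1 by rewrite -yw wz mxE; ring.
exists (y' * z 0 i * c); rewrite scalerA; split.
  by congr (_ *: _); rewrite -[c in LHS]mulr1 -ss; ring.
rewrite -[bil _ _ _]mul1r -ss -mulrA qc; ring.
Qed.
End Datum.

Lemma kset_map (R S : comNzRingType) (g : {rmorphism R -> S}) n e (v : 'rV_n) (y : 'cV_n) a b x :
  kset e v y a b x -> kset (g e) (map_mx g v) (map_mx g y) (g a) (g b) (map_mx g x).
Proof.
move=> [c [pc qc]]; exists (g c); split.
  have -> : pp (g e) (map_mx g x) = map_mx g (pp e x).
    by rewrite /pp map_mxD map_mxZ map_lsubmx map_rsubmx.
  by rewrite pc map_mxZ rmorphM.
have -> : qq (map_mx g x) = map_mx g (qq x) by rewrite /qq map_rsubmx.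
by rewrite -map_mxM mxE qc rmorphM.
Qed.

Lemma odd_abszD (b : int) (c : bool) : odd (absz (b + (nat_of_bool c)%:Z)) = odd (absz b) (+) c.
Proof.
case: c; last by rewrite addr0 addbF.
rewrite addbT; case: b => m.
  by have -> : absz (Posz m + true%:Z) = m.+1 by lia.
have -> : absz (Negz m + true%:Z) = m by lia.
by rewrite /= negbK.
Qed.

Lemma rev_ordE n (l m : 'I_n) : (m == rev_ord l) = (m + l.+1 == n)%N.
Proof. by rewrite -val_eqE /=; have := ltn_ord l; have := ltn_ord m; lia. Qed.

(** * The signed antidiagonal form and its middle block *)

Section ConcreteForm.
Variables (R : comNzRingType) (n k : nat).
Hypothesis hk : (2 * k < n)%N.

(* The coordinates on which Lambda_k and Lambda_(n - k) differ. *)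
Definition midb (l : 'I_n) : bool := (k <= l)%N && (l < n - k)%N.
Definition dgb (chi : 'I_n -> bool) : 'M[R]_n := diag_mx (\row_l (chi l)%:R).
(** The block [Km] at an index k + b n with the common sign (-1) ^ b removed. *)
Definition Kc : 'M[R]_n := \matrix_(l, m) ((-1) ^+ (l < k)%N *+ (m == rev_ord l)).
Definition muc := dgb midb.
Definition nuc := dgb (negb \o midb).

Lemma dgb_mulE chi m (M : 'M[R]_(n, m)) i j : (dgb chi *m M) i j = (chi i)%:R * M i j.
Proof. by rewrite mul_diag_mx !mxE. Qed.
Lemma mul_dgbE chi m (M : 'M[R]_(m, n)) i j : (M *m dgb chi) i j = M i j * (chi j)%:R.
Proof. by rewrite mul_mx_diag !mxE. Qed.
Lemma dgbE chi i j : dgb chi i j = (chi i)%:R *+ (i == j).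
Proof. by rewrite !mxE. Qed.
Lemma dgbM chi chi' : dgb chi *m dgb chi' = dgb (fun l => chi l && chi' l).
Proof.
apply/matrixP => i j; rewrite dgb_mulE !dgbE.
by case: (chi i); rewrite ?mul1r // mul0r /= mul0rn.
Qed.
Lemma dgb0 chi : (forall l, chi l = false) -> dgb chi = 0.
Proof. by move=> h; apply/matrixP => i j; rewrite dgbE h mul0rn mxE. Qed.
Lemma dgb1 chi : (forall l, chi l = true) -> dgb chi = 1%:M.
Proof. by move=> h; apply/matrixP => i j; rewrite dgbE h mxE. Qed.
Lemma dgb_ext chi chi' : chi =1 chi' -> dgb chi = dgb chi'.
Proof. by move=> h; apply/matrixP => i j; rewrite !dgbE h. Qed.
Lemma dgb_tr chi : (dgb chi)^T = dgb chi. Proof. exact: tr_diag_mx. Qed.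

Lemma KcE l m : Kc l m = (-1) ^+ (l < k)%N *+ (m == rev_ord l).
Proof. by rewrite mxE. Qed.

Lemma Kc_row (w : 'rV[R]_n) l : (Kc *m w^T) l 0 = (-1) ^+ (l < k)%N * w 0 (rev_ord l).
Proof.
rewrite mxE (bigD1 (rev_ord l)) //= big1 ?addr0 ?KcE ?eqxx ?mxE // => m ml.
by rewrite KcE (negPf ml) mul0r.
Qed.

Lemma KcT_row (w : 'rV[R]_n) l :
  (Kc^T *m w^T) l 0 = (-1) ^+ (rev_ord l < k)%N * w 0 (rev_ord l).
Proof.
rewrite mxE (bigD1 (rev_ord l)) //= big1 ?addr0.
  by rewrite [Kc^T _ _]mxE KcE rev_ordK eqxx mxE.
move=> m ml; rewrite [Kc^T _ _]mxE KcE.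
by rewrite -[l]rev_ordK (inj_eq rev_ord_inj) eq_sym (negPf ml) mul0r.
Qed.

(** Reversal of indices preserves the middle block, where all signs are + and the form is symmetric.
    Outside it exactly one of l and its mirror image is below k, so the signs are opposite and the
    form is alternating. *)
Lemma Kc_axioms : (exists h : R, h * 2%:R = 1) -> form_axioms Kc muc nuc.
Proof.
move=> h; split=> //; rewrite ?dgb_tr ?dgbM //.
- by apply: dgb_ext => l; rewrite andbb.
- by apply: dgb0 => l; rewrite /= andbN.
- by apply: dgb0 => l; rewrite /= andNb.
- apply/matrixP => i j; rewrite mxE !dgbE mxE /=.
  by case: (midb i); rewrite /= mul0rn ?addr0 ?add0r.
- apply/matrixP => l m; rewrite dgb_mulE mul_dgbE KcE rev_ordE /midb.
  have := ltn_ord l; have := ltn_ord m; case: eqP => [e lm ll|]; last by rewrite mulr0n mulr0 mul0r.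
  have -> : (k <= m < n - k)%N = (k <= l < n - k)%N by lia.
  by rewrite mulrC.
- apply/matrixP => l m; rewrite dgb_mulE mul_dgbE mxE !KcE !rev_ordE /midb.
  have := ltn_ord l; have := ltn_ord m.
  rewrite [(l + _ == _)%N](_ : _ = (m + l.+1 == n)%N); last by lia.
  case: eqP => [e lm ll|]; last by rewrite !mulr0n mulr0 mul0r.
  have -> : (k <= m < n - k)%N = (k <= l < n - k)%N by lia.
  case: (boolP (_ && _)) => h1; last by rewrite mulr0 mul0r.
  by rewrite mulrC; congr (_ * (_ ^+ _ *+ _)); lia.
- apply/matrixP => l m; rewrite [in RHS]mxE dgb_mulE mul_dgbE mxE !KcE !rev_ordE /midb /=.
  have := ltn_ord l; have := ltn_ord m.
  rewrite [(l + _ == _)%N](_ : _ = (m + l.+1 == n)%N); last by lia.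
  case: eqP => [e lm ll|]; last by rewrite !mulr0n mulr0 mul0r oppr0.
  have -> : (k <= m < n - k)%N = (k <= l < n - k)%N by lia.
  case: (boolP (_ && _)) => h1; first by rewrite mulr0 mul0r oppr0.
  rewrite mulr1 mul1r; have -> : (m < k)%N = ~~ (l < k)%N by lia.
  by case: (l < k)%N; rewrite /= ?expr1 ?expr0 ?opprK.
- apply/matrixP => l m; rewrite mxE (bigD1 (rev_ord l)) //= big1 ?addr0; last first.
    by move=> j jl; rewrite KcE (negPf jl) mul0r.
  rewrite [Kc^T _ _]mxE [RHS]mxE !KcE eqxx (inj_eq rev_ord_inj).
  by case: eqP => [->|_]; rewrite ?mulr0 // -signr_addb addbb.
- move=> w i; exists (rev_ord i), ((-1) ^+ (rev_ord i < k)%N).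
  by rewrite Kc_row rev_ordK -signr_addb addbb.
- move=> w i; exists (rev_ord i), ((-1) ^+ (i < k)%N).
  by rewrite KcT_row rev_ordK -signr_addb addbb.
Qed.
End ConcreteForm.

(** * The explicit families as points of the naive local model *)

Section Families.
Variables (E : ramified_quadratic) (n k : nat).
Hypotheses (hn : (0 < n)%N) (hk : (2 * k < n)%N).
Local Notation OF := (OF E).
Local Notation OF0 := (OF0 E).

Definition cplus (i : int) := exists b : int, i = k%:Z + b * n%:Z.
Definition cminus (i : int) := exists b : int, i = (n - k)%N%:Z + b * n%:Z.

Lemma cplusP i : (n%:Z %| i - k%:Z)%Z <-> cplus i.
Proof.
split=> [/dvdzP[b e]|[b ->]]; first by exists b; rewrite -e; ring.
by apply/dvdzP; exists b; ring.
Qed.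

Lemma class_cases (i : class_idx n k) : cplus (val i) \/ cminus (val i).
Proof.
case: i => i /= /orP[/cplusP|/dvdzP[b e]]; first by left.
right; exists (b - 1); rewrite -subzn; last by lia.
by rewrite mulrBl mul1r -e; ring.
Qed.

Lemma lat_exp_plus b (l : 'I_n) : lat_exp (k%:Z + b * n%:Z) l = b + (l < k)%N%:Z :> int.
Proof. by apply: lat_expE; lia. Qed.

Lemma lat_exp_minus b (l : 'I_n) :
  lat_exp ((n - k)%N%:Z + b * n%:Z) l = b + (l < n - k)%N%:Z :> int.
Proof.
(* For k = 0 the residue of n - k is 0 and the quotient grows by 1; the formula survives because l <
   n always holds. *)
have [k0|kp] := posnP k; last by apply: lat_expE; lia.
rewrite k0 subn0 (_ : n%:Z + _ = 0%N%:Z + (b + 1) * n%:Z); last by ring.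
by rewrite lat_expE // ltn_ord ltn0 addr0.
Qed.

Variable R : comAlgType OF.
Local Notation e := (pi_R R).
Local Notation K := (Kc R n k).
Local Notation mu := (muc R n k).
Local Notation nu := (nuc R n k).
Local Notation sm := (@struct_map E R).

Lemma half_R : exists h : R, h * 2%:R = 1.
Proof.
have [h e2] := half_OF E; exists h%:A.
by rewrite -(rmorph_nat (@GRing.in_alg OF R)) /= -scalerAl mul1r scalerA e2 scale1r.
Qed.

Lemma Kc_form : form_axioms K mu nu.
Proof. exact: (Kc_axioms hk half_R). Qed.

Lemma map_Pim : map_mx sm (Pim E n) = Pmx n e.
Proof.
by rewrite map_block_mx !map_mx0 map_mx1 map_scalar_mx /= struct_map_pi0.
Qed.

Lemma map_Dg (chi : 'I_n -> bool) : map_mx sm (Dg E chi) = dgb R chi.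
Proof.
apply/matrixP => i j; rewrite [LHS]mxE dgbE !mxE rmorphMn /=.
by case: (chi i); rewrite ?rmorph1 ?rmorph0.
Qed.

Lemma map_PT D (chi : 'I_n -> bool) :
  map_mx sm (PT E D chi) = iter D (mulmx (Pmx n e)) (Tmx e (dgb R (negb \o chi)) (dgb R chi)).
Proof.
elim: D => [|D IH].
  by rewrite /PT /= map_block_mx map_mxZ !map_Dg /= struct_map_pi0.
by rewrite /PT !iterS map_mxM map_Pim IH.
Qed.

Lemma Pi_mx (i : int) (x : lat_space n R) : Pi i x = x *m Pmx n e.
Proof. by rewrite /Pi /lat_tensor /lat_tensor_mx lat_mx_pi map_Pim. Qed.

Lemma period_id (i j : int) (x : lat_space n R) : j = i - n%:Z ->
  lat_tensor i j (@scale_pi E n) x = x.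
Proof. by move=> ->; rewrite /lat_tensor /lat_tensor_mx lat_mx_period map_mx1 mulmx1. Qed.

Lemma map_gram_plus i : cplus i -> exists2 r : R, r * r = 1 &
  map_mx sm (lat_gram E n i) = r *: Gmx K.
Proof.
move=> [b ->]; exists ((-1) ^+ odd `|b|%N); first by rewrite -signr_addb addbb.
rewrite lat_gramE map_block_mx !map_mx0 map_mxN /Gmx scale_block_mx !scaler0 scalerN.
suff -> : map_mx sm (Km E n (k%:Z + b * n%:Z)) = (-1) ^+ odd `|b|%N *: K by [].
apply/matrixP => l m; rewrite 2!mxE [RHS]mxE KcE rmorphMn rmorphXn rmorphN1 mulrnAr.
by rewrite lat_exp_plus -[in LHS]signr_odd odd_abszD signr_addb.
Qed.

Lemma map_gram_minus i : cminus i -> exists2 r : R, r * r = 1 &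
  map_mx sm (lat_gram E n i) = r *: (Gmx K)^T.
Proof.
move=> [b ->]; exists ((-1) ^+ odd `|b|%N); first by rewrite -signr_addb addbb.
rewrite lat_gramE map_block_mx !map_mx0 map_mxN /Gmx tr_block_mx !trmx0 scale_block_mx !scaler0.
suff -> : map_mx sm (Km E n ((n - k)%N%:Z + b * n%:Z)) = (-1) ^+ odd `|b|%N *: (- K)^T.
  by rewrite !linearN /= opprK.
apply/matrixP => l m; rewrite 2!mxE ![in RHS]mxE rmorphMn rmorphXn rmorphN1.
have -> : (l == rev_ord m) = (m == rev_ord l).
  by rewrite !rev_ordE; lia.
rewrite -mulNrn mulrnAr; case: eqP => [->|//]; rewrite !mulr1n.
rewrite lat_exp_minus -[in LHS]signr_odd odd_abszD signr_addb; congr (_ * _).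
have -> : (rev_ord l < k)%N = ~~ (l < n - k)%N by have := ltn_ord l; rewrite /=; lia.
by case: (l < n - k)%N; rewrite /= ?expr1 ?opprK.
Qed.
End Families.

Lemma stable_iter (R : comNzRingType) m (P T : 'M[R]_m) (U V : set 'rV[R]_m) D :
    (forall x, U x -> U (x *m P)) -> (forall x, U x -> V (x *m T)) ->
  forall x, U x -> V (x *m iter D (mulmx P) T).
Proof.
move=> hP hT; elim: D => [|D IH] x Ux; first exact: hT.
by rewrite iterS mulmxA; apply: IH; apply: hP.
Qed.

Section DatumFamily.
Variables (E : ramified_quadratic) (n k : nat).
Hypotheses (hn : (0 < n)%N) (hk : (2 * k < n)%N).
Local Notation OF := (OF E).
Variable R : comAlgType OF.
Local Notation e := (pi_R R).
Local Notation K := (Kc R n k).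
Local Notation mu := (muc R n k).
Local Notation nu := (nuc R n k).

Definition datum (z : 'rV[R]_n) s t a b :=
  [/\ s * t = e, 2%:R * t * a = b * quad K mu z & chart mu nu z s t a b].

(** For k = 0 every index satisfies both congruences and the test selects [Up]; [Up_eq_Um] removes
    the asymmetry. *)
Definition fam (z : 'rV[R]_n) s t a b : class_idx n k -> set (lat_space n R) :=
  fun i => if (n%:Z %| val i - k%:Z)%Z then Up e K mu nu z s t a b
           else Um e K mu nu z s t a b.

Lemma class_trans (i j : class_idx n k) D chi (U V : set (lat_space n R)) :
    (forall l : 'I_n, lat_exp (val j) l =
       lat_exp (val i) l + D%:Z + (nat_of_bool (chi l))%:Z :> int) ->
    (forall x, U x -> U (x *m Pmx n e)) ->
    (forall x, U x -> V (x *m Tmx e (dgb R (negb \o chi)) (dgb R chi))) ->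
  forall x, U x -> V (lat_tensor (val i) (val j) id x).
Proof.
move=> h hP hT x Ux; rewrite /lat_tensor /lat_tensor_mx (lat_mx_PT E h) map_PT.
exact: (stable_iter D hP hT Ux).
Qed.

Lemma mulz_lt (b b' c : int) : b * n%:Z < b' * n%:Z + c -> c <= n%:Z -> b <= b'.
Proof.
move=> h cn; rewrite leNgt; apply/negP => h'.
have : (b' + 1) * n%:Z <= b * n%:Z by apply: ler_wpM2r; lia.
by rewrite mulrDl mul1r; lia.
Qed.

Lemma Tmx_id (x : lat_space n R) :
  x *m Tmx e (dgb R (negb \o fun=> false)) (dgb R (fun=> false)) = x.
Proof.
rewrite (@dgb0 R n (fun=> false)) // (@dgb1 R n (negb \o _)) //.
by rewrite /Tmx scaler0 -scalar_mx_block mulmx1.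
Qed.

Section FamTheory.
Variables (z : 'rV[R]_n) (s t a b : R).
Hypothesis D : datum z s t a b.
Local Notation U := (Up e K mu nu z s t a b).
Local Notation V := (Um e K mu nu z s t a b).
Local Notation F := (fam z s t a b).
Let faK : form_axioms K mu nu := Kc_form hk R.

Lemma U_frame : good_frame e U.
Proof. case: D => st tab ch; exact: (Up_frame faK st tab ch). Qed.
Lemma V_frame : good_frame e V.
Proof. by case: D => st tab ch; exact: (Um_frame faK st tab ch). Qed.

Lemma fam_plus i : cplus n k (val i) -> F i = U.
Proof. by move=> /cplusP h; rewrite /fam h. Qed.

Lemma fam_minus i : cminus n k (val i) -> F i = V.
Proof.
move=> [c ci]; rewrite /fam; case: ifP => // /dvdzP[d id].
(* Being congruent to both k and -k forces n to divide 2 k < n, hence k = 0. *)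
have : (n%:Z %| (2 * k)%N%:Z)%Z.
  by apply/dvdzP; exists (c - d + 1); move: id; rewrite ci -subzn; lia.
rewrite /dvdz /= => /dvdn_leq; case: (posnP k) => [k0|k0]; last by lia.
move=> _; case: D => st tab ch; apply: (Up_eq_Um faK st tab _ ch).
by apply: dgb0 => l; rewrite /midb /= k0 subn0 ltn_ord.
Qed.

Lemma fam_frame i : good_frame e (F i).
Proof. by rewrite /fam; case: ifP => _; [exact: U_frame|exact: V_frame]. Qed.

Lemma U_to_V x : U x -> V (x *m Tmx e nu mu).
Proof. by case: D => st tab ch; exact: (Up_to_Um faK st tab). Qed.
Lemma V_to_U x : V x -> U (x *m Tmx e mu nu).
Proof. by case: D => st tab ch; exact: (Um_to_Up faK st). Qed.

Lemma fam_LM2 : LM2 F.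
Proof.
have sU x := @good_frame_stable _ _ _ _ x U_frame.
have sV x := @good_frame_stable _ _ _ _ x V_frame.
move=> i j ij.
have [[c ci]|[c ci]] := class_cases hn hk i; have [[d dj]|[d dj]] := class_cases hn hk j.
- rewrite fam_plus ?fam_plus; [|by exists d|by exists c].
  have cd : c <= d by apply: (@mulz_lt _ _ 0); lia.
  apply: (@class_trans _ _ (absz (d - c)) (fun=> false)) => // [l|x]; last by rewrite Tmx_id.
  rewrite ci dj !lat_exp_plus //; lia.
- rewrite fam_plus ?fam_minus; [|by exists d|by exists c].
  have cd : c <= d by apply: (@mulz_lt _ _ (n%:Z - (2 * k)%N%:Z)); lia.
  apply: (@class_trans _ _ (absz (d - c)) (@midb n k)) => // [l|x Ux]; last exact: U_to_V.
  rewrite ci dj (lat_exp_plus hn hk) (lat_exp_minus hn hk) /midb; lia.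
- rewrite fam_minus ?fam_plus; [|by exists d|by exists c].
  (* The exponent grows by d - c outside the middle block and by d - c - 1 on it: hence D = d - c -
     1 and the complementary mask. *)
  have cd : c + 1 <= d by apply: (@mulz_lt _ _ (2 * k)%N%:Z); lia.
  apply: (@class_trans _ _ (absz (d - c - 1)%R) (negb \o @midb n k)) => // [l|x Ux]; last first.
    rewrite (_ : dgb R (negb \o (negb \o _)) = mu); first exact: V_to_U.
    by apply: dgb_ext => l /=; rewrite negbK.
  rewrite ci dj (lat_exp_plus hn hk) (lat_exp_minus hn hk) /midb /=; lia.
- rewrite fam_minus ?fam_minus; [|by exists d|by exists c].
  have cd : c <= d by apply: (@mulz_lt _ _ 0); lia.
  apply: (@class_trans _ _ (absz (d - c)) (fun=> false)) => // [l|x]; last by rewrite Tmx_id.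
  rewrite ci dj !lat_exp_minus //; lia.
Qed.

Lemma class_period (i j : class_idx n k) : val j = val i - n%:Z ->
  (cplus n k (val i) -> cplus n k (val j)) /\ (cminus n k (val i) -> cminus n k (val j)).
Proof. by move=> ->; split=> -[c ->]; exists (c - 1); ring. Qed.

Lemma class_dual (i j : class_idx n k) : val j = n%:Z - val i ->
  (cplus n k (val i) -> cminus n k (val j)) /\ (cminus n k (val i) -> cplus n k (val j)).
Proof.
have sub : (n - k)%N%:Z = n%:Z - k%:Z by lia.
by move=> ->; split=> -[c ->]; exists (- c); rewrite sub; ring.
Qed.

Lemma image_id (T : Type) (f : T -> T) (A : set T) : (forall x, f x = x) -> f @` A = A.
Proof.
move=> h; apply/seteqP; split=> [_ [x Ax <-]|x Ax]; first by rewrite h.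
by exists x.
Qed.

Lemma fam_LM3 : LM3 F.
Proof.
move=> i j ij; rewrite image_id => [|x]; last exact: period_id.
have [hp hm] := class_period ij.
have [h|h] := class_cases hn hk i; first by rewrite (fam_plus h) (fam_plus (hp h)).
by rewrite (fam_minus h) (fam_minus (hm h)).
Qed.

Lemma fam_LM4 : LM4 F.
Proof.
move=> i j ij; have [hp hm] := class_dual ij.
have [G' GG'] : exists G', G' *m Gmx K = 1%:M by apply: Gmx_inv; exact: (fa_KK faK).
have fU := good_frame_framed U_frame; have fV := good_frame_framed V_frame.
have [h|h] := class_cases hn hk i.
  have [r rr rE] := map_gram_plus hn hk R h.
  rewrite (fam_plus h) (fam_minus (hp h)).
  rewrite /pair_tensor rE; apply: (framed_perp (G' := r *: G')) => //.
    by rewrite -scalemxAl -scalemxAr scalerA rr scale1r.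
  move=> x y Ux Vy; rewrite -scalemxAr -scalemxAl mxE (Up_Um_orth Ux Vy).
  exact: mulr0.
have [r rr rE] := map_gram_minus hn hk R h.
rewrite (fam_minus h) (fam_plus (hm h)).
rewrite /pair_tensor rE; apply: (framed_perp (G' := r *: G'^T)) => //.
  rewrite -scalemxAl -scalemxAr scalerA rr scale1r -trmx_mul.
  by rewrite (mulmx1C GG') trmx1.
move=> x y Ux Vy; rewrite -scalemxAr -scalemxAl mxE.
have -> : x *m (Gmx K)^T *m y^T = (y *m Gmx K *m x^T)^T by rewrite !trmx_mul trmxK mulmxA.
by rewrite mxE (Up_Um_orth Vy Ux) mulr0.
Qed.

Lemma fam_naive : M_naive F.
Proof.
split; last first.
- move=> i; rewrite /lat_tensor_mx lat_mx_pi map_Pim; apply: good_frame_charpoly => //.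
  exact: fam_frame.
- exact: fam_LM4.
- exact: fam_LM3.
- exact: fam_LM2.
move=> i; have fi := fam_frame i; have ff := good_frame_framed fi; split.
- exact: framed_summand ff.
- exact: framed_rank.
- by move=> y Fy; rewrite Pi_mx; apply: good_frame_stable.
Qed.
End FamTheory.
End DatumFamily.

(** * Kraemer points over local rings *)

Section BaseChangeConditions.
Variables (R S : comNzRingType) (g : {rmorphism R -> S}) (m : nat).

Lemma base_change_submodule (U : set 'rV[R]_m) : is_submodule (base_change g U : set 'rV[S]_m).
Proof.
split=> [W Ws _|a x y Ux Uy W Ws UW]; first by case: Ws.
by case: (Ws) => _; apply; [exact: Ux|exact: Uy].
Qed.

Lemma mem_base_change (U : set 'rV[R]_m) x : U x -> base_change g U (map_mx g x).
Proof. by move=> Ux W _; apply; exists x. Qed.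

Lemma base_change_mul (U V : set 'rV[R]_m) (T : 'M_m) : (forall x, U x -> V (x *m T)) ->
  forall x, base_change g U x -> base_change g V (x *m map_mx g T).
Proof.
move=> h; have [V0 Vl] := base_change_submodule V.
apply: (@base_change_min _ _ g _ U [set x | base_change g V (x *m map_mx g T)]).
  split=> /= [|a x y Vx Vy]; first by rewrite mul0mx.
  by rewrite mulmxDl -scalemxAl; apply: Vl.
by move=> x /h /mem_base_change; rewrite map_mxM.
Qed.

Lemma base_change_mul0 (U : set 'rV[R]_m) (T : 'M_m) : (forall x, U x -> x *m T = 0) ->
  forall x, base_change g U x -> x *m map_mx g T = 0.
Proof.
move=> h; apply: (@base_change_min _ _ g _ U [set x | x *m map_mx g T = 0]).
  split=> /= [|a x y Vx Vy]; first by rewrite mul0mx.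
  by rewrite mulmxDl -scalemxAl Vx Vy scaler0 addr0.
by move=> x /h /= e; rewrite -map_mxM e map_mx0.
Qed.

(** The orthogonal of the row span of an idempotent P is the row span of an explicit P' built from
    P, G and its inverse, and such a formula commutes with base change. *)
Lemma base_change_perp (U V : set 'rV[R]_m) (G G' : 'M_m) :
    is_direct_summand U -> is_direct_summand V -> G' *m G = 1%:M ->
    [set z : 'rV[R]_m | forall y, U y -> (y *m G *m z^T) 0 0 = 0] = V ->
  [set z : 'rV[S]_m | forall y, base_change g U y -> (y *m map_mx g G *m z^T) 0 0 = 0] =
    base_change g V.
Proof.
move=> /projector_exists[P PU] /projector_exists[Q QV] GG' UV.
have GG := mulmx1C GG'.
have PGQ : P *m G *m Q^T = 0.
  apply: bilin_rows0 => x y; rewrite -(projector_rowsp PU) -(projector_rowsp QV).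
  by move=> Ux; rewrite -UV => /(_ x Ux).
pose P' := 1%:M - (G' *m P *m G)^T.
have PQ : P' *m Q = P'.
  apply: (projectorM QV) => _ [u ->]; rewrite -UV /= (projector_rowsp PU).
  apply/perp_rowsp; rewrite -mulmxA -[RHS](mulmx0 _ u); congr (_ *m _).
  apply: trmx_inj; rewrite trmx_mul trmxK trmx0 /P' raddfB /= trmxK trmx1.
  rewrite mulmxBr mulmx1 !mulmxA -[P *m G *m G']mulmxA GG mulmx1.
  by rewrite (projector_idem PU) subrr.
rewrite (projector_rowsp PU) (projector_rowsp QV) !base_change_rowsp.
apply/seteqP; split=> z /=.
  move=> /perp_rowsp; rewrite -map_mxM => zP.
  exists (z *m map_mx g P'); rewrite -mulmxA -map_mxM PQ.
  have -> : P' = 1%:M - (P *m G)^T *m G'^T by rewrite /P' -trmx_mul mulmxA.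
  rewrite map_mxB map_mx1 mulmxBr mulmx1 map_mxM mulmxA -map_trmx zP.
  by rewrite mul0mx subr0.
move=> [u ->]; apply/perp_rowsp; rewrite -mulmxA -[RHS](mulmx0 _ u); congr (_ *m _).
by apply: trmx_inj; rewrite trmx_mul trmxK trmx0 -map_mxM map_trmx -map_mxM PGQ map_mx0.
Qed.
End BaseChangeConditions.

Section KraBaseChange.
Variables (E : ramified_quadratic) (n k : nat).
Hypotheses (hn : (0 < n)%N) (hk : (2 * k < n)%N).
Local Notation OF := (OF E).
Variables (R S : comAlgType OF) (g : {lrmorphism R -> S}).
Implicit Types (F : class_idx n k -> set (lat_space n R)).

Lemma lrmorph_struct (a : OF0 E) : g (struct_map R a) = struct_map S a.
Proof. by rewrite /struct_map linearZ rmorph1. Qed.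

Lemma lrmorph_pi : g (pi_R R) = pi_R S.
Proof. by rewrite /pi_R linearZ rmorph1. Qed.

Lemma map_lat_tensor i j f : map_mx g (lat_tensor_mx R i j f) = lat_tensor_mx S i j f :> 'M_(n + n).
Proof. by apply/matrixP => a b; rewrite !mxE lrmorph_struct. Qed.

Lemma gram_inv (i : class_idx n k) (T : comAlgType OF) : exists G',
  G' *m map_mx (struct_map T) (lat_gram E n (val i)) = 1%:M.
Proof.
have [G' GG'] : exists G', G' *m Gmx (Kc T n k) = 1%:M.
  by apply: Gmx_inv; exact: (fa_KK (Kc_form hk T)).
have [h|h] := class_cases hn hk i.
  have [r rr ->] := map_gram_plus hn hk T h; exists (r *: G').
  by rewrite -scalemxAl -scalemxAr scalerA rr scale1r.
have [r rr ->] := map_gram_minus hn hk T h; exists (r *: G'^T).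
by rewrite -scalemxAl -scalemxAr scalerA rr scale1r -trmx_mul (mulmx1C GG') trmx1.
Qed.

Lemma bc_summand_rank F r : OF_summand_of_rank F r -> OF_summand_of_rank (bc_family g F) r.
Proof.
move=> h i; have [Fs Fr FP] := h i; split.
- exact: bc_summand.
- exact: bc_rank.
move=> y; rewrite Pi_mx => Fy.
have := base_change_mul (g := g) (U := F i) (V := F i) (T := Pmx n (pi_R R)) _ Fy.
rewrite map_block_mx !map_mx0 map_mx1 map_scalar_mx rmorphXn /= lrmorph_pi.
by apply=> x Fx; rewrite -(Pi_mx (val i)); exact: FP.
Qed.

Lemma bc_transition F : transition_stable F -> transition_stable (bc_family g F).
Proof.
move=> h i j ij y Fy; rewrite /lat_tensor -map_lat_tensor.
by apply: (base_change_mul _ Fy) => x; exact: h.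
Qed.

Lemma periodicP (T : comAlgType OF) (F : class_idx n k -> set (lat_space n T)) :
  periodic F <-> forall i j : class_idx n k, val j = val i - n%:Z -> F i = F j.
Proof.
by split=> h i j ij; move: (h i j ij); rewrite image_id // => x; exact: period_id.
Qed.

Lemma bc_periodic F : periodic F -> periodic (bc_family g F).
Proof.
by move=> /periodicP h; apply/periodicP => i j /h e; rewrite /bc_family e.
Qed.

Lemma bc_LM4 F : LM1 F -> LM4 F -> LM4 (bc_family g F).
Proof.
move=> h1 h4 i j ij; have [G' GG'] := gram_inv i R.
have [si _ _] := h1 i; have [sj _ _] := h1 j.
have := base_change_perp g si sj GG' (h4 i j ij); rewrite /bc_family => <-.
rewrite /pair_tensor (_ : map_mx g _ = map_mx (struct_map S) (lat_gram E n (val i))) //.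
by apply/matrixP => a b; rewrite [LHS]mxE [X in g X]mxE [RHS]mxE lrmorph_struct.
Qed.

Lemma Kra_base_change F0 F : M_Kra (F0, F) -> M_Kra (bc_family g F0, bc_family g F).
Proof.
case=> -[h1 h2 h3 h4] [h5 h6 h7 h8] h9 h10; split.
- by split; [exact: bc_summand_rank|exact: bc_transition|exact: bc_periodic|exact: bc_LM4].
- split; [|exact: bc_summand_rank|exact: bc_transition|exact: bc_periodic].
  move=> i; apply: base_change_min; first exact: base_change_submodule.
  by move=> x /h5; exact: mem_base_change.
- move=> i y Fy.
  have := base_change_mul (g := g) (U := F i) (V := F0 i) (T := Pmx n (pi_R R) + (pi_R R)%:M) _ Fy.
  rewrite map_mxD map_block_mx !map_mx0 map_mx1 !map_scalar_mx rmorphXn /= lrmorph_pi.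
  rewrite mulmxDr mul_mx_scalar -(Pi_mx (val i)); apply=> x Fx.
  by rewrite mulmxDr mul_mx_scalar -(Pi_mx (val i)); exact: h9.
move=> i y Fy.
have := base_change_mul0 (g := g) (U := F0 i) (T := Pmx n (pi_R R) - (pi_R R)%:M) _ Fy.
rewrite map_mxB map_block_mx !map_mx0 map_mx1 !map_scalar_mx rmorphXn /= lrmorph_pi.
rewrite mulmxBr mul_mx_scalar -(Pi_mx (val i)); apply=> x Fx.
by rewrite mulmxBr mul_mx_scalar -(Pi_mx (val i)); exact: h10.
Qed.
End KraBaseChange.

(** * Normal form of the module F_k over a local ring *)

Section LocalCore.
Variables (L : comNzRingType) (kk : fieldType) (rho : {rmorphism L -> kk}).
Hypothesis loc : is_local rho.

Lemma local_unimodular n (v : 'rV[L]_n) c : v *m c = 1%:M ->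
  exists j v', v' * v 0 j = 1.
Proof.
move=> vc; apply: contrapT => nv.
have v0 j : rho (v 0 j) = 0.
  apply/eqP; apply: contrapT => /negP/(proj2 loc)[v' v'v].
  by apply: nv; exists j, v'.
have : rho ((v *m c) 0 0) = 0.
  by rewrite mxE rmorph_sum big1 // => j _; rewrite rmorphM v0 mul0r.
by rewrite vc mxE rmorph1 => /eqP; rewrite oner_eq0.
Qed.

Variables (n : nat) (e : L) (K mu nu : 'M[L]_n).
Hypothesis FA : form_axioms K mu nu.
Variables (Fp Fm : set 'rV[L]_(n + n)) (v w : 'rV[L]_n) (cv cw : 'cV[L]_n).
Hypotheses (Fp_framed : framed n Fp) (vcv : v *m cv = 1%:M) (wcw : w *m cw = 1%:M).
Hypotheses (Fp_v : Fp (mk e ((2%:R * e) *: v) v))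
  (Fp_pp : forall x, Fp x -> exists c, pp e x = c *: v)
  (Fm_pp : forall y, Fm y -> exists c, pp e y = c *: w)
  (orth : forall x y, Fp x -> Fm y -> (x *m Gmx K *m y^T) 0 0 = 0)
  (perp : forall x, (forall y, Fm y -> (x *m Gmx K *m y^T) 0 0 = 0) -> Fp x)
  (trans : forall x, Fp x -> Fm (x *m Tmx e nu mu)).
Variables (s t : L).
Hypotheses (v_w : v *m nu + e *: (v *m mu) = t *: w)
  (w_v : w *m mu + e *: (w *m nu) = s *: v).

(** The middle part of v and the outer part of w; the relations [v_w] and [w_v] give the remaining
    parts as t and s times these. *)
Let z : 'rV[L]_n := v *m mu + w *m nu.

Let scale_inj (u : 'rV[L]_n) c a b : u *m c = 1%:M -> a *: u = b *: u -> a = b.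
Proof.
move=> uc /(congr1 (fun x => (x *m c) 0 0)).
by rewrite -!scalemxAl uc !mxE !mulr1.
Qed.

Let nunu := fa_nunu FA.
Let vnu : v *m nu = t *: (w *m nu).
Proof.
rewrite scalemxAl -v_w mulmxDl -scalemxAl -!mulmxA nunu (fa_munu FA) mulmx0.
by rewrite scaler0 addr0.
Qed.
Let vmu : e *: (v *m mu) = t *: (w *m mu).
Proof.
rewrite [t *: _]scalemxAl -v_w mulmxDl -scalemxAl -!mulmxA (fa_mumu FA) (fa_numu FA) mulmx0.
by rewrite add0r.
Qed.
Let wmu : w *m mu = s *: (v *m mu).
Proof.
rewrite scalemxAl -w_v mulmxDl -scalemxAl -!mulmxA (fa_mumu FA) (fa_numu FA) mulmx0.
by rewrite scaler0 addr0.
Qed.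
Let wnu : e *: (w *m nu) = s *: (v *m nu).
Proof.
rewrite [s *: _]scalemxAl -w_v mulmxDl -scalemxAl -!mulmxA nunu (fa_munu FA) mulmx0.
by rewrite add0r.
Qed.
Let split_id (u : 'rV[L]_n) : u *m mu + u *m nu = u.
Proof. by rewrite -mulmxDr (fa_D FA) mulmx1. Qed.

(** The two transition maps compose to Pi, which acts as pi on the line of v, and v is
    unimodular. *)
Lemma core_st : s * t = e.
Proof.
apply: (scale_inj vcv); rewrite -[v in LHS]split_id -[v in RHS]split_id !scalerDr.
congr (_ + _); first by rewrite vmu wmu scalerA mulrC.
by rewrite mulrC -scalerA -wnu !scalerA vnu scalerA mulrC.
Qed.
Let zmu : z *m mu = v *m mu.
Proof. by rewrite mulmxDl -!mulmxA (fa_mumu FA) (fa_numu FA) mulmx0 addr0. Qed.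
Let znu : z *m nu = w *m nu.
Proof. by rewrite mulmxDl -!mulmxA nunu (fa_munu FA) mulmx0 add0r. Qed.
Let vE : vvec mu nu z t = v.
Proof. by rewrite /vvec zmu znu -vnu addrC split_id. Qed.
Let wE : wvec mu nu z s = w.
Proof. by rewrite /wvec zmu znu -wmu addrC split_id. Qed.
Let q := quad K mu z.

Let vw : bil K v w = s * q.
Proof. by rewrite -{1}vE -{1}wE (bil_vw FA). Qed.

Let Fp_sub : is_submodule Fp.
Proof. by have [B [C [_ ->]]] := Fp_framed; exact: rowsp_submodule. Qed.
Let FpD x y : Fp x -> Fp y -> Fp (x + y).
Proof. by move=> Fx Fy; rewrite -[x]scale1r; apply: (proj2 Fp_sub). Qed.
Let FpZ a x : Fp x -> Fp (a *: x).
Proof. by move=> Fx; rewrite -[_ *: _]addr0; apply: (proj2 Fp_sub) => //; case: Fp_sub. Qed.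
(** First coordinates of F_-k are multiples of w, so such a vector is orthogonal to F_-k, and
    duality puts it in F_k. *)
Let Fp0 x : bil K x w = 0 -> Fp (mk e 0 x).
Proof.
move=> xw; apply: perp => y /Fm_pp[c yc].
by rewrite (Gmx_pair e) pp_mk qq_mk yc bilZr xw mulr0 subr0 /bil !mul0mx mxE.
Qed.

Let mkD (p p' u u' : 'rV[L]_n) : mk e (p + p') (u + u') = mk e p u + mk e p' u'.
Proof. by rewrite -[RHS](mkK e) ppD qqD !pp_mk !qq_mk. Qed.
Let mkZ a (p u : 'rV[L]_n) : mk e (a *: p) (a *: u) = a *: mk e p u.
Proof. by rewrite -[RHS](mkK e) ppZ qqZ !pp_mk !qq_mk. Qed.

Let eps : 'rV[L]_n := cw^T *m K^T.
Let eps_w : bil K eps w = 1.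
Proof.
rewrite /bil -[eps *m K]mulmxA (mulmx1C (fa_KK FA)) mulmx1 -trmx_mul wcw trmx1.
by rewrite mxE.
Qed.

(** Modulo the vectors of [Fp0] an element of F_k is a pair of scalars: the coefficient of v in [pp]
    and the pairing of [qq] with w. *)
Let red x : Fp x -> exists c, pp e x = c *: v /\ Fp (mk e (c *: v) (bil K (qq x) w *: eps)).
Proof.
move=> Fx; have [c xc] := Fp_pp Fx; exists c; split=> //.
have -> : mk e (c *: v) (bil K (qq x) w *: eps) =
    x + mk e 0 (bil K (qq x) w *: eps - qq x).
  by rewrite -{2}[x](mkK e) -mkD addr0 xc addrC subrK.
apply: FpD => //; apply: Fp0.
by rewrite bilDl bilNl bilZl eps_w mulr1 subrr.
Qed.

Let kset_Fp a b : Fp (mk e (b *: v) (a *: eps)) ->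
  kset e v (K *m w^T) a b `<=` Fp.
Proof.
move=> Fx0 x [c [pc]]; rewrite mulmxA -/(bil K _ w) => qc.
have -> : x = c *: mk e (b *: v) (a *: eps) + mk e 0 (qq x - (c * a) *: eps).
  rewrite -mkZ -mkD addr0 !scalerA [c * b]mulrC -pc addrC subrK.
  by rewrite mkK.
apply: FpD; first exact: FpZ.
by apply: Fp0; rewrite bilDl bilNl bilZl eps_w qc mulr1 mulrC subrr.
Qed.

(** An element of F_k is orthogonal to its own image in F_-k. Both coordinates of that image involve
    b or a, which leaves a spurious factor b in the relation. *)
Let relation a b : Fp (mk e (b *: v) (a *: eps)) -> b * (2%:R * t * a) = b * (b * q).
Proof.
move=> Fx; have := orth Fx (trans Fx).
rewrite (Gmx_pair e) pp_Tmx qq_Tmx !pp_mk !qq_mk.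
rewrite -!scalemxAl [e *: (b *: _)]scalerA [e * b]mulrC -[(b * e) *: _]scalerA -scalerDr v_w.
rewrite !(bilZl, bilZr) !(bilDr, bilNr, bilZr) eps_w.
rewrite (bil_symnu FA v eps) (bil_symmu FA v eps) (bil_nu FA) (bil_mu FA).
have h : bil K eps (v *m nu) + e * bil K eps (v *m mu) = t.
  by rewrite -bilZr -bilDr v_w bilZr eps_w mulr1.
have -> : bil K v (v *m mu) = q.
  have -> : v *m mu = v *m mu *m mu by rewrite -mulmxA (fa_mumu FA).
  by rewrite -(bil_mu FA) -zmu.
move=> h'; apply/eqP; rewrite -subr_eq0 -oppr_eq0 -h'; apply/eqP; rewrite -h; ring.
Qed.

(** Some pair (b, a) arising from F_k has a unit coordinate, which is scaled to 1. The corresponding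
    [kset] is then contained in F_k, and equality follows as both are free of rank n. *)
Lemma core : exists z s t a b,
  [/\ s * t = e, 2%:R * t * a = b * quad K mu z, chart mu nu z s t a b
    & Fp = Up e K mu nu z s t a b].
Proof.
have [[b Fx]|nA] := pselect (exists b, Fp (mk e (b *: v) (1 *: eps))).
  have Fk : kset e v (K *m w^T) 1 b = Fp.
    by apply: (framed_eq (kset_framedA _ _ _ _) Fp_framed); exact: kset_Fp.
  (* The generator of the line lies in F_k with scalar c = [bil K v w]; comparing first coordinates
     gives this, and s t' = e below rests on it. *)
  have be : b * bil K v w = 2%:R * e.
    have := Fp_v; rewrite -Fk => -[c []]; rewrite pp_mk qq_mk => h1 h2.
    by rewrite (scale_inj vcv h1) -[c]mul1r -h2 mulmxA.
  have rel := relation Fx.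
  have [h h2] := fa_half FA.
  (* The compatibility only gives b (2 t - b q) = 0, so that 2 t = b q may fail
     (the Kraemer model is not flat); but Fp depends on t only through b t. *)
  pose t' := h * b * q.
  have bt : b * t' = b * t.
    have : h * (b * (2%:R * t * 1)) = h * (b * (b * q)) by rewrite rel.
    have -> : h * (b * (2%:R * t * 1)) = (h * 2%:R) * (b * t) by ring.
    by rewrite h2 mul1r => ->; rewrite /t'; ring.
  have st' : s * t' = e.
    have -> : s * t' = h * (b * (s * q)) by rewrite /t'; ring.
    by rewrite -vw be mulrA h2 mul1r.
  have t'q : 2%:R * t' * 1 = b * q.
    have -> : 2%:R * t' * 1 = (h * 2%:R) * (b * q) by rewrite /t'; ring.
    by rewrite h2 mul1r.
  exists z, s, t', 1, b; split=> //; first by left.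
  rewrite -Fk /Up wE; have bv : b *: vvec mu nu z t' = b *: v.
    by rewrite -vE /vvec !scalerDr !scalerA bt.
  by apply/seteqP; split=> x [c [pc qc]]; exists c; split=> //;
    rewrite pc [b * c]mulrC -!scalerA bv.
have [[a Fx]|nB] := pselect (exists a, Fp (mk e (1 *: v) (a *: eps))).
  have taq : 2%:R * t * a = 1 * q by have := relation Fx; rewrite !mul1r.
  have ch : chart mu nu z s t a 1.
    right; split=> //; rewrite vE wE.
    have [i [y' yw]] := local_unimodular wcw; have [j [v' vv]] := local_unimodular vcv.
    by exists i, j, y', v'.
  exists z, s, t, a, 1; split=> //; first exact: core_st.
  have fU := good_frame_framed (Up_frame FA core_st taq ch).
  apply/esym; apply: (framed_eq fU Fp_framed).
  by rewrite /Up vE wE; exact: kset_Fp.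
(* Otherwise Fp reduces to a space of dimension less than n. *)
exfalso; have nu1 x c : Fp x -> pp e x = c *: v -> rho c = 0 /\ rho (bil K (qq x) w) = 0.
  move=> Fx xc; have [c' [xc' Fx']] := red Fx.
  have cc : c = c' by apply: (scale_inj vcv); rewrite -xc xc'.
  rewrite -{}cc {c' xc'} in Fx'.
  split; apply/eqP; apply: contrapT => /negP/(proj2 loc)[u uE].
    apply: nB; exists (u * bil K (qq x) w).
    by have := FpZ u Fx'; rewrite -mkZ !scalerA uE.
  apply: nA; exists (u * c).
  by have := FpZ u Fx'; rewrite -mkZ !scalerA uE.
have [B [C [BC FB]]] := Fp_framed.
have Brow i : Fp (row i B) by rewrite FB; exact: rowsp_row.
(* Under [rho] the first coordinates of F_k vanish, so the second ones span the whole space; being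
   orthogonal to w, they force w to reduce to zero, contrary to [wcw]. *)
pose B2 := rsubmx B; pose C' := dsubmx C - e *: usubmx C.
have rB : map_mx rho B2 *m map_mx rho C' = 1%:M.
  rewrite -map_mxM; have -> : B2 *m C' = 1%:M - (lsubmx B + e *: B2) *m usubmx C.
    rewrite -BC -{1}[B]hsubmxK -{1}[C]vsubmxK mul_row_col /C' mulmxBr mulmxDl.
    by rewrite -scalemxAr -scalemxAl opprD addrACA subrr add0r.
  rewrite map_mxB map_mx1 map_mxM.
  suff -> : map_mx rho (lsubmx B + e *: B2) = 0 by rewrite mul0mx subr0.
  apply/row_matrixP => i; rewrite row0 -map_row.
  have [c pc] := Fp_pp (Brow i); have [rc _] := nu1 _ _ (Brow i) pc.
  have -> : row i (lsubmx B + e *: B2) = pp e (row i B).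
    by apply/rowP => j; rewrite !mxE.
  by rewrite pc map_mxZ rc scale0r.
have rw : map_mx rho (K *m w^T) = 0.
  rewrite -[LHS]mul1mx -(mulmx1C rB) -mulmxA -map_mxM.
  suff -> : map_mx rho (B2 *m (K *m w^T)) = 0 by rewrite mulmx0.
  apply/row_matrixP => i; rewrite row0 -map_row; apply/rowP => j.
  have [c pc] := Fp_pp (Brow i); have [_ rc] := nu1 _ _ (Brow i) pc.
  rewrite [RHS]mxE [LHS]mxE row_mul mulmxA ord1.
  have -> : row i B2 = qq (row i B) by apply/rowP => l; rewrite !mxE.
  exact: rc.
have : map_mx rho w^T = 0.
  rewrite -[w^T]mul1mx -(mulmx1C (fa_KK FA)) -mulmxA map_mxM rw mulmx0 //.
rewrite -map_trmx => /(congr1 trmx); rewrite trmxK trmx0 => w0.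
have := congr1 (map_mx rho) wcw; rewrite map_mxM w0 mul0mx map_mx1.
by move=> /matrixP/(_ 0 0)/eqP; rewrite !mxE eq_sym oner_eq0.
Qed.
End LocalCore.

Section KraLocal.
Variables (E : ramified_quadratic) (n k : nat).
Hypotheses (hn : (0 < n)%N) (hk : (2 * k < n)%N).
Local Notation OF := (OF E).

Lemma in_class_plus : in_class n k k%:Z.
Proof. by rewrite /in_class subrr dvdz0. Qed.
Lemma in_class_minus : in_class n k (n - k)%N%:Z.
Proof.
rewrite /in_class (_ : (n - k)%N%:Z + k%:Z = n%:Z) ?dvdzz ?orbT //; lia.
Qed.
Definition idx_plus : class_idx n k := exist _ k%:Z in_class_plus.
Definition idx_minus : class_idx n k := exist _ (n - k)%N%:Z in_class_minus.

Lemma cplus_idx : cplus n k (val idx_plus). Proof. by exists 0 => /=; ring. Qed.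
Lemma cminus_idx : cminus n k (val idx_minus). Proof. by exists 0 => /=; ring. Qed.

Lemma in_class_shift i : in_class n k i -> in_class n k (i - n%:Z).
Proof.
rewrite /in_class => /orP[]/dvdzP[q h]; apply/orP; [left|right];
  by apply/dvdzP; exists (q - 1); rewrite mulrBl -h mul1r; ring.
Qed.

Lemma periodic_shift (T : Type) (F : class_idx n k -> T) :
    (forall i j : class_idx n k, val j = val i - n%:Z -> F i = F j) ->
  forall (i j : class_idx n k) (b : int), val j = val i + b * n%:Z -> F i = F j.
Proof.
move=> h.
have hs (m : nat) (i j : class_idx n k) : val j = val i - m%:Z * n%:Z -> F i = F j.
  elim: m i => [|m IH] i ij.
    by congr F; apply: val_inj; rewrite ij mul0r subr0.
  pose i' : class_idx n k := exist (in_class n k) (val i - n%:Z) (in_class_shift (valP i)).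
  rewrite (h i i') //; apply: IH; rewrite ij /= (_ : m.+1%:Z = m%:Z + 1); [ring|lia].
move=> i j [m|m] ij.
  by apply/esym/(hs m); rewrite ij; ring.
by apply: (hs m.+1); rewrite ij NegzE; ring.
Qed.

Variable L : comAlgType OF.
Local Notation e := (pi_R L).
Local Notation K := (Kc L n k).
Local Notation mu := (muc L n k).
Local Notation nu := (nuc L n k).

Lemma trans_pm (F : class_idx n k -> set (lat_space n L)) : transition_stable F ->
  forall x, F idx_plus x -> F idx_minus (x *m Tmx e nu mu).
Proof.
move=> h x Fx; have := h idx_plus idx_minus _ x Fx => /=; move=> /(_ ltac:(lia)).
rewrite /lat_tensor /lat_tensor_mx (@lat_mx_PT E n _ _ 0 (@midb n k)) ?map_PT // => l.
have -> : k%:Z = k%:Z + 0 * n%:Z by ring.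
have -> : (n - k)%N%:Z = (n - k)%N%:Z + 0 * n%:Z by ring.
rewrite (lat_exp_plus hn hk) (lat_exp_minus hn hk) /midb; lia.
Qed.

Lemma trans_mp (F : class_idx n k -> set (lat_space n L)) :
    transition_stable F -> periodic F ->
  forall x, F idx_minus x -> F idx_plus (x *m Tmx e mu nu).
Proof.
move=> h /periodicP hp x Fx.
(* For k = 0 the index n - k equals k + n, so periodicity takes the place of a transition map. *)
have [k0|kp] := posnP k.
  have nu0 : nu = 0 by apply: dgb0 => l; rewrite /midb /= k0 subn0 ltn_ord.
  have mu1 : mu = 1%:M by apply: dgb1 => l; rewrite /midb /= k0 subn0 ltn_ord.
  rewrite nu0 mu1 /Tmx scaler0 -scalar_mx_block mulmx1.
  by rewrite -(hp idx_minus idx_plus) //= k0 subn0; lia.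
have ic : in_class n k (k%:Z + n%:Z).
  rewrite /in_class (_ : k%:Z + n%:Z - k%:Z = n%:Z) ?dvdzz //; ring.
pose j : class_idx n k := exist (in_class n k) (k%:Z + n%:Z) ic.
rewrite -(hp j idx_plus) /=; last by ring.
have := h idx_minus j _ x Fx => /=; move=> /(_ ltac:(lia)).
rewrite /lat_tensor /lat_tensor_mx (@lat_mx_PT E n _ _ 0 (negb \o @midb n k)) ?map_PT /=.
  by rewrite (_ : dgb L (negb \o (negb \o _)) = mu) //; apply: dgb_ext => l /=; rewrite negbK.
move=> l; have -> : k%:Z + n%:Z = k%:Z + 1 * n%:Z by ring.
have -> : (n - k)%N%:Z = (n - k)%N%:Z + 0 * n%:Z by ring.
rewrite (lat_exp_plus hn hk) (lat_exp_minus hn hk) /midb /=; lia.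
Qed.

Lemma eigenvector (f : 'rV[L]_(n + n)) : f *m Pmx n e - e *: f = 0 ->
  pp e f = (2%:R * e) *: qq f.
Proof.
move=> h; have : qq (f *m Pmx n e + (- e) *: f) = 0.
  by rewrite scaleNr h /qq linear0.
rewrite qqD qqZ qq_Pmx scaleNr -addrA -opprD => /eqP; rewrite subr_eq0 => /eqP->.
by rewrite -scalerDl mulr_natl mulr2n.
Qed.

(** An eigenvector of Pi is determined by its second coordinate, so unimodularity passes from the
    generator to that half. *)
Lemma line_vector (U : set 'rV[L]_(n + n)) : framed 1 U ->
    (forall x, U x -> x *m Pmx n e - e *: x = 0) ->
  exists (v : 'rV[L]_n) (c : 'cV[L]_n), [/\ v *m c = 1%:M, U (mk e ((2%:R * e) *: v) v) &
    forall x, U x -> exists r, x = r *: mk e ((2%:R * e) *: v) v].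
Proof.
move=> [f [C [fC UE]]] h.
have Uf : U f by rewrite UE; exists 1%:M; rewrite mul1mx.
have pf := eigenvector (h f Uf).
have fE : mk e ((2%:R * e) *: qq f) (qq f) = f by rewrite -pf mkK.
exists (qq f), (e *: usubmx C + dsubmx C); rewrite fE; split=> //.
  rewrite -fC -{2}fE /mk -{3}[C]vsubmxK mul_row_col mulmxDr -scalemxAr.
  congr (_ + _); rewrite -scalerBl -scalemxAl; congr (_ *: _); ring.
move=> x; rewrite UE => -[u ->]; exists (u 0 0).
by rewrite {1}[u]mx11_scalar mul_scalar_mx.
Qed.

Lemma Kra_local (kk : fieldType) (rho : {rmorphism L -> kk})
    (F0 F : class_idx n k -> set (lat_space n L)) :
    is_local rho -> M_Kra (F0, F) ->
  exists z s t a b, datum k z s t a b /\ F = fam z s t a b.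
Proof.
move=> loc [[h1 h2 h3 h4] [h5 h6 h7 h8] h9 h10].
have FA := Kc_form hk L.
have eig i x : F0 i x -> x *m Pmx n e - e *: x = 0.
  by move=> F0x; rewrite -(Pi_mx (val i)); exact: h10 F0x.
have ln i : framed 1 (F0 i).
  by have [? ? _] := h6 i; exact: (local_framed loc).
have [v [cv [vcv F0v F0ve]]] := line_vector (ln idx_plus) (eig idx_plus).
have [w [cw [wcw F0w F0we]]] := line_vector (ln idx_minus) (eig idx_minus).
have Kpp i x : F i x -> F0 i (x *m Pmx n e + e *: x).
  by move=> Fx; rewrite -(Pi_mx (val i)); exact: h9.
have ppx (x : 'rV[L]_(n + n)) : qq (x *m Pmx n e + e *: x) = pp e x.
  by rewrite qqD qqZ qq_Pmx subrK.
have ppF i u : (forall x, F0 i x -> exists r, x = r *: mk e ((2%:R * e) *: u) u) ->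
    forall x, F i x -> exists c, pp e x = c *: u.
  move=> hu x /Kpp/hu[r rE]; exists r.
  by rewrite -ppx rE qqZ qq_mk.
have [r rr rG] := map_gram_plus hn hk L cplus_idx.
have [r' rr' rG'] := map_gram_minus hn hk L cminus_idx.
have ipm : val idx_minus = n%:Z - val idx_plus by rewrite /=; lia.
have imp : val idx_plus = n%:Z - val idx_minus by rewrite /=; lia.
have Fo x y : F idx_plus x -> F idx_minus y -> (x *m Gmx K *m y^T) 0 0 = 0.
  move=> Fx; rewrite -(h4 _ _ ipm) => /(_ x Fx).
  rewrite /pair_tensor rG -scalemxAr -scalemxAl mxE => /(congr1 ( *%R r)).
  by rewrite mulrA rr mul1r mulr0.
have Fperp x : (forall y, F idx_minus y -> (x *m Gmx K *m y^T) 0 0 = 0) -> F idx_plus x.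
  move=> hx; rewrite -(h4 _ _ imp) => y /hx xy.
  rewrite /pair_tensor rG' -scalemxAr -scalemxAl mxE.
  have -> : y *m (Gmx K)^T *m x^T = (x *m Gmx K *m y^T)^T by rewrite !trmx_mul trmxK mulmxA.
  by rewrite mxE xy mulr0.
have qT (u : 'rV[L]_n) X' X : qq (mk e ((2%:R * e) *: u) u *m Tmx e X' X) =
    u *m X' + e *: (u *m X).
  rewrite qq_Tmx pp_mk qq_mk -scalemxAl mulr_natl mulr2n scalerDl.
  by rewrite addrAC addrK addrC.
have [t vw] : exists t, v *m nu + e *: (v *m mu) = t *: w.
  have [t tE] := F0we _ (trans_pm h7 F0v); exists t.
  by rewrite -qT tE qqZ qq_mk.
have [s wv] : exists s, w *m mu + e *: (w *m nu) = s *: v.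
  have [s sE] := F0ve _ (trans_mp h7 h8 F0w); exists s.
  by rewrite -qT sE qqZ qq_mk.
have Ff : framed n (F idx_plus).
  by have [? ? _] := h1 idx_plus; exact: (local_framed loc).
have [z [s' [t' [a [b [st tab ch FU]]]]]] := core loc FA Ff vcv wcw (h5 _ _ F0v)
  (ppF _ _ F0ve) (ppF _ _ F0we) Fo Fperp (trans_pm h2) vw wv.
have D : datum k z s' t' a b by [].
exists z, s', t', a, b; split=> //.
have Fplus : F idx_plus = fam z s' t' a b idx_plus.
  by rewrite (fam_plus _ _ _ _ _ cplus_idx).
(* Only F_k was put in normal form; F_-k agrees because on both sides it is the orthogonal of
   F_k. *)
have Fminus : F idx_minus = fam z s' t' a b idx_minus.
  by rewrite -(h4 _ _ ipm) -(fam_LM4 hn hk D ipm) Fplus.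
have sF := periodic_shift ((periodicP F).1 h3).
have sf := periodic_shift ((periodicP _).1 (fam_LM3 hn hk D)).
apply/funext => i; have [[c ci]|[c ci]] := class_cases hn hk i.
  have e1 : val i = val idx_plus + c * n%:Z by [].
  by rewrite -(sF _ _ _ e1) -(sf _ _ _ e1).
have e1 : val i = val idx_minus + c * n%:Z by [].
by rewrite -(sF _ _ _ e1) -(sf _ _ _ e1).
Qed.
End KraLocal.

(** * The universal family *)

Section GoodReduction.
(** A / pw embeds in B and [pw] is a nonzerodivisor. This passes to polynomial rings and lets
    identities modulo [pw] be tested in a domain. *)
Definition good_reduction (A B : nzRingType) (rho : A -> B) (pw : A) :=
  [/\ rho pw = 0, forall a, rho a = 0 -> exists b, a = pw * b
    & forall a, pw * a = 0 -> a = 0].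

Lemma good_reduction_poly (A B : nzRingType) (rho : {rmorphism A -> B}) pw :
  good_reduction rho pw -> good_reduction (map_poly rho) pw%:P.
Proof.
move=> [r0 rker reg]; split; first by rewrite map_polyC /= r0.
  move=> p p0; have /choice[f fP] : forall a, exists b, rho a = 0 -> a = pw * b.
    by move=> a; have [/rker[b ->]|?] := pselect (rho a = 0); [exists b|exists 0].
  exists (\poly_(i < size p) f p`_i); apply/polyP => i; rewrite coefCM coef_poly.
  case: ltnP => [_|h]; last by rewrite nth_default ?mulr0.
  by apply: fP; rewrite -coef_map p0 coef0.
move=> p h; apply/polyP => i; rewrite coef0; apply: reg.
by rewrite -coefCM h coef0.
Qed.

Lemma good_reduction_mpoly n (A B : nzRingType) (rho : {rmorphism A -> B}) pw :
  good_reduction rho pw -> good_reduction (@map_mpoly n A B rho) pw%:MP.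
Proof.
move=> [r0 rker reg]; split.
- by apply/mpolyP => m; rewrite mcoeff_map_mpoly /= mcoeffC mcoeff0 rmorphM /= r0 mul0r.
- move=> p p0; have /choice[f fP] : forall a, exists b, rho a = 0 -> a = pw * b.
    by move=> a; have [/rker[b ->]|?] := pselect (rho a = 0); [exists b|exists 0].
  exists (\sum_(m <- msupp p) f p@_m *: 'X_[m]); rewrite {1}[p]mpolyE mulr_sumr.
  apply: eq_bigr => m _; rewrite mul_mpolyC scalerA -fP //.
  by rewrite -mcoeff_map_mpoly p0 mcoeff0.
move=> p h; apply/mpolyP => m; rewrite mcoeff0; apply: reg.
by rewrite -mcoeffCM h mcoeff0.
Qed.

Variables (A : comNzRingType) (D : idomainType) (rho : {rmorphism A -> D}).
Variables (pw al be : A).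
Hypotheses (gr : good_reduction rho pw) (be0 : rho be != 0).
Local Notation A2 := {poly {poly A}}.
Let rho1 : {rmorphism {poly A} -> {poly D}} := map_poly rho.
Let sig : {rmorphism A2 -> {poly {poly D}}} := map_poly rho1.
Let gr2 : good_reduction sig pw%:P%:P.
Proof. by do 2 apply: good_reduction_poly. Qed.
Let sker (p : A2) : sig p = 0 -> exists q, p = pw%:P%:P * q.
Proof. by case: gr2 => _ h _; exact: h. Qed.

(** The inner variable is s and the outer one t; [al] and [be] will be 2 a and b q. *)
Definition eqn1 : A2 := 'X%:P * 'X - pw%:P%:P.
Definition eqn2 : A2 := al%:P%:P * 'X - be%:P%:P.

Lemma drop_coef0 (R : nzRingType) (p : {poly R}) : p = drop_poly 1 p * 'X + (p`_0)%:P.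
Proof.
apply/polyP => i; rewrite coefD coefMX coefC coef_drop_poly.
by case: i => [|i] /=; rewrite ?add0r // addr0 addn1.
Qed.

(* Modulo [pw] the two equations become [S T = 0] and [al T = be]; as [be] is
   nonzero and involves neither [S] nor [T], they form a regular sequence. *)
Lemma regular_sequence (g h1 h2 : A2) :
    pw%:P%:P * g = eqn1 * h1 + eqn2 * h2 ->
  exists k1 k2, g = eqn1 * k1 + eqn2 * k2.
Proof.
move=> eg; have [r0 _ reg] := gr2.
have sX : sig 'X = 'X by rewrite /sig /= map_polyX.
have sS : sig 'X%:P = 'X%:P by rewrite /sig /= map_polyC /= map_polyX.
have sC a : sig a%:P%:P = (rho a)%:P%:P by rewrite /sig /= map_polyC /= map_polyC.
have s1 : sig eqn1 = 'X%:P * 'X by rewrite rmorphB rmorphM /= sX sS r0 subr0.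
have s2 : sig eqn2 = (rho al)%:P%:P * 'X - (rho be)%:P%:P.
  by rewrite rmorphB rmorphM /= sX !sC.
have e0 : 'X%:P * 'X * sig h1 + sig eqn2 * sig h2 = 0.
  by rewrite -s1 -!rmorphM -rmorphD -eg rmorphM /= r0 mul0r.
(* At t = 0 the second equation is -be, nonzero, so the reduction of h2 is divisible by t; after
   cancelling t, the same argument at s = 0 gives divisibility by s. *)
have [h hE] : exists h : A2, sig h2 = 'X%:P * 'X * sig h.
  have a0 : (sig h2)`_0 = 0.
    have := congr1 (fun p : {poly {poly D}} => p.[0]) e0.
    rewrite hornerD !hornerM hornerX mulr0 mul0r add0r s2 hornerD hornerN.
    rewrite hornerM hornerX mulr0 add0r !hornerC horner_coef0 => /eqP.
    by rewrite mulf_eq0 oppr_eq0 polyC_eq0 (negPf be0) /= => /eqP.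
  pose h2' := drop_poly 1 h2.
  have e1 : sig h2 = 'X * sig h2'.
    rewrite {1}[h2]drop_coef0 rmorphD rmorphM /= sX mulrC.
    by rewrite [map_poly _ (_)%:P]map_polyC /= -coef_map [X in X%:P]a0 addr0.
  clearbody h2'.
  have e2 : 'X%:P * sig h1 + sig eqn2 * sig h2' = 0.
    have /eqP : 'X * ('X%:P * sig h1 + sig eqn2 * sig h2') = 0.
      by rewrite -[RHS]e0 e1; ring.
    by rewrite mulf_eq0 polyX_eq0 => /eqP.
  (* Sets the inner variable s to 0. *)
  pose tau : {rmorphism {poly {poly D}} -> {poly D}} := map_poly (horner_eval (0 : D)).
  have t2 : tau (sig h2') = 0.
    have tY : tau 'X%:P = 0 by rewrite /tau /= map_polyC /= /horner_eval hornerX.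
    have /eqP := congr1 tau e2; rewrite rmorphD !rmorphM tY rmorph0 mul0r add0r mulf_eq0.
    case/orP => [/eqP h|/eqP//].
    have := congr1 (fun p : {poly D} => p`_0) h.
    rewrite coef0 s2 /tau /= coef_map /= coefB coefMX /= sub0r coefC /=.
    rewrite /horner_eval hornerN hornerC.
    by move/eqP; rewrite oppr_eq0 (negPf be0).
  exists (map_poly (drop_poly 1) h2').
  rewrite e1 [_ * 'X]mulrC -mulrA; congr (_ * _); apply/polyP => i.
  rewrite coefCM !coef_map /=.
  rewrite {1}[h2'`_i]drop_coef0 rmorphD rmorphM /= map_polyX mulrC.
  rewrite map_polyC /=.
  have /(congr1 (fun p : {poly D} => p`_i)) := t2.
  rewrite coef0 /tau /= !coef_map /= /horner_eval horner_coef0 coef_map => ->.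
  by rewrite addr0.
have [y yE] : exists y, h2 - 'X%:P * 'X * h = pw%:P%:P * y.
  by apply: sker; rewrite rmorphB !rmorphM /= sX sS hE subrr.
have [x xE] : exists x, h1 + eqn2 * h = pw%:P%:P * x.
  apply: sker; rewrite rmorphD rmorphM /=.
  have /eqP : 'X%:P * 'X * (sig h1 + sig eqn2 * sig h) = 0.
    by rewrite -[RHS]e0 hE; ring.
  by rewrite !mulf_eq0 polyC_eq0 !polyX_eq0 => /eqP.
(* Lifting gives h1 = - eqn2 h + pw x and h2 = s t h + pw y. As s t - eqn1 = pw, the terms in h add
   up to pw eqn2 h, whence h + y. *)
exists x, (h + y); apply/eqP; rewrite -subr_eq0; apply/eqP/reg.
have -> : pw%:P%:P * (g - (eqn1 * x + eqn2 * (h + y))) =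
  pw%:P%:P * g - eqn1 * (pw%:P%:P * x) - eqn2 * (pw%:P%:P * y) - pw%:P%:P * (eqn2 * h).
  by ring.
by rewrite eg -xE -yE /eqn1; ring.
Qed.
End GoodReduction.

Lemma res_good_reduction (E : ramified_quadratic) : good_reduction (@rq_res E) (piO E).
Proof.
have [p0 vp] := rq_pi_unif E; split.
- by apply/eqP; rewrite rq_res_ker /val_ge vp lexx orbT.
- move=> a /eqP; rewrite rq_res_ker => va.
  have vb : int_val a / rq_pi E \in integers (rq_v E).
    have vpi : val_ge (rq_v E) (-1) (rq_pi E)^-1.
      rewrite /val_ge invr_eq0 (negPf p0) /=.
      have := dvM (rq_v E) (invr_neq0 p0) p0; rewrite mulVf // dv1 vp; lia.
    exact: (val_geM va vpi).
  exists (IntRing vb); apply: val_inj => /=.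
  by rewrite mulrC divfK.
move=> a /(congr1 val)/= /eqP; rewrite mulf_eq0 (negPf p0) /= => /eqP a0.
exact: val_inj.
Qed.

Section MapForm.
Variables (R S : comNzRingType) (g : {rmorphism R -> S}) (n k : nat).

Lemma map_dgb chi : map_mx g (dgb R chi : 'M_n) = dgb S chi.
Proof.
by apply/matrixP => i j; rewrite mxE !dgbE rmorphMn; case: (chi i); rewrite ?rmorph1 ?rmorph0.
Qed.

Lemma map_muc : map_mx g (muc R n k) = muc S n k. Proof. exact: map_dgb. Qed.
Lemma map_nuc : map_mx g (nuc R n k) = nuc S n k. Proof. exact: map_dgb. Qed.

Lemma map_Kc : map_mx g (Kc R n k) = Kc S n k.
Proof. by apply/matrixP => i j; rewrite mxE !KcE rmorphMn rmorphXn rmorphN1. Qed.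

Lemma map_quad (z : 'rV[R]_n) :
  g (quad (Kc R n k) (muc R n k) z) = quad (Kc S n k) (muc S n k) (map_mx g z).
Proof.
by rewrite /quad /bil -map_muc -map_Kc -map_mxM map_trmx -!map_mxM [RHS]mxE.
Qed.

Lemma map_dv (z : 'rV[R]_n) t : map_mx g (vvec (muc R n k) (nuc R n k) z t) =
  vvec (muc S n k) (nuc S n k) (map_mx g z) (g t).
Proof. by rewrite /vvec map_mxD map_mxZ !map_mxM map_muc map_nuc. Qed.

Lemma map_dw (z : 'rV[R]_n) s : map_mx g (wvec (muc R n k) (nuc R n k) z s) =
  wvec (muc S n k) (nuc S n k) (map_mx g z) (g s).
Proof. by rewrite /wvec map_mxD map_mxZ !map_mxM map_muc map_nuc. Qed.

End MapForm.

Section DatumBaseChange.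
Variables (E : ramified_quadratic) (n k : nat).
Hypotheses (hn : (0 < n)%N) (hk : (2 * k < n)%N).
Local Notation OF := (OF E).
Variables (R S : comAlgType OF) (g : {lrmorphism R -> S}).

Lemma datum_map (z : 'rV[R]_n) s t a b : datum k z s t a b ->
  datum k (map_mx g z) (g s) (g t) (g a) (g b).
Proof.
move=> [st tab ch]; split.
- rewrite -rmorphM st; exact: lrmorph_pi.
- by rewrite -map_quad -!rmorphM -tab !rmorphM rmorph_nat.
case: ch => [->|[-> [i [j [y' [v' [yw vv]]]]]]]; [left|right]; rewrite rmorph1 //.
split=> //; exists i, j, (g y'), (g v').
by rewrite -map_dw -map_dv ![map_mx _ _ _ _]mxE -!rmorphM yw vv rmorph1.
Qed.

Lemma fam_map (z : 'rV[R]_n) s t a b : datum k z s t a b ->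
  bc_family g (fam z s t a b) =
    fam (map_mx g z) (g s) (g t) (g a) (g b) :> (class_idx n k -> _).
Proof.
move=> D; have D' := datum_map D; apply/funext => i.
have f1 := framed_bc g (good_frame_framed (fam_frame hk D i)).
have f2 := good_frame_framed (fam_frame hk D' i).
have gp : (g : {rmorphism R -> S}) (pi_R R) = pi_R S := lrmorph_pi g.
apply: (framed_eq f1 f2); rewrite /fam; case: ifP => _;
  apply: base_change_min; try exact: kset_submodule; move=> x /(kset_map g);
  by rewrite gp map_mxM -!map_trmx map_Kc map_dv map_dw.
Qed.
End DatumBaseChange.

Section QuadNonzero.
Variables (n k : nat) (hk : (2 * k < n)%N) (F : fieldType) (two : (2%:R : F) != 0).

(** Polarization at the basis vector of index k, counted from 0, and its mirror image: both lie in
    the middle block since 2 k < n, and they pair to 1. *)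
Lemma quad_neq0 : exists z, quad (Kc F n k) (muc F n k) z != 0.
Proof.
apply: contrapT => h0; have h z : quad (Kc F n k) (muc F n k) z = 0.
  by apply/eqP; apply: contrapT => /negP hz; apply: h0; exists z.
have hh : exists h : F, h * 2%:R = 1 by exists (2%:R^-1); rewrite mulVf.
have FA := Kc_axioms hk hh.
have kn : (k < n)%N by lia.
pose l := Ordinal kn; pose x : 'rV[F]_n := delta_mx 0 l.
pose y : 'rV[F]_n := delta_mx 0 (rev_ord l).
have := h (x + y); rewrite /quad mulmxDl !(bilDl, bilDr).
have := h x; have := h y; rewrite /quad => -> ->.
rewrite (bil_symmu FA (y *m _) x) addr0 add0r -mulr2n -mulr_natl => /eqP.
rewrite mulf_eq0 (negPf two) (bil_mu FA) -mulmxA (fa_mumu FA) /=.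
have -> : y *m muc F n k = y.
  apply/rowP => j; rewrite mul_dgbE !mxE eqxx /=.
  case: eqP => [->|]; rewrite ?mul0r // /midb /= mul1r.
  by have -> : (k <= n - k.+1 < n - k)%N by lia.
rewrite /bil -rowE /y trmx_delta -colE !mxE eqxx /= ltnn expr0 mulr1n.
by rewrite oner_eq0.
Qed.
End QuadNonzero.

Lemma poly_lift (A T : comNzRingType) (f : {rmorphism A -> T}) (u : T) :
  exists g : {rmorphism {poly A} -> T}, (forall a, g a%:P = f a) /\ g 'X = u.
Proof.
have cfu : commr_rmorph f u by move=> a; exact: mulrC.
exists (horner_morph cfu); split=> [a|]; first exact: horner_morphC.
exact: horner_morphX.
Qed.

(** * A torsion-free chart and its specializations *)

Section Chart.
Variables (E : ramified_quadratic) (n k : nat).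
Hypotheses (hn : (0 < n)%N) (hk : (2 * k < n)%N).
Local Notation OF := (OF E).
Variables (A : comNzRingType) (iota : {rmorphism OF -> A}).
Variables (Z : 'rV[A]_n) (s t al be u : A).
Let w := iota (piO E).
Let e1 := s * t - w.
Let e2 := 2%:R * t * al - be * quad (Kc A n k) (muc A n k) Z.

Definition chart_ideal : set A := [set x | exists k1 k2, x = e1 * k1 + e2 * k2].
Local Notation I := chart_ideal.

Lemma chart_ideal_ideal : is_ideal I.
Proof.
split; first by exists 0, 0; rewrite !mulr0 addr0.
move=> a _ _ [k1 [k2 ->]] [l1 [l2 ->]].
by exists (a * k1 + l1), (a * k2 + l2); ring.
Qed.

Hypothesis torsion : forall x, I (w * x) -> I x.
Hypothesis u_notin : forall N, ~ I (u ^+ N).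

Lemma chart_torsion x N : I (w ^+ N * x) -> I x.
Proof.
elim: N => [|N IH]; first by rewrite expr0 mul1r.
by rewrite exprS -mulrA => /torsion.
Qed.

Let S : set A := [set x | exists N, x = u ^+ N].
Let Spi : set A := [set x | exists N M, x = u ^+ N * w ^+ M].
Let S1 : S 1. Proof. by exists 0%N. Qed.
Let SM a b : S a -> S b -> S (a * b).
Proof. by move=> [N ->] [M ->]; exists (N + M)%N; rewrite exprD. Qed.
Let Spi1 : Spi 1. Proof. by exists 0%N, 0%N; rewrite !expr0 mulr1. Qed.
Let SpiM a b : Spi a -> Spi b -> Spi (a * b).
Proof.
move=> [N [M ->]] [N' [M' ->]]; exists (N + N')%N, (M + M')%N.
by rewrite !exprD; ring.
Qed.
Let S_disj a : S a -> ~ I a. Proof. by move=> [N ->]. Qed.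
Let Spi_disj a : Spi a -> ~ I a.
Proof. by move=> [N [M ->]]; rewrite mulrC => /chart_torsion/u_notin. Qed.

(* The universal ring and its generic fibre; the torsion hypothesis makes the
   former embed in the latter. *)
Definition univ := LocData iota S1 SM chart_ideal_ideal S_disj.
Definition univ_pi := LocData iota Spi1 SpiM chart_ideal_ideal Spi_disj.

Lemma univ_to_pi : exists g : {lrmorphism locq univ -> locq univ_pi},
  forall x, g x = 0 -> x = 0.
Proof.
have [||a [N ->]|g gE] := @locq_lift _ _ _ univ (locq univ_pi) (locq_of univ_pi).
- by move=> x; rewrite locq_algE.
- move=> x Ix; apply/locq_of_eq0; exists 1; [exact: ld_S1|by rewrite mul1r].
- by apply: locq_of_unit; exists N, 0%N; rewrite expr0 mulr1.
exists g => x gx; have [a [b [Sb e]]] := locq_frac x.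
have : locq_of univ_pi a = 0 by rewrite -gE -e rmorphM /= gx mul0r.
move=> /locq_of_eq0[_ [N [M ->]]]; rewrite -mulrA mulrCA => /chart_torsion h.
have a0 : locq_of univ a = 0 by apply/locq_of_eq0; exists (u ^+ N); [exists N|].
have [y ys] := locq_of_unit Sb.
by rewrite -[x]mulr1 -ys mulrCA e a0 mulr0.
Qed.

Lemma univ_pi_unit : exists y : locq univ_pi, y * pi_R (locq univ_pi) = 1.
Proof.
rewrite /pi_R locq_algE; apply: locq_of_unit.
by exists 0%N, 1%N; rewrite expr0 mul1r expr1.
Qed.

Lemma univ_eq (x : A) : I x -> locq_of univ x = 0.
Proof. by move=> Ix; apply/locq_of_eq0; exists 1; [exact: ld_S1|rewrite mul1r]. Qed.

Hypothesis u_chart : forall (T : comNzRingType) (f : {rmorphism A -> T}),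
  (exists y, y * f u = 1) ->
  chart (muc T n k) (nuc T n k) (map_mx f Z) (f s) (f t) (f al) (f be).

Local Notation q := (locq_of univ).

Lemma univ_datum : datum k (map_mx q Z) (q s) (q t) (q al) (q be).
Proof.
split.
- apply/eqP; rewrite -rmorphM -subr_eq0 /pi_R locq_algE -rmorphB; apply/eqP/univ_eq.
  by exists 1, 0; rewrite mulr0 addr0 mulr1.
- rewrite -map_quad -(rmorph_nat q) -!rmorphM; apply/eqP; rewrite -subr_eq0 -rmorphB.
  by apply/eqP/univ_eq; exists 0, 1; rewrite mulr0 add0r mulr1.
by apply: u_chart; apply: locq_of_unit; exists 1%N.
Qed.

(** On the universal family Y is given by an ideal J. It dies in the generic fibre, which Y
    contains, and the chart ring embeds there, so J = 0 and Y contains every specialization. *)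
Lemma chart_Mloc (L : comAlgType OF) (phi : {rmorphism A -> L}) :
    (forall x, phi (iota x) = x%:A) -> (exists y, y * phi u = 1) ->
    datum k (map_mx phi Z) (phi s) (phi t) (phi al) (phi be) ->
  @M_loc E n k L (fam (map_mx phi Z) (phi s) (phi t) (phi al) (phi be)).
Proof.
move=> phio [y yu] D; split; first exact: fam_naive.
move=> Y [Ysub Ymap Ycl] Ygen.
have phiI x : I x -> phi x = 0.
  case: D => st tab _ [k1 [k2 ->]].
  rewrite rmorphD !rmorphM.
  have -> : phi e1 = 0 by rewrite rmorphB rmorphM st phio subrr.
  have -> : phi e2 = 0 by rewrite rmorphB !rmorphM rmorph_nat tab map_quad subrr.
  by rewrite !mul0r addr0.
have [//|//|_ [N ->]|g gE] := @locq_lift _ _ _ univ L phi.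
  by exists (y ^+ N); rewrite rmorphXn -exprMn yu expr1n.
have [h hinj] := univ_to_pi.
have D' := univ_datum.
have [J Ji JY] := Ycl _ _ (fam_naive hn hk D').
have J0 x : J x -> x = 0.
  move=> Jx; apply: hinj; apply: (JY _ h).1 Jx.
  apply: (Ygen _ univ_pi_unit); rewrite (fam_map hk h D').
  exact: (fam_naive hn hk (datum_map h D')).
have : Y L (bc_family g (fam (map_mx q Z) (q s) (q t) (q al) (q be))).
  by apply/JY => x /J0->; rewrite rmorph0.
rewrite (fam_map hk g D') !gE.
suff -> : map_mx g (map_mx q Z) = map_mx phi Z by [].
by apply/rowP => i; rewrite !mxE gE.
Qed.
End Chart.

Section Universal.
Variables (E : ramified_quadratic) (n k : nat).
Hypotheses (hn : (0 < n)%N) (hk : (2 * k < n)%N).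
Local Notation OF := (OF E).
Local Notation MP := {mpoly OF[n]}.
Local Notation P0 := {poly MP}.
Local Notation P2 := {poly {poly P0}}.

(** P2 is O_F[z_1, ..., z_n, c, s, t] with c the free one of a and b; s and t are adjoined last, to
    match [regular_sequence]. *)
Definition uP : {rmorphism P0 -> P2} := polyC \o polyC.
Definition uM : {rmorphism MP -> P2} := uP \o polyC.
Definition uiota : {rmorphism OF -> P2} := uM \o @mpolyC n OF.
Definition uX : 'rV[MP]_n := \row_i 'X_i.
Definition uZ : 'rV[P2]_n := map_mx uM uX.
Definition uc : P0 := 'X.
Definition us : P2 := 'X%:P.
Definition ut : P2 := 'X.
Definition uq : P0 := (quad (Kc MP n k) (muc MP n k) uX)%:P.

Lemma uqE : uP uq = quad (Kc P2 n k) (muc P2 n k) uZ.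
Proof. exact: (map_quad uM). Qed.

Lemma universal_eval (L : comAlgType OF) (z : 'rV[L]_n) (c s t : L) :
  exists phi : {rmorphism P2 -> L}, [/\ forall x, phi (uiota x) = x%:A,
    map_mx phi uZ = z, phi (uP uc) = c, phi us = s & phi ut = t].
Proof.
pose f0 : {rmorphism MP -> L} := mmap (@GRing.in_alg OF L) (z 0).
have f0X i : f0 'X_i = z 0 i by rewrite /f0 /= mmapX mmap1U.
have f0C x : f0 x%:MP = x%:A by rewrite /f0 /= mmapC.
have [f1 [f1C f1X]] := poly_lift f0 c.
have [f2 [f2C f2X]] := poly_lift f1 s.
have [f3 [f3C f3X]] := poly_lift f2 t.
exists f3; split.
- by move=> x; rewrite -f0C -f1C -f2C -f3C.
- by apply/rowP => i; rewrite mxE mxE -f0X -f1C -f2C -f3C mxE.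
- by rewrite -f1X -f2C -f3C.
- by rewrite -f2X -f3C.
exact: f3X.
Qed.

Let pw : P0 := (piO E)%:MP%:P.
Let rho0 : {rmorphism P0 -> {poly {mpoly (rq_k E)[n]}}} := map_poly (map_mpoly (@rq_res E)).

Lemma universal_reduction : good_reduction rho0 pw.
Proof. by apply/good_reduction_poly/good_reduction_mpoly/res_good_reduction. Qed.

(** A nonzero value of q over the residue field, which has odd characteristic, witnesses that the
    polynomial is nonzero. *)
Lemma uq_neq0 : rho0 uq != 0.
Proof.
have two : (2%:R : rq_k E) != 0.
  by apply: contra (rq_odd E) => h; rewrite inE /= h.
have [z zq] := quad_neq0 hk two.
pose ev : {rmorphism {mpoly (rq_k E)[n]} -> rq_k E} := mmap idfun (z 0).
pose r1 : {rmorphism MP -> {mpoly (rq_k E)[n]}} := map_mpoly (@rq_res E).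
have rq : rho0 uq = (r1 (quad (Kc MP n k) (muc MP n k) uX))%:P by exact: map_polyC.
apply: contra zq; rewrite rq polyC_eq0 => /eqP /(congr1 ev); rewrite rmorph0 !map_quad.
suff -> : map_mx ev (map_mx r1 uX) = z by move=> ->.
apply/rowP => i; rewrite mxE mxE mxE.
by rewrite /ev /r1 /= map_mpolyX mmapX mmap1U.
Qed.

Lemma chart_ideal_torsion (al be : P0) : rho0 be != 0 ->
  forall x, chart_ideal k uiota uZ us ut (uP al) (uP be) (uiota (piO E) * x) ->
    chart_ideal k uiota uZ us ut (uP al) (uP be) x.
Proof.
move=> be0 x.
have e2E : 2%:R * ut * uP al - uP be * quad (Kc P2 n k) (muc P2 n k) uZ =
    eqn2 (2%:R * al) (be * uq).
  rewrite -uqE -(rmorph_nat uP) mulrAC -!rmorphM; exact: erefl.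
have bq : rho0 (be * uq) != 0 by rewrite rmorphM mulf_neq0 // uq_neq0.
rewrite /chart_ideal e2E => -[h1 [h2 h]].
exact: (regular_sequence universal_reduction bq h).
Qed.

Lemma datum_Mloc (L : comAlgType OF) (z : 'rV[L]_n) s t a b :
  datum k z s t a b -> @M_loc E n k L (fam z s t a b).
Proof.
move=> D; have [st tab ch] := D.
have key (al be : P0) (u : P2) (phi : {rmorphism P2 -> L}) : rho0 be != 0 ->
    (forall (T : comNzRingType) (f : {rmorphism P2 -> T}), (exists y, y * f u = 1) ->
      chart (muc T n k) (nuc T n k) (map_mx f uZ) (f us) (f ut) (f (uP al)) (f (uP be))) ->
    phi (uP al) = a -> phi (uP be) = b -> phi us = s -> phi ut = t -> map_mx phi uZ = z ->
    (forall x, phi (uiota x) = x%:A) -> (exists y, y * phi u = 1) ->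
    @M_loc E n k L (fam z s t a b).
  move=> be0 uch phia phib phis phit phiz phio [y yu].
  (* The given point itself shows that the chart is not empty: [phi] kills the ideal and sends u to
     a unit. *)
  have nI N : ~ chart_ideal k uiota uZ us ut (uP al) (uP be) (u ^+ N).
    move=> [k1 [k2 h]].
    have : phi (u ^+ N) = 0.
      rewrite h rmorphD !rmorphM !rmorphB !rmorphM phis phit st phio subrr mul0r add0r.
      by rewrite rmorph_nat map_quad phia phib phiz tab subrr mul0r.
    move=> /(congr1 (fun x => y ^+ N * x)); rewrite rmorphXn -exprMn yu expr1n mulr0.
    by move=> /eqP; rewrite oner_eq0.
  rewrite -phiz -phis -phit -phia -phib.
  apply: (chart_Mloc hn hk (chart_ideal_torsion be0) nI uch phio); first by exists y.
  by rewrite phiz phis phit phia phib.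
case: ch => [a1|[b1 [i [j [y' [v' [yw vv]]]]]]].
  have [phi [phio phiz phic phis phit]] := universal_eval z b s t.
  apply: (key 1 uc 1 phi) => //.
  - by rewrite /rho0 /= map_polyX polyX_eq0.
  - by move=> T f _; left; rewrite !rmorph1.
  - by rewrite !rmorph1 a1.
  by exists 1; rewrite rmorph1 mulr1.
have [phi [phio phiz phic phis phit]] := universal_eval z a s t.
(* Inverting this product of an entry of w and an entry of v makes both units, which is the extra
   demand of the chart b = 1. *)
pose u : P2 := wvec (muc P2 n k) (nuc P2 n k) uZ us 0 i * vvec (muc P2 n k) (nuc P2 n k) uZ ut 0 j.
have uE (T : comNzRingType) (f : {rmorphism P2 -> T}) : f u =
    wvec (muc T n k) (nuc T n k) (map_mx f uZ) (f us) 0 i *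
    vvec (muc T n k) (nuc T n k) (map_mx f uZ) (f ut) 0 j.
  rewrite rmorphM -map_dw -map_dv [map_mx f _ _ _ in RHS]mxE.
  by rewrite [X in _ = _ * X]mxE.
clearbody u; apply: (key uc 1 u phi) => //.
- by rewrite rmorph1 oner_neq0.
- move=> T f [y]; rewrite uE => yu; right; rewrite !rmorph1; split=> //.
  move: yu; set W := wvec _ _ _ _ 0 i; set V := vvec _ _ _ _ 0 j => yu.
  by exists i, j, (y * V), (y * W); split; rewrite -[RHS]yu /W /V; ring.
- by rewrite !rmorph1 b1.
by exists (y' * v'); rewrite uE phiz phis phit mulrACA yw vv mulr1.
Qed.
End Universal.

Lemma local_zero (O : comNzRingType) (R : comAlgType O) (a : R) :
    (forall (L : comAlgType O) (g : {lrmorphism R -> L}) (K : fieldType)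
       (rho : {rmorphism L -> K}), is_local rho -> g a = 0) -> a = 0.
Proof.
move=> h; apply/eqP; apply: contrapT => /negP/localize[L [g [K [rho [loc ga]]]]].
by move: ga; rewrite (h L g K rho loc) eqxx.
Qed.

(** * Descent to arbitrary rings *)

Section Descent.
Variables (E : ramified_quadratic) (n k : nat).
Hypotheses (hn : (0 < n)%N) (hk : (2 * k < n)%N).
Local Notation OF := (OF E).
Variables (R : comAlgType OF) (F0 F : class_idx n k -> set (lat_space n R)).
Hypothesis Kra : M_Kra (F0, F).

Lemma Kra_local_Mloc (L : comAlgType OF) (g : {lrmorphism R -> L}) (K : fieldType)
    (rho : {rmorphism L -> K}) : is_local rho -> @M_loc E n k L (bc_family g F).
Proof.
move=> loc; have := Kra_local hn hk loc (Kra_base_change hn hk g Kra).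
by move=> [z [s [t [a [b [D ->]]]]]]; exact: datum_Mloc.
Qed.

(** An equality of polynomials can be checked coefficientwise in local rings, where F is one of the
    explicit families. *)
Lemma Kra_LM5 : LM5 F.
Proof.
case: Kra => -[h1 _ _ _] _ _ _ i; have [Fs _ FP] := h1 i.
have [P PF] := projector_exists Fs; exists P => //.
set d := \det _; set p := _ * _; apply/eqP; rewrite -subr_eq0; apply/eqP/polyP => j.
rewrite coef0; apply: local_zero => L g K rho loc.
have [[hL1 _ _ _ hL5] _] := Kra_local_Mloc g loc.
have [_ _ FPL] := hL1 i.
have := charpoly_projector FPL (bc_projector g PF) (hL5 i).
suff -> : \det (map_mx polyC (1%:M - map_mx g P) + map_mx polyC (map_mx g P) *m
    ('X%:M - map_mx polyC (lat_tensor_mx L (val i) (val i) (@scale_pi E n)))) = map_poly g d.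
  move=> e; rewrite -coef_map rmorphB /= e; suff -> : map_poly g p =
    ('X + (pi_R L)%:P) ^+ n.-1 * ('X - (pi_R L)%:P) by rewrite subrr coef0.
  rewrite rmorphM rmorphXn rmorphB rmorphD /= map_polyX map_polyC /=.
  by rewrite (lrmorph_pi g).
have gC a b (M : 'M[R]_(a, b)) : map_mx (map_poly g) (map_mx polyC M) = map_mx polyC (map_mx g M).
  by apply/matrixP => l m; rewrite !mxE /= map_polyC.
rewrite /d -[RHS]det_map_mx; congr determinant.
rewrite [RHS]map_mxD [in RHS]map_mxM !gC [in RHS]map_mxB [in RHS]map_mx1.
rewrite [X in _ = _ + _ *m X]map_mxB map_scalar_mx gC (map_lat_tensor g).
by rewrite /= map_polyX.
Qed.

(** The ideal that Y defines at F vanishes in every local ring of R, so it is zero, and the identity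
    of R exhibits F as a point of Y. *)
Lemma Kra_Mloc : M_loc F.
Proof.
have naive : M_naive F.
  by case: (Kra) => -[h1 h2 h3 h4] _ _ _; split=> //; exact: Kra_LM5.
split=> // Y Yc Yg; have [Ysub Ymap Ycl] := Yc.
have [J Ji JY] := Ycl _ _ naive.
have J0 x : J x -> x = 0.
  move=> Jx; apply: local_zero => L g K rho loc.
  have [_ /(_ Y Yc Yg) YL] := Kra_local_Mloc g loc.
  exact: (JY _ g).1 YL _ Jx.
have := (JY R (idfun : {lrmorphism R -> R})).2 J0.
suff -> : bc_family idfun F = F by [].
apply/funext => i; apply: base_change_id => //.
by case: naive => h1 _ _ _ _; have [[]] := h1 i.
Qed.
End Descent.

Theorem theorem1p4p1 (E : ramified_quadratic) (n k : nat)
    (hn : (3 <= n)%N) (hk : (2 * k <= n)%N) (hnk : (2 * k)%N <> n) :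
  (forall (R : comAlgType (OF E)) (F0 F : class_idx n k -> set (lat_space n R)),
     M_Kra (F0, F) -> M_loc F)
  /\ (forall R : comAlgType (OF E),
     @M_nspl E n k R = @M_Kra E n k R).
Proof.
have n0 : (0 < n)%N by apply: leq_trans hn.
have kn : (2 * k < n)%N by rewrite ltn_neqAle hk andbT; apply/eqP.
have Mloc (R : comAlgType (OF E)) (F0 F : class_idx n k -> set (lat_space n R)) :
  M_Kra (F0, F) -> M_loc F by exact: Kra_Mloc.
split=> // R; apply/seteqP; split=> [x []//|[F0 F] KF].
by split=> //; exact: Mloc KF.
Qed.
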